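(* Let $Q\subset\mathbb{H}^3$ be a finite-sided convex hyperbolic polyhedron of finite volume, all of whose dihedral angles are submultiples of $\pi$, and let $G$ be the discrete group of reflections in $Q$ (the group generated by the reflections of $\mathbb{H}^3$ in the sides of $Q$). Then $G$ contains an index $2$ Kleinian subgroup which admits a Double Dirichlet domain, and which also admits a DF domain if $Q$ has an ideal vertex (placed, by conjugation, at $\infty$).
   Context: $\mathbb{H}^3$ is upper half-space $\mathbb{C}\times(0,\infty)$ with hyperbolic distance $d$; orientation-preserving isometries are identified with $\mathrm{PSL}_2(\mathbb{C})$. A Kleinian group is a discrete subgroup of $\mathrm{PSL}_2(\mathbb{C})$. A submultiple of $\pi$ is an angle $\pi/k$ with $k\ge2$ an integer. A fundamental domain for a Kleinian group $\Gamma$ is a closed convex polyhedron whose $\Gamma$-translates cover $\mathbb{H}^3$ and whose interior is disjoint from its translates by nontrivial elements of $\Gamma$. The Dirichlet domain of $\Gamma$ centered at $w_0\in\mathbb{H}^3$ is $\{x\in\mathbb{H}^3: d(x,w_0)\le d(x,\alpha(w_0))\ \forall\,1\ne\alpha\in\Gamma\}$. Ford domain: suppose the stabilizer $\Gamma_\infty<\Gamma$ of $\infty$ contains a copy of $\mathbb{Z}^2$. For $\gamma=\pm\begin{pmatrix}a&b\\c&d\end{pmatrix}\in\Gamma\setminus\Gamma_\infty$, the isometric sphere $S_\gamma$ is the hemisphere in $\mathbb{H}^3$ with center $-d/c\in\mathbb{C}$ and radius $1/|c|$. A Ford domain is the intersection of the set of points lying on or outside all isometric spheres $S_\gamma$,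 $\gamma\in\Gamma\setminus\Gamma_\infty$, with a fundamental domain for the action of $\Gamma_\infty$ that is the vertical chimney above a fundamental polygon for $\Gamma_\infty$ acting on $\mathbb{C}$. A DF domain for $\Gamma$ is a fundamental domain for $\Gamma$ which is both a Ford domain and a Dirichlet domain for some center in $\mathbb{H}^3$. A Double Dirichlet domain for $\Gamma$ is a fundamental domain for $\Gamma$ which is the Dirichlet domain centered at $w_0$ and also the one centered at $w_1$, for some $w_0\ne w_1$ in $\mathbb{H}^3$. *)

(* Defs.v *)
From HB Require Import structures.
From mathcomp Require Import all_boot all_order all_algebra.
From mathcomp Require Import all_classical all_reals all_analysis.
From mathcomp Require Import complex.
Import Order.TTheory GRing.Theory Num.Theory.

Set Implicit Arguments.
Unset Strict Implicit.
Unset Printing Implicit Defensive.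

Local Open Scope classical_set_scope.
Local Open Scope ring_scope.
Local Open Scope complex_scope.

Local Notation normc := ComplexField.Normc.normc.

Section HyperbolicSpace.
Variable R : realType.

(* The point (hz, ht) of the upper half-space C x (0, oo). *)
Record H3 := MkH3 { hz : R[i]; ht : R; ht_gt0 : 0 < ht }.

(* The real inner product on C = R^2. *)
Definition cdot (u v : R[i]) : R :=
  complex.Re u * complex.Re v + complex.Im u * complex.Im v.

Definition arcosh (u : R) : R := ln (u + Num.sqrt (u ^+ 2 - 1)).

Definition hdist (x y : H3) : R :=
  arcosh (1 + (normc (hz x - hz y) ^+ 2 + (ht x - ht y) ^+ 2)
              / (2 * ht x * ht y)).

Definition hball (x : H3) (e : R) : set H3 := [set y | hdist x y < e].

Definition hinterior (A : set H3) : set H3 :=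
  [set x | exists2 e : R, 0 < e & hball x e `<=` A].

(* Volume is computed in the coordinates (x, y, t) with z = x + iy, with the hyperbolic
   density t^-3. *)
Definition hcoords (A : set H3) : set (R * R * R) :=
  [set (complex.Re (hz x), complex.Im (hz x), ht x) | x in A].

Definition hvolume (A : set H3) : \bar R :=
  (\int[(lebesgue_measure \x lebesgue_measure) \x lebesgue_measure]_(p in
      hcoords A) ((p.2 ^+ 3)^-1)%:E)%E.

(* Hyperbolic planes: the vertical plane <u, z> = s, or the hemisphere with
   center c in C and radius r. *)
Variant hplane :=
  | Vertical (u : R[i]) (s : R) of u != 0
  | Hemisphere (c : R[i]) (r : R) of 0 < r.

(* An oriented plane stands for one of the two closed half-spaces it bounds;
   the boolean [true] reverses the side. *)
Definition oplane : Type := (hplane * bool)%type.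

Definition hlevel (p : hplane) (x : H3) : R :=
  match p with
  | Vertical u s _ => cdot u (hz x) - s
  | Hemisphere c r _ => normc (hz x - c) ^+ 2 + ht x ^+ 2 - r ^+ 2
  end.

Definition hplane_set (p : hplane) : set H3 := [set x | hlevel p x = 0].

Definition halfspace (h : oplane) : set H3 :=
  [set x | (-1) ^+ h.2 * hlevel h.1 x <= 0].

(* A Euclidean normal vector at x, in C x R, to the boundary of [halfspace h],
   pointing out of [halfspace h] (half the gradient of [hlevel] if the boundary
   is a hemisphere). *)
Definition onormal (h : oplane) (x : H3) : R[i] * R :=
  let n := match h.1 with
           | Vertical u _ _ => (u, 0)
           | Hemisphere c _ _ => (hz x - c, ht x)
           end in
  (((-1) ^+ h.2)%:C * n.1, (-1) ^+ h.2 * n.2).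

Definition edot (v w : R[i] * R) : R := cdot v.1 w.1 + v.2 * w.2.

Definition eangle (v w : R[i] * R) : R :=
  acos (edot v w / (Num.sqrt (edot v v) * Num.sqrt (edot w w))).

(* The model is conformal, so the interior angle at x of the wedge
   [halfspace h `&` halfspace k] is Euclidean: it is the supplement of the angle
   between the outward normals. *)
Definition dihedral_angle (h k : oplane) (x : H3) : R :=
  pi - eangle (onormal h x) (onormal k x).

Lemma reflect_gt0 (p : hplane) (x : H3) :
  0 < match p with
      | Vertical _ _ _ => ht x
      | Hemisphere c r _ => r ^+ 2 * ht x / (normc (hz x - c) ^+ 2 + ht x ^+ 2)
      end.
Proof.
case: p => [_ _ _|c r r0]; first exact: ht_gt0.
have t0 := ht_gt0 x.
by rewrite divr_gt0 ?mulr_gt0 ?exprn_gt0// ltr_wpDl ?sqr_ge0 ?exprn_gt0.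
Qed.

(* Euclidean reflection in a vertical plane, inversion in a hemisphere. *)
Definition reflect (p : hplane) (x : H3) : H3 :=
  MkH3 (match p with
        | Vertical u s _ =>
            hz x - (2 * (cdot u (hz x) - s) / normc u ^+ 2)%:C * u
        | Hemisphere c r _ =>
            c + (r ^+ 2 / (normc (hz x - c) ^+ 2 + ht x ^+ 2))%:C * (hz x - c)
        end)
       (reflect_gt0 p x).

Definition locally_finite (F : set oplane) : Prop :=
  forall x, exists2 e : R, 0 < e &
    finite_set [set h | F h /\ hplane_set h.1 `&` hball x e !=set0].

Definition convex_polyhedron (D : set H3) : Prop :=
  hinterior D !=set0 /\
  exists2 F : set oplane, locally_finite F & D = \bigcap_(h in F) halfspace h.

Definition finite_sided_polyhedron (D : set H3) : Prop :=
  hinterior D !=set0 /\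
  exists2 F : set oplane, finite_set F & D = \bigcap_(h in F) halfspace h.

(* Q lies in [halfspace h] and meets its boundary plane in a two-dimensional
   set; that set is the side of Q. *)
Definition is_side (Q : set H3) (h : oplane) : Prop :=
  Q `<=` halfspace h /\
  exists x, hplane_set h.1 x /\
    exists2 e : R, 0 < e & hplane_set h.1 `&` hball x e `<=` Q.

Definition side_inter (Q : set H3) (h k : oplane) : set H3 :=
  Q `&` hplane_set h.1 `&` hplane_set k.1.

(* The sides in two distinct planes share an edge of Q, rather than at most a
   vertex, when they have at least two common points. *)
Definition adjacent_sides (Q : set H3) (h k : oplane) : Prop :=
  [/\ is_side Q h, is_side Q k, hplane_set h.1 <> hplane_set k.1 &
      exists x y, [/\ side_inter Q h k x, side_inter Q h k y & x <> y]].

Definition submultiple_of_pi (a : R) : Prop :=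
  exists2 k : nat, (2 <= k)%N & a = pi / k%:R.

Definition dihedral_angles_submultiples (Q : set H3) : Prop :=
  forall h k x, adjacent_sides Q h k -> side_inter Q h k x ->
    submultiple_of_pi (dihedral_angle h k x).

Definition is_group (G : set (H3 -> H3)) : Prop :=
  [/\ G id,
      forall f g, G f -> G g -> G (f \o g) &
      forall f, G f -> exists g, [/\ G g, f \o g = id & g \o f = id]].

Definition generated (S : set (H3 -> H3)) : set (H3 -> H3) :=
  smallest is_group S.

Definition reflection_group (Q : set H3) : set (H3 -> H3) :=
  generated [set reflect h.1 | h in is_side Q].

Definition left_cosets (G K : set (H3 -> H3)) : set (set (H3 -> H3)) :=
  [set [set g \o k | k in K] | g in G].

Definition index2_subgroup (G K : set (H3 -> H3)) : Prop :=
  [/\ is_group K, K `<=` G & (left_cosets G K #= `I_2)%card].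

(* Elements of PSL_2(C) are handled through their lifts to SL_2(C): the isometry
   of H3 induced by A is the same for A and - A. *)
Definition SL2 : Type := {A : 'M[R[i]]_2 | \det A == 1}.

Definition ma (A : SL2) : R[i] := val A ord0 ord0.
Definition mb (A : SL2) : R[i] := val A ord0 ord_max.
Definition mc (A : SL2) : R[i] := val A ord_max ord0.
Definition md (A : SL2) : R[i] := val A ord_max ord_max.

Definition mobius_denom (A : SL2) (x : H3) : R :=
  normc (mc A * hz x + md A) ^+ 2 + normc (mc A) ^+ 2 * ht x ^+ 2.

Lemma normc_sqr_gt0 (z : R[i]) : z != 0 -> 0 < normc z ^+ 2.
Proof.
move=> z0; rewrite lt0r sqr_ge0 andbT sqrf_eq0.
by apply: contra z0 => /eqP/ComplexField.Normc.eq0_normc ->.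
Qed.

Lemma mobius_denom_gt0 (A : SL2) (x : H3) : 0 < mobius_denom A x.
Proof.
have t0 := ht_gt0 x.
rewrite /mobius_denom; have [c0|c0] := eqVneq (mc A) 0.
  have d0 : md A != 0.
    apply/eqP => d0; have := eqP (valP A).
    rewrite (expand_det_row _ ord_max) !big_ord_recl big_ord0 addr0.
    have -> : lift ord0 ord0 = ord_max :> 'I_2 by apply/val_inj.
    rewrite -/(mc A) -/(md A) c0 d0 !mul0r addr0 => /esym/eqP.
    by rewrite oner_eq0.
  rewrite c0 mul0r add0r; apply: ltr_pwDl; first exact: normc_sqr_gt0.
  by apply: mulr_ge0; exact: sqr_ge0.
apply: ltr_wpDl; first exact: sqr_ge0.
by apply: mulr_gt0; [exact: normc_sqr_gt0|exact: exprn_gt0].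
Qed.

Lemma mobius_ht_gt0 (A : SL2) (x : H3) : 0 < ht x / mobius_denom A x.
Proof. by rewrite divr_gt0 ?ht_gt0 ?mobius_denom_gt0. Qed.

(* The Poincare extension to H3 of z |-> (az + b) / (cz + d). *)
Definition mobius (A : SL2) (x : H3) : H3 :=
  MkH3 (((ma A * hz x + mb A) * conjc (mc A * hz x + md A)
         + ma A * conjc (mc A) * (ht x ^+ 2)%:C)
        * ((mobius_denom A x)^-1)%:C)
       (mobius_ht_gt0 A x).

(* The action on the sphere at infinity; [None] is the point oo. *)
Definition mobius_bd (A : SL2) (v : option R[i]) : option R[i] :=
  match v with
  | None => if mc A == 0 then None else Some (ma A / mc A)
  | Some z => if mc A * z + md A == 0 then None
              else Some ((ma A * z + mb A) / (mc A * z + md A))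
  end.

Definition SL2_lift (K : set (H3 -> H3)) : set SL2 :=
  [set A | K (mobius A)].

Definition kleinian (K : set (H3 -> H3)) : Prop :=
  [/\ is_group K,
      K `<=` range mobius &
      forall A, SL2_lift K A -> exists2 e : R, 0 < e &
        forall B, SL2_lift K B ->
          (forall i j, normc (val A i j - val B i j) < e) -> B = A].

(* M K M^-1, where M is the isometry induced by A *)
Definition conj_group (A : SL2) (K : set (H3 -> H3)) : set (H3 -> H3) :=
  [set h : H3 -> H3 | exists2 g, K g & h \o mobius A = mobius A \o g].

Definition fundamental_domain (K : set (H3 -> H3)) (D : set H3) : Prop :=
  [/\ convex_polyhedron D,
      \bigcup_(g in K) (g @` D) = setT &
      forall g, K g -> g <> id -> hinterior D `&` g @` hinterior D = set0].

Definition dirichlet_domain (K : set (H3 -> H3)) (w : H3) : set H3 :=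
  [set x | forall g, K g -> g <> id -> hdist x w <= hdist x (g w)].

Definition stab_infty (K : set (H3 -> H3)) : set (H3 -> H3) :=
  [set mobius A | A in [set A | SL2_lift K A /\ mobius_bd A None = None]].

Definition contains_Z2 (K : set (H3 -> H3)) : Prop :=
  exists phi : int * int -> (H3 -> H3),
    [/\ injective phi, forall a b, phi (a + b) = phi a \o phi b &
        forall a, K (phi a)].

Definition outside_isometric_spheres (K : set (H3 -> H3)) : set H3 :=
  [set x | forall A, (K `\` stab_infty K) (mobius A) ->
     (1 / normc (mc A)) ^+ 2
       <= normc (hz x - (- md A / mc A)) ^+ 2 + ht x ^+ 2].

Definition cinterior (P : set R[i]) : set R[i] :=
  [set z | exists2 e : R, 0 < e & forall w, normc (z - w) < e -> P w].

Definition convex_polygon (P : set R[i]) : Prop :=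
  cinterior P !=set0 /\
  exists2 F : set (R[i] * R), finite_set F /\ (forall l, F l -> l.1 != 0) &
    P = \bigcap_(l in F) [set z | cdot l.1 z <= l.2].

Definition bd_image (A : SL2) (P : set R[i]) : set R[i] :=
  [set w | exists2 z, P z & mobius_bd A (Some z) = Some w].

(* For a group fixing oo, hence acting on C. *)
Definition fundamental_polygon (K : set (H3 -> H3)) (P : set R[i]) : Prop :=
  [/\ convex_polygon P,
      \bigcup_(A in SL2_lift K) bd_image A P = setT &
      forall A, SL2_lift K A -> mobius A <> id ->
        cinterior P `&` bd_image A (cinterior P) = set0].

Definition chimney (P : set R[i]) : set H3 := [set x | P (hz x)].

Definition ford_domain (K : set (H3 -> H3)) (D : set H3) : Prop :=
  contains_Z2 (stab_infty K) /\
  exists P, [/\ fundamental_polygon (stab_infty K) P,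
                fundamental_domain (stab_infty K) (chimney P) &
                D = outside_isometric_spheres K `&` chimney P].

Definition DF_domain (K : set (H3 -> H3)) (D : set H3) : Prop :=
  [/\ fundamental_domain K D, ford_domain K D &
      exists w, D = dirichlet_domain K w].

Definition double_dirichlet_domain (K : set (H3 -> H3)) (D : set H3) : Prop :=
  fundamental_domain K D /\
  exists w0 w1, [/\ w0 <> w1, D = dirichlet_domain K w0 &
                    D = dirichlet_domain K w1].

(* The points at infinity of the closure of Q in the closed ball; for Q
   finite-sided of finite volume these are its ideal vertices. *)
Definition ideal_vertex (Q : set H3) (v : option R[i]) : Prop :=
  match v with
  | None => forall M : R, exists2 x, Q x & M < normc (hz x) ^+ 2 + ht x ^+ 2
  | Some z => forall e : R, 0 < e ->
      exists2 x, Q x & normc (hz x - z) ^+ 2 + ht x ^+ 2 < e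
  end.

End HyperbolicSpace.

(* Main.v *)
(* In the Lorentz space of Hermitian 2x2 matrices, where hyperbolic space is the
   hyperboloid lb v v = -1, the reflections in the sides of Q are the linear
   reflections in their unit normals.  The projections of a point common to the
   planes of two sides onto these sides coincide (dihedral angles are not
   obtuse), so the planes of two sides either meet along an edge of Q or do not
   meet; hence the Gram matrix is that of a Coxeter group, and Tits' argument
   writes every element as a word w each of whose letters carries the image of
   the chamber under the letters after it across a wall, away from the chamber;
   so lb v (w x) <= lb v x for all v and x in the closed chamber.

   K is the group of even words.  If w0 is an interior point of a side t, its
   orbit under K is its orbit under G, because the reflection tau in t fixes it;
   therefore the Dirichlet domain of K centered at w0 is the union of Q and
   tau Q, for every choice of w0 in t.

   For an isotropic v, lb v compares heights of horospheres.  If oo is an ideal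
   vertex and t a vertical side, the same inequality shows that the points of
   Q and tau Q are the highest of their orbits, and this is the Ford condition.
   Finiteness of the volume makes the cross-section of the vertical sides
   bounded, so that the stabilizer of oo, generated by them, contains two
   independent translations. *)

From HB Require Import structures.
From mathcomp Require Import all_boot all_order all_algebra.
From mathcomp Require Import all_classical all_reals all_analysis.
From mathcomp Require Import complex measurable_realfun.
From mathcomp Require Import ring lra zify.
Require Import Defs.
Import Order.TTheory GRing.Theory Num.Theory.
Import numFieldNormedType.Exports.

Set Implicit Arguments.
Unset Strict Implicit.
Unset Printing Implicit Defensive.

Local Open Scope classical_set_scope.
Local Open Scope ring_scope.
Local Notation normc := ComplexField.Normc.normc.

(** * Lorentz space and words in reflections *)

(** The hypothesis on angles speaks only of sides that share an edge, whereas Tits' argument needs a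
    condition on every pair of normals. Two planes could a priori cross away from Q, or meet Q in a
    single vertex; excluding this from local data is the geometric core, and it is where non-obtuse
    angles and the Farkas lemma enter.

    No presentation of G and no tessellation theorem is assumed. Word length is measured in the
    group of linear maps generated by the reflections. The equality case of the inequality on the
    closed chamber matters as much as the inequality: if w x is as close to v as x is, then w x = u
    x for some u fixing v. This is what identifies the Dirichlet domain exactly instead of merely
    enclosing Q and tau Q in it.

    Even words form a proper subgroup because an odd word acts as an element of SL2 composed with
    complex conjugation, and such a map is never induced by SL2 alone.

    Volume is used only through a packing bound: finitely many separated points at a fixed depth
    inside Q. This statement survives conjugation, so moving the ideal vertex to infinity requires
    no change of variables in integrals. *)

Section LorentzSpace.
Variable R : realType.

Definition lorentz : Type := (R^o * R^o * R^o * R^o)%type.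
HB.instance Definition _ := GRing.Lmodule.on lorentz.

(* Minus the polarized determinant, (a, b, p, q) being the Hermitian matrix
   [[q, a + ib], [a - ib, p]]. *)
Definition lb (v w : lorentz) : R :=
  v.1.1.1 * w.1.1.1 + v.1.1.2 * w.1.1.2 - (v.1.2 * w.2 + v.2 * w.1.2) / 2.

Lemma lbC v w : lb v w = lb w v.
Proof. rewrite /lb; ring. Qed.

Lemma lbDl u v w : lb (u + v) w = lb u w + lb v w.
Proof. rewrite /lb /=; ring. Qed.

Lemma lbZl a v w : lb (a *: v) w = a * lb v w.
Proof. rewrite /lb /= /GRing.scale /=; ring. Qed.

Lemma lbNl v w : lb (- v) w = - lb v w.
Proof. by rewrite -scaleN1r lbZl mulN1r. Qed.

Lemma lbBl u v w : lb (u - v) w = lb u w - lb v w.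
Proof. by rewrite lbDl lbNl. Qed.

Lemma lbDr u v w : lb u (v + w) = lb u v + lb u w.
Proof. by rewrite lbC lbDl !(lbC u). Qed.

Lemma lbZr a v w : lb v (a *: w) = a * lb v w.
Proof. by rewrite lbC lbZl (lbC v). Qed.

Lemma lbNr v w : lb v (- w) = - lb v w.
Proof. by rewrite lbC lbNl (lbC v). Qed.

Lemma lbBr u v w : lb u (v - w) = lb u v - lb u w.
Proof. by rewrite lbDr lbNr. Qed.

Lemma lb0l v : lb 0 v = 0.
Proof. by rewrite -(scale0r 0) lbZl mul0r. Qed.

Lemma lb0r v : lb v 0 = 0.
Proof. by rewrite lbC lb0l. Qed.

Definition lbE := (lbDl, lbBl, lbNl, lbZl, lbDr, lbBr, lbNr, lbZr, lb0l, lb0r).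

Definition refl (n v : lorentz) : lorentz := v - (2 * lb v n) *: n.

Lemma lb_refll n v w : lb (refl n v) w = lb v w - 2 * lb v n * lb n w.
Proof. by rewrite /refl lbBl lbZl. Qed.

Lemma lb_refl_adj n v w : lb (refl n v) w = lb v (refl n w).
Proof. rewrite /refl !lbE (lbC n w); ring. Qed.

Lemma refl_id n v : lb v n = 0 -> refl n v = v.
Proof. by rewrite /refl => ->; rewrite mulr0 scale0r subr0. Qed.

Section UnitNormal.
Variables (n : lorentz) (n1 : lb n n = 1).

Lemma lb_refl_normal v : lb (refl n v) n = - lb v n.
Proof. rewrite /refl !lbE n1; ring. Qed.

Lemma reflK : involutive (refl n).
Proof.
by move=> v; rewrite {1}/refl lb_refl_normal /refl mulrN scaleNr opprK subrK.
Qed.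

Lemma lb_refl v w : lb (refl n v) (refl n w) = lb v w.
Proof. by rewrite lb_refl_adj reflK. Qed.

End UnitNormal.

(* The planes orthogonal to n and m do not meet, or meet at an angle pi/k. *)
Definition coxeter_pair (n m : lorentz) : Prop :=
  lb n m <= -1 \/ exists2 k, (2 <= k)%N & lb n m = - cos (pi / k%:R).

Lemma pi_div_bounds k : (2 <= k)%N ->
  0 < pi / k%:R :> R /\ pi / k%:R <= pi / 2 :> R.
Proof.
move=> k2; have k0 : 0 < k%:R :> R by rewrite ltr0n; lia.
have k2' : 2 <= k%:R :> R by rewrite ler_nat.
split; first by rewrite divr_gt0 ?pi_gt0.
by rewrite ler_pM2l ?pi_gt0// lef_pV2 ?posrE// ltr0n.
Qed.

Lemma coxeter_pair_le0 n m : coxeter_pair n m -> lb n m <= 0.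
Proof.
case=> [|[k k2 ->]]; first by move/le_trans; apply; rewrite lerN10.
have [p0 p2] := pi_div_bounds k2.
rewrite oppr_le0 cos_ge0_pihalf// p2 andbT.
by rewrite (le_trans _ (ltW p0))// lerNl oppr0 divr_ge0 ?pi_ge0.
Qed.

(** Chebyshev polynomials of the second kind with shifted index, [U_(n-1) (c / 2)]: at [c = 2 cos t]
    the value is [sin (n t) / sin t]. They are the coefficients of alternating products of two
    reflections. *)
Fixpoint cheb (c : R) (n : nat) : R :=
  if n is m.+1 then if m is k.+1 then c * cheb c m - cheb c k else 1 else 0.

Lemma chebSS c n : cheb c n.+2 = c * cheb c n.+1 - cheb c n.
Proof. by []. Qed.

Lemma cheb_ge0 c n : 2 <= c -> 0 <= cheb c n.
Proof.
move=> c2; suff [] : 0 <= cheb c n /\ cheb c n <= cheb c n.+1 by [].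
elim: n => [|n [n0 nn]]; first by split; rewrite //= ler01.
have p : 0 <= cheb c n.+1 by exact: le_trans nn.
split=> //; rewrite chebSS; nra.
Qed.

Lemma cheb_sin (t : R) n : sin t * cheb (2 * cos t) n = sin (n%:R * t).
Proof.
suff [] : sin t * cheb (2 * cos t) n = sin (n%:R * t) /\
  sin t * cheb (2 * cos t) n.+1 = sin (n.+1%:R * t) by [].
elim: n => [|n [n0 nn]].
  by rewrite /= mulr0 mulr1 mul0r mul1r sin0.
split=> //; rewrite chebSS mulrBr n0 mulrCA nn.
have -> : n.+2%:R * t = n.+1%:R * t + t by rewrite -!natr1; ring.
have -> : n%:R * t = n.+1%:R * t - t by rewrite -!natr1; ring.
rewrite sinB sinD; ring.
Qed.

Lemma cheb_pi_ge0 k n : (2 <= k)%N -> (n <= k)%N ->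
  0 <= cheb (2 * cos (pi / k%:R)) n.
Proof.
move=> k2 nk; have [p0 p2] := pi_div_bounds k2.
have k0 : 0 < k%:R :> R by rewrite ltr0n; lia.
have s0 : 0 < sin (pi / k%:R : R).
  by rewrite sin_gt0_pi// p0 (le_lt_trans p2)// ltr_pdivrMr ?ltr0n// ltr_pMr ?pi_gt0// ltr1n.
rewrite -(pmulr_rge0 _ s0) cheb_sin sin_ge0_pi//.
rewrite mulr_ge0 ?(ltW p0)//= mulrCA ler_piMr ?pi_ge0// ler_pdivrMr//.
by rewrite mul1r ler_nat.
Qed.

Lemma cheb_pi k : (2 <= k)%N -> let c := 2 * cos (pi / k%:R) in
  [/\ cheb c k = 0, cheb c k.-1 = 1 & cheb c k.+1 = -1].
Proof.
move=> k2 c; have [p0 p2] := pi_div_bounds k2.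
have k0 : 0 < k%:R :> R by rewrite ltr0n; lia.
have s0 : 0 < sin (pi / k%:R : R).
  by rewrite sin_gt0_pi// p0 (le_lt_trans p2)// ltr_pdivrMr ?ltr0n// ltr_pMr ?pi_gt0// ltr1n.
have H : cheb c k = 0.
  apply: (mulfI (lt0r_neq0 s0)); rewrite cheb_sin mulr0 mulrCA divff ?gt_eqF//.
  by rewrite mulr1 sinpi.
have H1 : cheb c k.-1 = 1.
  apply: (mulfI (lt0r_neq0 s0)); rewrite cheb_sin mulr1.
  have -> : k.-1%:R * (pi / k%:R) = pi - pi / k%:R :> R.
    rewrite -(ltn_predK k2) /= -natr1; field.
    by rewrite natr1 (ltn_predK k2) gt_eqF.
  by rewrite sinB sinpi cospi mul0r mulN1r sub0r opprK.
split=> //.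
by rewrite -(ltn_predK k2) chebSS (ltn_predK k2) H H1 mulr0 sub0r.
Qed.

Section Words.
Variables (I : eqType) (e : I -> lorentz).
Hypothesis e1 : forall i, lb (e i) (e i) = 1.
Implicit Types (w u : seq I) (v : lorentz) (s a b : I).

Definition act w v : lorentz := foldr (fun i => refl (e i)) v w.

Lemma act_cat w u v : act (w ++ u) v = act w (act u v).
Proof. exact: foldr_cat. Qed.

Lemma act_revK w v : act (rev w) (act w v) = v.
Proof.
elim: w v => // s w IH v; rewrite rev_cons -cats1 act_cat /= reflK //; exact: IH.
Qed.

Lemma act_Krev w v : act w (act (rev w) v) = v.
Proof. by rewrite -{1}(revK w) act_revK. Qed.

Lemma lb_act w v x : lb (act w v) (act w x) = lb v x.
Proof. by elim: w => //= s w IH; rewrite lb_refl. Qed.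

Definition aeq w u := forall v, act w v = act u v.

Lemma aeq_cons s w u : aeq w u -> aeq (s :: w) (s :: u).
Proof. by move=> wu v /=; rewrite wu. Qed.

Lemma aeq_sym w u : aeq w u -> aeq u w.
Proof. by move=> wu v. Qed.

Lemma aeq_cancel s w : aeq (s :: s :: w) w.
Proof. by move=> v /=; rewrite reflK. Qed.

Lemma has_len w : exists n, `[< exists u, aeq u w /\ size u = n >].
Proof. by exists (size w); apply/asboolP; exists w. Qed.

(** Length in the group of linear maps generated by the reflections, not in an abstract Coxeter
    group; no faithfulness is presupposed. *)
Definition len w := ex_minn (has_len w).

Lemma lenP w : exists u, aeq u w /\ size u = len w.
Proof. by rewrite /len; case: ex_minnP => n /asboolP. Qed.

Lemma len_le w u : aeq u w -> (len w <= size u)%N.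
Proof.
by move=> uw; rewrite /len; case: ex_minnP => n _; apply; apply/asboolP; exists u.
Qed.

Lemma len_eq w u : aeq w u -> len w = len u.
Proof.
move=> wu; apply/eqP; rewrite eqn_leq; apply/andP; split.
- by have [x [xu <-]] := lenP u; apply: len_le => v; rewrite xu wu.
- by have [x [xu <-]] := lenP w; apply: len_le => v; rewrite xu wu.
Qed.

Lemma len_size w : (len w <= size w)%N.
Proof. exact: len_le. Qed.

Lemma len0 w : len w = 0%N -> aeq w [::].
Proof.
by have [u [uw <-]] := lenP w => /size0nil u0; rewrite u0 in uw; exact: aeq_sym.
Qed.

Lemma len_cat w u : (len (w ++ u) <= len w + len u)%N.
Proof.
have [x [xw <-]] := lenP w; have [y [yu <-]] := lenP u.
by rewrite -size_cat; apply: len_le => v; rewrite !act_cat xw yu.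
Qed.

Lemma len_cons s w : (len (s :: w) <= (len w).+1)%N.
Proof.
rewrite -cat1s -add1n; apply: leq_trans (len_cat _ _) _; rewrite leq_add2r.
exact: len_size.
Qed.

Lemma len_cons_ge s w : (len w <= (len (s :: w)).+1)%N.
Proof. by rewrite -(len_eq (aeq_cancel s w)) len_cons. Qed.

Lemma len_min_behead s w : len (s :: w) = (size w).+1 -> len w = size w.
Proof.
move=> h; apply/eqP; rewrite eqn_leq len_size /= -ltnS -h; exact: len_cons.
Qed.

Fixpoint alt a b (p : nat) : seq I := if p is q.+1 then a :: alt b a q else [::].

Lemma size_alt a b p : size (alt a b p) = p.
Proof. by elim: p a b => //= p IH a b; rewrite IH. Qed.

(** An alternating word acts on the span of [e a] and [e b] as a power of their rotation, up to one
    reflection; parity decides which normal receives which coefficient. *)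
Lemma lb_act_alt p a b v : let c := - 2 * lb (e a) (e b) in
  lb (act (alt b a p) v) (e a) =
  if odd p then cheb c p * lb v (e a) + cheb c p.+1 * lb v (e b)
  else cheb c p.+1 * lb v (e a) + cheb c p * lb v (e b).
Proof.
pose P p := forall a b, let c := - 2 * lb (e a) (e b) in
  lb (act (alt b a p) v) (e a) =
  if odd p then cheb c p * lb v (e a) + cheb c p.+1 * lb v (e b)
  else cheb c p.+1 * lb v (e a) + cheb c p * lb v (e b).
(* The recurrence has order two, so two consecutive lengths are carried; each step exchanges the two
   letters, whence the quantifiers in [P]. *)
suff [] : P p /\ P p.+1 by move=> /(_ a b).
elim: p {a b} => [|p [p0 p1]].
  by split=> a b c; rewrite /= ?/refl ?lbE /c ?(lbC (e b) (e a)); ring.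
split=> // a b c.
have -> : act (alt b a p.+2) v = refl (e b) (act (alt a b p.+1) v) by [].
rewrite lb_refll (p1 b a).
have -> : lb (act (alt a b p.+1) v) (e a) = - lb (act (alt b a p) v) (e a).
  by rewrite /= lb_refl_normal.
rewrite (p0 a b) (lbC (e b) (e a)) -/c chebSS [in RHS]chebSS /= negbK.
have cE : lb (e a) (e b) = - c / 2 by rewrite /c; field.
by case: (odd p) => /=; rewrite cE; field.
Qed.

(** For [p < k] both coefficients are sines of angles in [0, pi] over a positive sine, hence
    nonnegative. *)
Lemma alt_fold_lt a b p k v : (2 <= k)%N -> lb (e a) (e b) = - cos (pi / k%:R) ->
  (p < k)%N -> lb v (e a) <= 0 -> lb v (e b) <= 0 ->
  lb (act (alt b a p) v) (e a) <= 0.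
Proof.
move=> k2 ab pk va vb; rewrite lb_act_alt ab mulrNN.
have h1 : 0 <= cheb (2 * cos (pi / k%:R : R)) p.+1 by exact: cheb_pi_ge0.
have h0 : 0 <= cheb (2 * cos (pi / k%:R : R)) p by apply: cheb_pi_ge0 => //; exact: ltnW.
by case: ifP => _; nra.
Qed.

Lemma alt_fold_inf a b p v : lb (e a) (e b) <= -1 ->
  lb v (e a) <= 0 -> lb v (e b) <= 0 ->
  lb (act (alt b a p) v) (e a) <= 0.
Proof.
move=> ab va vb; rewrite lb_act_alt.
have c2 : 2 <= - 2 * lb (e a) (e b) by lra.
have h1 := cheb_ge0 p.+1 c2; have h0 := cheb_ge0 p c2.
by case: ifP => _; nra.
Qed.

Lemma act_sub_span a b w v : all (pred2 a b) w ->
  exists x y, act w v = v + x *: e a + y *: e b.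
Proof.
elim: w => [|s w IH] /=; first by exists 0, 0; rewrite !scale0r !addr0.
case/andP=> sab /IH [x [y wE]]; rewrite wE /refl; set r := 2 * _.
case/orP: sab => /eqP ->.
- by exists (x - r), y; rewrite addrAC -(addrA v) -scalerBl.
- by exists x, (y - r); rewrite -(addrA (v + _)) -scalerBl.
Qed.

Lemma all_alt a b p : all (pred2 a b) (alt a b p).
Proof.
elim: p a b => //= p IH a b; rewrite eqxx /=.
by apply: sub_all (IH b a) => x /=; rewrite orbC.
Qed.

Arguments cheb : simpl never.

(** Both words move v only within the span of [e a] and [e b]. Its Gram determinant [1 - c ^+ 2] is
    nonzero, so comparing the products with these two vectors suffices. *)
Lemma alt_braid a b k : (2 <= k)%N -> lb (e a) (e b) = - cos (pi / k%:R) ->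
  aeq (alt a b k) (alt b a k).
Proof.
move=> k2 ab v; have [c0 c1 cm] := cheb_pi k2.
have key x y : lb (e x) (e y) = - cos (pi / k%:R) ->
    lb (act (alt x y k) v) (e x) = lb (act (alt y x k) v) (e x).
  move=> xy; rewrite [in RHS]lb_act_alt -{1}(ltn_predK k2) /= lb_refl_normal// lb_act_alt.
  rewrite xy mulrNN (ltn_predK k2) c0 c1 cm -[in RHS](ltn_predK k2) /=.
  by case: (odd _) => /=; ring.
have [x [y E]] := act_sub_span v (all_alt a b k).
have [x' [y' E']] : exists x y, act (alt b a k) v = v + x *: e a + y *: e b.
  by apply: act_sub_span; apply: sub_all (all_alt b a k) => z /=; rewrite orbC.
have ka := key a b ab; have kb := key b a (etrans (lbC _ _) ab).
move: ka kb; rewrite E E' !lbE !e1 (lbC (e b)) ab => ka kb.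
set c := cos _ in ka kb ab; have c2 : c ^+ 2 < 1.
  have [p0 p2] := pi_div_bounds k2.
  have s0 : 0 < sin (pi / k%:R : R).
    rewrite sin_gt0_pi// p0 (le_lt_trans p2)// ltr_pdivrMr ?ltr0n//.
    by rewrite ltr_pMr ?pi_gt0// ltr1n.
  by rewrite -subr_gt0 -(cos2Dsin2 (pi / k%:R)) -/c addrC addKr exprn_gt0.
have d1 : (x - x') = c * (y - y') by lra.
have d2 : (y - y') = c * (x - x') by lra.
have d3 : (1 - c ^+ 2) * (x - x') = 0 by rewrite mulrBl mul1r expr2 -mulrA -d2 -d1 subrr.
move/eqP: d3; rewrite mulf_eq0 subr_eq0 eq_sym (lt_eqF c2) /= => /eqP d3.
rewrite d3 mulr0 in d2.
by rewrite (subr0_eq d3) (subr0_eq d2).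
Qed.

(** In an alternating word of length k + 1 the braid relation turns the tail into one that starts
    with the first letter, and the two cancel. *)
Lemma min_alt_le a b k p : (2 <= k)%N -> lb (e a) (e b) = - cos (pi / k%:R) ->
  len (alt a b p) = p -> (p <= k)%N.
Proof.
move=> k2; elim: p a b => // p IH a b ab h.
have hp : len (alt b a p) = p.
  by rewrite (@len_min_behead a) ?size_alt// -[RHS]h.
have := IH b a (etrans (lbC _ _) ab) hp; rewrite leq_eqVlt => /orP[/eqP pk|//].
exfalso; suff /len_le : aeq (alt b a p.-1) (alt a b p.+1).
  by rewrite h size_alt; lia.
apply: aeq_sym => v; have -> : act (alt a b p.+1) v = refl (e a) (act (alt b a p) v) by [].
rewrite pk -(alt_braid k2 ab).
have -> : alt a b k = a :: alt b a k.-1 by rewrite -{1}(ltn_predK k2).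
by rewrite /= reflK.
Qed.

(** The exceptional case is [p = k], the longest element of the dihedral group: it can also be
    written with a in front, and the rest is short enough to stay on the chamber's side of a. *)
Lemma alt_fold a b p : coxeter_pair (e a) (e b) -> len (alt b a p) = p ->
  (forall v, lb v (e a) <= 0 -> lb v (e b) <= 0 ->
     lb (act (alt b a p) v) (e a) <= 0) \/
  exists2 u, (size u).+1 = p /\ aeq (alt b a p) (a :: u) &
    forall v, lb v (e a) <= 0 -> lb v (e b) <= 0 -> lb (act u v) (e a) <= 0.
Proof.
move=> [ab _|[k k2 ab] h]; first by left=> v; exact: alt_fold_inf.
have := min_alt_le k2 (etrans (lbC _ _) ab) h; rewrite leq_eqVlt => /orP[/eqP pk|pk].
  right; exists (alt b a p.-1) => [|v].
  - rewrite size_alt pk (ltn_predK k2); split=> // v.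
    by rewrite -(alt_braid k2 ab) -{1}(ltn_predK k2).
  - by apply: (alt_fold_lt k2 ab); rewrite pk (ltn_predK k2).
by left=> v; exact: (alt_fold_lt k2 ab).
Qed.

Lemma min_word_alt a b w : all (pred2 a b) w -> len w = size w ->
  w = alt a b (size w) \/ w = alt b a (size w).
Proof.
elim: w => [|s w IH] /=; first by left.
case/andP=> sab wab h; have hw := len_min_behead h.
have nss q : w <> s :: q.
  move=> wE; suff /len_le : aeq q (s :: w) by rewrite h wE /=; lia.
  by rewrite wE; exact/aeq_sym/aeq_cancel.
case/orP: sab => /eqP sE; rewrite sE in nss *.
- case: (IH wab hw) => wE; last by left; rewrite -wE.
  by case: (size w) wE => [->|q wE]; [left|case: (nss _ wE)].
- case: (IH wab hw) => wE; first by right; rewrite -wE.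
  by case: (size w) wE => [->|q wE]; [right|case: (nss _ wE)].
Qed.

Definition cone v := forall i, lb v (e i) <= 0.

Definition below w s := forall v, cone v -> lb (act w v) (e s) <= 0.

Hypothesis e_cox : forall i j, i != j -> coxeter_pair (e i) (e j).

(* P and Q are the two halves of Tits' lemma, proved by a joint induction. *)
Let P n := forall w s, len w = n ->
  below w s \/ ((forall v, cone v -> 0 <= lb (act w v) (e s)) /\ (len (s :: w) < n)%N).

Let Q n := forall w a b, a != b -> len w = n -> exists u x,
  [/\ all (pred2 a b) u, aeq w (u ++ x), (size u + len x)%N = n, below x a & below x b].

(** Take a reduced word s'w. If s differs from s', [Q n] splits off the part u of w in the letters s
    and s'; the remaining x is below both walls, so the claim is about the alternating word s'u
    alone, which [alt_fold] settles. *)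
Let tits_P n : P n -> Q n -> P n.+1.
Proof.
move=> Pn Qn w0 s h0; have [[|s' w] [ww0 sw]] := lenP w0; first by rewrite h0 in sw.
rewrite h0 /= in sw; have {sw} [sw] := sw.
have h : len (s' :: w) = n.+1 by rewrite (len_eq ww0).
have hw : len w = n by rewrite -sw; apply: (@len_min_behead s'); rewrite h sw.
suff [A|[A B]] : below (s' :: w) s \/ ((forall v, cone v ->
    0 <= lb (act (s' :: w) v) (e s)) /\ (len (s :: s' :: w) < n.+1)%N).
- by left=> v Cv; rewrite -ww0; exact: A.
- right; split; first by move=> v Cv; rewrite -ww0; exact: A.
  by rewrite -(len_eq (aeq_cons s ww0)).
have [ss'|ss'] := eqVneq s s'.
  subst s'; right; split; last by rewrite (len_eq (aeq_cancel _ _)) hw.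
  case: (Pn w s hw) => [A v Cv|[_]]; last by rewrite h; lia.
  by rewrite /= lb_refl_normal// oppr_ge0; exact: A.
have [u [x [uss wE us xs xs']]] := Qn w s s' ss' hw.
have wE' : aeq (s' :: w) ((s' :: u) ++ x) by exact: aeq_cons.
(* A shorter form of s'u would give a shorter form of s'w. *)
have hu : len (s' :: u) = (size u).+1.
  apply/eqP; rewrite eqn_leq len_size /=.
  have := len_cat (s' :: u) x; rewrite -(len_eq wE') h -us; lia.
have uA : s' :: u = alt s' s (size (s' :: u)).
  have := @min_word_alt s' s (s' :: u); rewrite /= eqxx hu => -[]//.
  - by apply: sub_all uss => z /=; rewrite orbC.
  - by case=> E; rewrite E eqxx in ss'.
have hA : len (alt s' s (size u).+1) = (size u).+1 by rewrite -[RHS]hu uA.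
case: (alt_fold (e_cox ss') hA) => [A|[u' [su' uu'] A]].
  left=> v Cv; rewrite wE' act_cat uA; apply: A; [exact: xs|exact: xs'].
have wE2 : aeq (s' :: w) (s :: u' ++ x).
  by move=> v; rewrite wE' act_cat uA uu' /= act_cat.
right; split.
  move=> v Cv; rewrite wE2 /= lb_refl_normal// oppr_ge0 act_cat.
  by apply: A; [exact: xs|exact: xs'].
rewrite (len_eq (aeq_cons s wE2)) (len_eq (aeq_cancel _ _)).
have := len_cat u' x; have := len_size u'; lia.
Qed.

(** While w is not below one of the two walls, [P] allows stripping that letter from the left, which
    shortens w. *)
Let tits_Q n : P n.+1 -> Q n -> Q n.+1.
Proof.
move=> Pn Qn w.
suff W a b : a != b -> len w = n.+1 -> ~ below w a -> exists u x,
    [/\ all (pred2 a b) u, aeq w (u ++ x), (size u + len x)%N = n.+1, below x a & below x b].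
  move=> a b ab h; have [wa|/(W a b ab h)//] := pselect (below w a).
  have [wb|wb] := pselect (below w b); first by exists [::], w; split.
  have ba : b != a by rewrite eq_sym.
  have [u [x [uba ? ? ? ?]]] := W b a ba h wb.
  by exists u, x; split=> //; apply: sub_all uba => z /=; rewrite orbC.
move=> ab h wa; case: (Pn w a h) => // -[_ aw].
have haw : len (a :: w) = n by have := len_cons_ge a w; lia.
have [u [x [uab aE ux xa xb]]] := Qn _ a b ab haw.
exists (a :: u), x; split=> //=; rewrite ?eqxx //; last by rewrite addSn ux.
by move=> v; rewrite -(aeq_cancel a w) /=; congr refl; exact: aE.
Qed.

Let tits n : P n /\ Q n.
Proof.
elim: n => [|n [Pn Qn]].
  have below0 w s : len w = 0%N -> below w s.
    by move=> /len0 w0 v Cv; rewrite w0; exact: Cv.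
  split=> [w s h|w a b ab h]; first by left; exact: below0.
  by exists [::], w; split=> //; exact: below0.
by have Pn1 := tits_P Pn Qn; split=> //; exact: tits_Q.
Qed.

Inductive folded : seq I -> Prop :=
| Folded0 : folded [::]
| FoldedS s w : below w s -> folded w -> folded (s :: w).

(** Reduced words are folded: in the other case of Tits' lemma the first letter would shorten the
    rest. *)
Lemma ex_folded w : exists2 u, aeq w u & folded u.
Proof.
move: {2}(len w) (erefl (len w)) => n; elim: n w => [|n IH] w h.
  exists [::]; last exact: Folded0.
  exact: len0.
have [[|s x] [xw /=]] := lenP w; rewrite h// => -[sx].
have hx : len x = n.
  by rewrite -sx; apply: (@len_min_behead s); rewrite (len_eq xw) h sx.
have [u xu fu] := IH _ hx.
exists (s :: u); first by move=> v; rewrite -xw /= xu.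
apply: FoldedS => // v Cv; rewrite -xu.
case: ((tits n).1 x s hx) => [|[_]]; first exact.
by rewrite (len_eq xw) h; lia.
Qed.

(* A comparison of distances if v is on the hyperboloid, of heights above a
   horosphere if v is isotropic. *)
Lemma lb_act_cone w v x : cone v -> cone x ->
  lb v (act w x) <= lb v x /\
  (lb v (act w x) = lb v x -> exists2 u, act u v = v & act w x = act u x).
Proof.
move=> Cv Cx; have [u wu] := ex_folded w.
rewrite wu => {w wu}; elim: u => [|s w IH] fw.
  by split=> // _; exists [::].
inversion fw as [|s' w' ws fw' E]; subst; have [h1 h2] := IH fw'.
(* Each letter changes the product with v by minus twice a product of two nonpositive numbers. *)
have p0 : 0 <= lb v (e s) * lb (act w x) (e s) by rewrite mulr_le0// ?ws.
have E : lb v (act (s :: w) x) = lb v (act w x) - 2 * (lb v (e s) * lb (act w x) (e s)).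
  by rewrite /= /refl !lbE; ring.
split; first by rewrite E; lra.
rewrite E => eq; have e1' : lb v (act w x) = lb v x by lra.
have [u uv wu] := h2 e1'.
have /eqP : lb v (e s) * lb (act w x) (e s) = 0 by lra.
(* In the equality case a letter either fixes v, and joins u, or fixes [act w x], and is dropped. *)
rewrite mulf_eq0 => /orP[/eqP v0|/eqP w0].
- by exists (s :: u); rewrite /= ?wu// uv refl_id.
- by exists u => //=; rewrite refl_id.
Qed.

(** The closed chamber meets each orbit once: in a folded word, a first letter that ends in the
    chamber must start from its own wall, so it acts trivially and can be peeled off. *)
Lemma act_cone_fix w v : cone v -> cone (act w v) -> act w v = v.
Proof.
move=> Cv; have [u wu] := ex_folded w.
rewrite wu => {w wu}; elim: u => // s w IH fw Cw.
inversion fw as [|s' w' ws fw' E]; subst.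
have h0 : lb (act w v) (e s) = 0.
  apply/eqP; rewrite eq_le ws//= -oppr_le0 -lb_refl_normal//; exact: Cw.
have E : act (s :: w) v = act w v by rewrite /= refl_id.
by rewrite E IH// -E.
Qed.

(** Folding puts the image under the remaining letters on the chamber's side of the first wall, so v
    itself lies on both sides of that wall; hence every letter fixes v. *)
Lemma stab_cone w v : cone v -> act w v = v ->
  exists2 u, aeq w u & all (fun s => lb v (e s) == 0) u.
Proof.
move=> Cv; have [u wu fu] := ex_folded w; rewrite wu => h; exists u => // {w wu}.
elim: u fu h => // s w IH fw h; inversion fw as [|s' w' ws fw' E]; subst.
have v0 : lb v (e s) = 0.
  by apply/eqP; rewrite eq_le Cv /= -h /= lb_refl_normal// oppr_ge0 ws.
rewrite /= v0 eqxx /=; apply: IH => //.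
by move: h => /= /(congr1 (refl (e s))); rewrite reflK// [in RHS]refl_id.
Qed.

End Words.
End LorentzSpace.

(** * The upper half-space as a hyperboloid *)

Section Hyperboloid.
Variable R : realType.
Implicit Types (x y : H3 R) (v w n : lorentz R).

Lemma normc_sqr (z : R[i]) : normc z ^+ 2 = complex.Re z ^+ 2 + complex.Im z ^+ 2.
Proof. by case: z => a b /=; rewrite sqr_sqrtr// addr_ge0 ?sqr_ge0. Qed.

(** The Hermitian matrix [[[|z|^2 + t^2, z], [conj z, 1]] / t], of determinant 1. *)
Definition emb x : lorentz R :=
  (complex.Re (hz x) / ht x, complex.Im (hz x) / ht x, (ht x)^-1,
   (complex.Re (hz x) ^+ 2 + complex.Im (hz x) ^+ 2 + ht x ^+ 2) / ht x).

(* To be used once emb is opaque. *)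
Lemma embE x : emb x =
  (complex.Re (hz x) / ht x, complex.Im (hz x) / ht x, (ht x)^-1,
   (complex.Re (hz x) ^+ 2 + complex.Im (hz x) ^+ 2 + ht x ^+ 2) / ht x).
Proof. by []. Qed.

(** The hyperbolic cosine of [hdist x y]. All distances are compared through it. *)
Definition ch x y : R := - lb (emb x) (emb y).

Lemma ht_neq0 x : ht x != 0.
Proof. by rewrite gt_eqF// ht_gt0. Qed.

Lemma ReB (z w : R[i]) : complex.Re (z - w) = complex.Re z - complex.Re w.
Proof. by case: z w => [a b] [c d]. Qed.

Lemma ImB (z w : R[i]) : complex.Im (z - w) = complex.Im z - complex.Im w.
Proof. by case: z w => [a b] [c d]. Qed.

Lemma chE x y : ch x y = 1 + (normc (hz x - hz y) ^+ 2 + (ht x - ht y) ^+ 2)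
              / (2 * ht x * ht y).
Proof.
rewrite normc_sqr ReB ImB /ch /lb /=; field.
by rewrite !ht_neq0.
Qed.

Lemma hdistE x y : hdist x y = arcosh (ch x y).
Proof. by rewrite chE. Qed.

Lemma chC x y : ch x y = ch y x.
Proof. by rewrite /ch lbC. Qed.

Lemma ch_ge1 x y : 1 <= ch x y.
Proof.
rewrite chE lerDl divr_ge0// ?addr_ge0 ?sqr_ge0// !mulr_ge0//; exact/ltW/ht_gt0.
Qed.

Lemma lb_emb x : lb (emb x) (emb x) = -1.
Proof. by rewrite /lb /=; field; rewrite ht_neq0. Qed.

Lemma chxx x : ch x x = 1.
Proof. by rewrite /ch lb_emb opprK. Qed.

Lemma H3_eq x y : hz x = hz y -> ht x = ht y -> x = y.
Proof.
case: x y => [z t t0] [z' t' t0'] /= zz tt; subst z' t'.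
by congr MkH3; exact: Prop_irrelevance.
Qed.

Lemma complex_eq (z w : R[i]) : complex.Re z = complex.Re w ->
  complex.Im z = complex.Im w -> z = w.
Proof. by case: z w => [a b] [c d] /= -> ->. Qed.

Lemma emb_inj : injective emb.
Proof.
move=> x y /= [e1 e2 e3 e4].
have t : ht x = ht y by apply: invr_inj.
have k : (ht x)^-1 != 0 by rewrite invr_eq0 ht_neq0.
apply: H3_eq => //; apply: complex_eq; apply: (mulIf k).
- by rewrite e1 -t.
- by rewrite e2 -t.
Qed.

Lemma lorentz_eq v w : v.1.1.1 = w.1.1.1 -> v.1.1.2 = w.1.1.2 ->
  v.1.2 = w.1.2 -> v.2 = w.2 -> v = w.
Proof. by case: v w => [[[a b] c] d] [[[a' b'] c'] d'] /= -> -> -> ->. Qed.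

Lemma ch_eq1 x y : ch x y = 1 -> x = y.
Proof.
rewrite chE => /eqP; rewrite -subr_eq0 addrC addKr mulf_eq0 invr_eq0.
rewrite !mulf_eq0 !(negbTE (ht_neq0 _)) pnatr_eq0 /= !orbF.
rewrite paddr_eq0 ?sqr_ge0// !sqrf_eq0 subr_eq0 => /andP[/eqP zz /eqP tt].
by apply: H3_eq => //; apply/eqP; rewrite -subr_eq0; apply/eqP/ComplexField.Normc.eq0_normc.
Qed.

Lemma arcosh_arg_ge1 (u : R) : 1 <= u -> 1 <= u + Num.sqrt (u ^+ 2 - 1).
Proof. by move=> u1; rewrite (le_trans u1)// lerDl sqrtr_ge0. Qed.

Lemma le_arcosh (u u' : R) : 1 <= u -> 1 <= u' -> (arcosh u <= arcosh u') = (u <= u').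
Proof.
move=> u1 u1'; have h := arcosh_arg_ge1 u1; have h' := arcosh_arg_ge1 u1'.
rewrite /arcosh ler_ln ?posrE ?(lt_le_trans ltr01)//.
have mono (a b : R) : 1 <= a -> a <= b -> Num.sqrt (a ^+ 2 - 1) <= Num.sqrt (b ^+ 2 - 1).
  by move=> a1 ab; rewrite ler_wsqrtr// lerB// lerXn2r ?nnegrE//; lra.
apply/idP/idP => [|uu]; last by rewrite lerD// mono.
by apply: contraTT; rewrite -!ltNge => uu; rewrite ltr_leD// mono// ltW.
Qed.

Lemma le_hdist x y x' y' : (hdist x y <= hdist x' y') = (ch x y <= ch x' y').
Proof. by rewrite !hdistE le_arcosh// ch_ge1. Qed.

Lemma hball_ch (e : R) : 0 < e ->
  exists2 d, 0 < d & forall x y, ch x y < 1 + d -> hball x e y.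
Proof.
move=> e0; have e1 : 1 < expR e by rewrite expR_gt1.
(* If [c < 1 + h ^+ 2] and [h <= 1] then [c ^+ 2 - 1 < 4 h ^+ 2], so
   [c + sqrt (c ^+ 2 - 1) < 1 + 3 h], which is less than [expR e]. *)
pose h := Num.min 1 ((expR e - 1) / 4).
have h0 : 0 < h by rewrite lt_min ltr01 divr_gt0// subr_gt0.
have h1 : h <= 1 by rewrite ge_min lexx.
have h4 : h <= (expR e - 1) / 4 by rewrite ge_min lexx orbT.
exists (h ^+ 2); first by rewrite exprn_gt0.
move=> x y xy; rewrite /hball /= hdistE /arcosh; have c1 := ch_ge1 x y.
set c := ch x y in xy c1 *.
have s : Num.sqrt (c ^+ 2 - 1) < 2 * h.
  have h2 : h ^+ 2 <= h by nra.
  have h3 : h ^+ 2 * h ^+ 2 <= h ^+ 2 by have := sqr_ge0 h; nra.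
  have h5 : 0 < h ^+ 2 by rewrite exprn_gt0.
  rewrite -(gtr0_norm (_ : 0 < 2 * h)) ?mulr_gt0// -sqrtr_sqr ltr_sqrt; last first.
    by rewrite exprn_gt0// mulr_gt0.
  have -> : (2 * h) ^+ 2 = 4 * h ^+ 2 by ring.
  have : c ^+ 2 < (1 + h ^+ 2) ^+ 2 by rewrite ltrXn2r ?nnegrE//; lra.
  have -> : (1 + h ^+ 2) ^+ 2 = 1 + 2 * h ^+ 2 + h ^+ 2 * h ^+ 2 by ring.
  by lra.
rewrite -[ltRHS]expRK ltr_ln ?posrE ?expR_gt0//; first by nra.
by rewrite (lt_le_trans ltr01)// arcosh_arg_ge1.
Qed.

Lemma ch_hball (d : R) : 0 < d ->
  exists2 e, 0 < e & forall x y, hball x e y -> ch x y < 1 + d.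
Proof.
move=> d0; exists (ln (1 + d)); first by rewrite ln_gt0// ltrDl.
move=> x y; rewrite /hball /= hdistE /arcosh; have c1 := ch_ge1 x y.
rewrite ltr_ln ?posrE ?(lt_le_trans ltr01 (arcosh_arg_ge1 c1))//; last by rewrite addr_gt0.
by apply: le_lt_trans; rewrite lerDl sqrtr_ge0.
Qed.

Lemma hinteriorP (A : set (H3 R)) x : hinterior A x <->
  exists2 d, 0 < d & forall y, ch x y < 1 + d -> A y.
Proof.
split=> [[e e0 xA]|[d d0 xA]].
- by have [d d0 h] := hball_ch e0; exists d => // y /h; exact: xA.
- by have [e e0 h] := ch_hball d0; exists e => // y /h; exact: xA.
Qed.

Lemma emb_surj v : lb v v = -1 -> 0 < v.1.2 -> exists x, emb x = v.
Proof.
case: v => [[[a b] c] d]; rewrite /lb /= => h c0.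
have t0 : 0 < c^-1 by rewrite invr_gt0.
exists (MkH3 (Complex (a / c) (b / c)) t0); apply: lorentz_eq => /=; rewrite ?invrK //.
- by rewrite divfK// gt_eqF.
- by rewrite divfK// gt_eqF.
- have -> : d = (a ^+ 2 + b ^+ 2 + 1) / c.
    by rewrite !expr2; apply: (mulIf (lt0r_neq0 c0)); rewrite divfK ?gt_eqF//; lra.
  by field; rewrite gt_eqF.
Qed.

Lemma emb_scale v : lb v v < 0 -> 0 < v.1.2 ->
  exists x (k : R), [/\ 0 < k, k ^+ 2 * lb v v = -1 & emb x = k *: v].
Proof.
move=> v0 v3; pose k := (Num.sqrt (- lb v v))^-1.
have k0 : 0 < k by rewrite invr_gt0 sqrtr_gt0 oppr_gt0.
have kk : k ^+ 2 * lb v v = -1.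
  rewrite exprVn sqr_sqrtr ?oppr_ge0 ?ltW// invrN mulNr mulVf ?lt_eqF//.
have [x xE] : exists x, emb x = k *: v.
  by apply: emb_surj; [rewrite !lbE mulrA -expr2|exact: mulr_gt0].
by exists x, k.
Qed.

Lemma emb3_gt0 x : 0 < (emb x).1.2.
Proof. by rewrite /= invr_gt0 ht_gt0. Qed.

(* Coordinates of v in an orthonormal frame of the tangent space at x *)
Definition fr1 x v : R := v.1.1.1 - complex.Re (hz x) * v.1.2.
Definition fr2 x v : R := v.1.1.2 - complex.Im (hz x) * v.1.2.
Definition fr3 x v : R :=
  ((v.2 - 2 * (complex.Re (hz x) * v.1.1.1 + complex.Im (hz x) * v.1.1.2)
    + (complex.Re (hz x) ^+ 2 + complex.Im (hz x) ^+ 2) * v.1.2) / ht x - v.1.2 * ht x) / 2.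

(** The left side is the product of the projections of v and w to the tangent space at x, where [lb]
    is Euclidean. *)
Lemma lb_frame x v w : lb v w + lb v (emb x) * lb w (emb x) =
  fr1 x v * fr1 x w + fr2 x v * fr2 x w + fr3 x v * fr3 x w.
Proof. by rewrite /lb /fr1 /fr2 /fr3 /=; field; rewrite ht_neq0. Qed.

Lemma lb_CS x v w : (lb v w + lb v (emb x) * lb w (emb x)) ^+ 2 <=
  (lb v v + lb v (emb x) ^+ 2) * (lb w w + lb w (emb x) ^+ 2).
Proof.
rewrite !(expr2 (lb _ (emb x))) !(lb_frame x).
set a := fr1 x v; set b := fr2 x v; set c := fr3 x v.
set d := fr1 x w; set f := fr2 x w; set g := fr3 x w.
rewrite -subr_ge0.
have -> : (a * a + b * b + c * c) * (d * d + f * f + g * g) -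
    (a * d + b * f + c * g) ^+ 2 =
  (a * f - b * d) ^+ 2 + (a * g - c * d) ^+ 2 + (b * g - c * f) ^+ 2 by ring.
by rewrite !addr_ge0// sqr_ge0.
Qed.

Lemma lb_tangent_ge0 x v : lb v (emb x) = 0 -> 0 <= lb v v.
Proof.
move=> h; have := lb_frame x v v; rewrite h mul0r addr0 => ->.
by rewrite !addr_ge0// -expr2 sqr_ge0.
Qed.

Lemma lb_tangent_eq0 x v : lb v (emb x) = 0 -> lb v v = 0 -> v = 0.
Proof.
move=> h h2; have := lb_frame x v v; rewrite h h2 mul0r addr0 => /esym/eqP.
rewrite !paddr_eq0 ?addr_ge0// -?expr2 ?sqr_ge0// !sqrf_eq0.
move=> /andP[/andP[/eqP f1 /eqP f2] /eqP f3].
have t0 := ht_gt0 x; have tn := ht_neq0 x.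
move: f1 f2 f3 h; rewrite /fr1 /fr2 /fr3 /lb /=.
move=> /eqP; rewrite subr_eq0 => /eqP v1 /eqP; rewrite subr_eq0 => /eqP v2.
move=> /eqP; rewrite mulf_eq0 invr_eq0 pnatr_eq0 orbF subr_eq0 => /eqP v3.
have {}v3 : v.2 - 2 * (complex.Re (hz x) * v.1.1.1 + complex.Im (hz x) * v.1.1.2)
    + (complex.Re (hz x) ^+ 2 + complex.Im (hz x) ^+ 2) * v.1.2 = v.1.2 * ht x * ht x.
  by rewrite -v3 divfK.
move=> h.
have v4 : v.2 = v.1.2 * (ht x ^+ 2 + complex.Re (hz x) ^+ 2 + complex.Im (hz x) ^+ 2).
  by move: v3; rewrite v1 v2; lra.
have v30 : v.1.2 = 0.
  have : - (v.1.2 * ht x) = 0 by rewrite -h v1 v2 v4; field.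
  by move/eqP; rewrite oppr_eq0 mulf_eq0 (negbTE tn) orbF => /eqP.
rewrite v30 mulr0 in v1; rewrite v30 mulr0 in v2; rewrite v30 mul0r in v4.
by apply: lorentz_eq.
Qed.

(** For a timelike v the coordinates [v.1.2] and s have the same sign, and the product with [emb x]
    tells which: v points to the sheet parametrized by [emb]. *)
Lemma lb_future x v : lb v v < 0 -> lb v (emb x) < 0 -> 0 < v.1.2.
Proof.
set p := fr1 x v; set q := fr2 x v => v0 h.
pose s : R := v.2 - 2 * (complex.Re (hz x) * v.1.1.1 + complex.Im (hz x) * v.1.1.2)
    + (complex.Re (hz x) ^+ 2 + complex.Im (hz x) ^+ 2) * v.1.2.
have t0 := ht_gt0 x; have tn := ht_neq0 x.
have E1 : lb v v = p ^+ 2 + q ^+ 2 - v.1.2 * s by rewrite /lb /p /q /fr1 /fr2 /s; field.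
have E2 : lb v (emb x) * (2 * ht x) = - (v.1.2 * ht x ^+ 2 + s).
  by rewrite /lb /s /=; field.
have h2 : lb v (emb x) * (2 * ht x) < 0 by rewrite nmulr_rlt0// mulr_gt0.
have v3s : 0 < v.1.2 * s by have := sqr_ge0 p; have := sqr_ge0 q; lra.
rewrite ltNge; apply/negP => v3.
have s0 : s < 0 by rewrite ltNge; apply/negP => s0; nra.
by have := sqr_ge0 (ht x); nra.
Qed.

(* - lb (emb x) n is the hyperbolic sine of the depth of x in the half-space. *)
Lemma lb_stay_lt0 x y n : lb n n = 1 -> lb (emb x) n < 0 ->
  ch x y ^+ 2 < 1 + lb (emb x) n ^+ 2 -> lb (emb y) n < 0.
Proof.
move=> n1 xn; have := lb_CS x (emb y) n; rewrite lb_emb n1 (lbC n) (lbC _ (emb x)).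
rewrite /ch; have c1 := ch_ge1 x y; rewrite /ch in c1.
set c := lb (emb x) (emb y) in c1 *; set a := lb (emb x) n in xn *; set b := lb (emb y) n.
move=> h1 h2; rewrite ltNge; apply/negP => b0.
have : 0 <= c * a by nra.
by nra.
Qed.

(** A small move from x along the geodesic in the tangent direction v. As v is orthogonal to
    [emb x], the normalizing factor k is exactly [ch x y], which makes the move easy to control. *)
Lemma perturb x v (d : R) : lb v (emb x) = 0 -> 0 < d ->
  exists2 e0 : R, 0 < e0 & forall e : R, `|e| < e0 -> exists y (k : R),
    [/\ 0 < k, emb y = k *: (emb x + e *: v), ch x y = k & k < 1 + d].
Proof.
move=> vx d0; have vv := lb_tangent_ge0 vx.
pose th := Num.min (1 / 2) (d / 4).
have th0 : 0 < th by rewrite lt_min !divr_gt0.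
have th1 : th <= 1 / 2 by rewrite ge_min lexx.
have th2 : th <= d / 4 by rewrite ge_min lexx orbT.
exists (Num.sqrt (th / (1 + lb v v))); first by rewrite sqrtr_gt0 divr_gt0// ltr_wpDr.
move=> e; rewrite -sqrtr_sqr ltr_sqrt ?divr_gt0// ?ltr_wpDr//.
rewrite ltr_pdivlMr ?ltr_wpDr// => eth.
set u := emb x + e *: v.
have uu : lb u u = -1 + e ^+ 2 * lb v v.
  by rewrite /u !lbE lb_emb vx (lbC _ v) vx; ring.
have uu0 : lb u u < 0 by rewrite uu; have := sqr_ge0 e; nra.
have ux : lb u (emb x) = -1 by rewrite /u !lbE lb_emb vx mulr0 addr0.
have u3 : 0 < u.1.2 by apply: (lb_future uu0 (x := x)); rewrite ux ltrN10.
have [y [k [k0 kk yE]]] := emb_scale uu0 u3.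
have kE : ch x y = k by rewrite /ch yE lbC lbZl ux mulrN1 opprK.
exists y, k; split=> //.
have k1 : 1 <= k by rewrite -kE ch_ge1.
rewrite uu in kk; have e2 := sqr_ge0 e.
have : e ^+ 2 * lb v v < th by nra.
set r := e ^+ 2 * lb v v in kk * => rth.
have : k * (1 - th) <= 1 by nra.
by nra.
Qed.

(** Such a v is tangent at x; moving from x along v itself gives [lb v v = 0], and tangent vectors
    are spacelike. *)
Lemma span_local x v (d : R) : 0 < d ->
  (forall y, ch x y < 1 + d -> lb (emb y) v = 0) -> v = 0.
Proof.
move=> d0 h; have vx : lb v (emb x) = 0 by rewrite lbC h// chxx ltrDl.
have [e e0 /(_ (e / 2))] := perturb vx d0.
rewrite gtr0_norm ?divr_gt0// ltr_pdivrMr// ltr_pMr// ltr1n => /(_ isT).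
move=> [y [k [k0 yE chy kd]]]; have := h y; rewrite chy kd => /(_ isT).
rewrite yE !lbE lbC vx add0r => /eqP.
rewrite !mulf_eq0 (gt_eqF k0) (gt_eqF e0) invr_eq0 pnatr_eq0 /= => /eqP.
exact: lb_tangent_eq0 vx.
Qed.

Lemma span v : (forall x, lb (emb x) v = 0) -> v = 0.
Proof.
move=> h; have t0 : 0 < 1 :> R := ltr01.
by apply: (@span_local (MkH3 0 t0) _ 1).
Qed.

Lemma emb_combo x y (a b : R) : 0 <= a -> 0 <= b -> 0 < a + b ->
  exists z (k : R), 0 < k /\ emb z = k *: (a *: emb x + b *: emb y).
Proof.
move=> a0 b0 ab; set v := a *: emb x + b *: emb y.
have xy := ch_ge1 x y; rewrite /ch in xy.
have vv : lb v v < 0.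
  rewrite /v !lbE !lb_emb (lbC (emb y)); set c := lb _ _ in xy *.
  have : 0 < (a + b) * (a + b) by rewrite mulr_gt0.
  have := mulr_ge0 a0 b0; nra.
have v3 : 0 < v.1.2.
  have /= := emb3_gt0 x; have /= := emb3_gt0 y; rewrite /v /= /GRing.scale /=.
  move=> p q; have [a1|a1] := ltP 0 a.
    by rewrite ltr_pwDl ?mulr_gt0// mulr_ge0// ltW.
  by rewrite ltr_wpDl ?mulr_ge0 ?(ltW q)// mulr_gt0//; lra.
by have [z [k [k0 _ zE]]] := emb_scale vv v3; exists z, k.
Qed.

End Hyperboloid.

(** * Half-spaces, reflections and dihedral angles in terms of unit normals *)

Section Planes.
Variable R : realType.
Implicit Types (x y : H3 R) (n : lorentz R) (h k : oplane R).

Lemma normc_gt0 (u : R[i]) : u != 0 -> 0 < normc u.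
Proof.
move=> u0; have := normc_sqr_gt0 u0; have : 0 <= normc u by case: u {u0} => a b; exact: sqrtr_ge0.
by rewrite le_eqVlt => /orP[/eqP <-|//]; rewrite expr0n ltxx.
Qed.

Definition pnorm (p : hplane R) : R :=
  match p with Vertical u _ _ => normc u | Hemisphere _ r _ => r end.

Lemma pnorm_gt0 p : 0 < pnorm p.
Proof. by case: p => [u s u0|c r r0] //=; exact: normc_gt0. Qed.

Definition pnrm (p : hplane R) : lorentz R :=
  match p with
  | Vertical u s _ => (complex.Re u / normc u, complex.Im u / normc u, 0, 2 * s / normc u)
  | Hemisphere c r _ => (- complex.Re c / r, - complex.Im c / r, - r^-1,
      (r ^+ 2 - complex.Re c ^+ 2 - complex.Im c ^+ 2) / r)
  end.

Definition plvl (p : hplane R) x : R :=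
  match p with
  | Vertical u s _ => (hlevel p x) / (normc u * ht x)
  | Hemisphere c r _ => (hlevel p x) / (2 * r * ht x)
  end.

Lemma lb_pnrm p x : lb (emb x) (pnrm p) = plvl p x.
Proof.
case: p => [u s u0|c r r0]; rewrite /plvl /hlevel /lb /=.
  by rewrite /cdot; field; rewrite ht_neq0 gt_eqF// normc_gt0.
by rewrite normc_sqr ReB ImB; field; rewrite ht_neq0 gt_eqF.
Qed.

Lemma plvlE p x : exists2 a : R, 0 < a & plvl p x = a * hlevel p x.
Proof.
have t0 := ht_gt0 x; case: p => [u s u0|c r r0] /=.
  exists (normc u * ht x)^-1; last by rewrite mulrC.
  by rewrite invr_gt0 mulr_gt0// normc_gt0.
exists (2 * r * ht x)^-1; last by rewrite mulrC.
by rewrite invr_gt0 !mulr_gt0.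
Qed.

Lemma lb_pnrm1 p : lb (pnrm p) (pnrm p) = 1.
Proof.
case: p => [u s u0|c r r0]; rewrite /lb /=; last by field; rewrite gt_eqF.
have n0 := normc_gt0 u0.
have -> : complex.Re u / normc u * (complex.Re u / normc u) +
  complex.Im u / normc u * (complex.Im u / normc u) -
  (0 * (2 * s / normc u) + 2 * s / normc u * 0) / 2 =
  (complex.Re u ^+ 2 + complex.Im u ^+ 2) / normc u ^+ 2 by field; rewrite gt_eqF.
by rewrite -normc_sqr divff// sqrf_eq0 gt_eqF.
Qed.

Definition nrm h : lorentz R := (-1) ^+ h.2 *: pnrm h.1.

Lemma nrm1 h : lb (nrm h) (nrm h) = 1.
Proof. by rewrite /nrm lbZl lbZr mulrA -expr2 sqrr_sign mul1r lb_pnrm1. Qed.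

Lemma halfspaceP h x : halfspace h x <-> lb (emb x) (nrm h) <= 0.
Proof.
rewrite /halfspace /= /nrm lbZr lb_pnrm; have [a a0 ->] := plvlE h.1 x.
by rewrite (mulrCA _ a) (pmulr_rle0 _ a0); split.
Qed.

Lemma hplane_setP h x : hplane_set h.1 x <-> lb (emb x) (nrm h) = 0.
Proof.
rewrite /hplane_set /= /nrm lbZr lb_pnrm; have [a a0 ->] := plvlE h.1 x.
split=> [->|/eqP]; first by rewrite !mulr0.
by rewrite !mulf_eq0 signr_eq0 gt_eqF//= => /eqP.
Qed.

Lemma refl_sign (b : bool) n v : refl ((-1) ^+ b *: n) v = refl n v.
Proof. by rewrite /refl lbZr scalerA mulrA -!mulrA (mulrC (lb v n)) !mulrA -(mulrA 2) -expr2 sqrr_sign mulr1. Qed.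

Lemma emb_reflect h x : emb (reflect h.1 x) = refl (nrm h) (emb x).
Proof.
rewrite /nrm refl_sign /refl lb_pnrm; case: h.1 => [u s u0|c r r0] /=; have tn := ht_neq0 x.
  have n0 := normc_gt0 u0; have nn : normc u != 0 by rewrite gt_eqF.
  have sq := normc_sqr u.
  case: x tn => [[a b] t t0] /= tn; case: u u0 n0 nn sq => [p q] u0 n0 nn sq.
  move: nn sq; rewrite /emb /cdot /GRing.scale /=; set m := Num.sqrt _ => nn sq.
  apply: lorentz_eq; rewrite /= /cdot /GRing.scale /=.
  - by field; rewrite tn nn.
  - by field; rewrite tn nn.
  - by field; rewrite tn nn.
  - set l := p * a + q * b - s.
    have -> : ((a - (2 * l / m ^+ 2 * p - 0 * q)) ^+ 2 + (b - (2 * l / m ^+ 2 * q + 0 * p)) ^+ 2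
      + t ^+ 2) / t = (a ^+ 2 + b ^+ 2 + t ^+ 2 - 4 * l * (l + s) / m ^+ 2
        + 4 * l ^+ 2 * (p ^+ 2 + q ^+ 2) / m ^+ 4) / t.
      by rewrite /l; field; rewrite tn nn.
    by rewrite -sq; field; rewrite tn nn.
have rn : r != 0 by rewrite gt_eqF.
have := normc_sqr (hz x - c); have t0 := ht_gt0 x.
case: x t0 tn => [[a b] t t0'] /= t0 tn; case: c => p q; rewrite /= => sq.
have D0 : (a - p) ^+ 2 + (b - q) ^+ 2 + t ^+ 2 != 0.
  by rewrite gt_eqF// ltr_wpDl ?exprn_gt0// addr_ge0// sqr_ge0.
apply: lorentz_eq; rewrite /= /GRing.scale /= sq.
- by field; rewrite tn rn D0.
- by field; rewrite tn rn D0.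
- by field; rewrite tn rn D0.
- by field; rewrite tn rn D0.
Qed.

Lemma nrm_surj n : lb n n = 1 -> exists h, nrm h = n.
Proof.
case: n => [[[a b] c] d] n1; have [c0|c0] := eqVneq c 0.
  have ab : a ^+ 2 + b ^+ 2 = 1 by move: n1; rewrite /lb /= c0; lra.
  have u0 : Complex a b != 0.
    apply/eqP => -[a0 b0]; move: ab; rewrite a0 b0 !expr0n/= addr0 => /eqP.
    by rewrite eq_sym oner_eq0.
  exists (Vertical (d / 2) u0, false); rewrite /nrm scale1r /=.
  rewrite ab sqrtr1 !divr1 c0; apply: lorentz_eq => //=; by field.
have r0 : 0 < `|c|^-1 by rewrite invr_gt0 normr_gt0.
(* In [pnrm] a hemisphere has third coordinate [- r^-1], so a positive c calls for the reversed
   side. *)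
exists (Hemisphere (Complex (a / c) (b / c)) r0, 0 < c); rewrite /nrm /=.
rewrite !invrK.
have E : ((-1) ^+ (0 < c)%R * `|c|) = - c.
  have [c1|c1] := ltP 0 c; first by rewrite gtr0_norm// expr1 mulN1r.
  by rewrite ler0_norm// expr0 mul1r.
have d0 : d * c = a ^+ 2 + b ^+ 2 - 1 by move: n1; rewrite /lb /=; lra.
have c2 : `|c|^-1 ^+ 2 = (c ^+ 2)^-1 by rewrite exprVn real_normK// num_real.
apply: lorentz_eq; rewrite /= /GRing.scale /= ?c2 1?mulrCA ?E.
- by field.
- by field.
- by rewrite mulrN E opprK.
- have -> : d = (a ^+ 2 + b ^+ 2 - 1) / c by rewrite -d0 mulfK.
  by field.
Qed.

Definition frame_scale x (v : lorentz R) (a : R) : R[i] * R :=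
  (Complex (a * fr1 x v) (a * fr2 x v), a * fr3 x v).

(** At points of the plane, the Euclidean normal is a positive multiple of the frame coordinates of
    the Lorentz normal; Euclidean angles thus become values of [lb]. *)
Lemma onormal_frame h x : hplane_set h.1 x ->
  onormal h x = frame_scale x (nrm h) (pnorm h.1).
Proof.
rewrite /hplane_set /frame_scale /nrm /onormal /fr1 /fr2 /fr3 /=; set e := (-1) ^+ _.
have tn := ht_neq0 x; case: h.1 => [u s u0|c r r0] /= hx; rewrite /GRing.scale /=.
  have nn : normc u != 0 by rewrite gt_eqF// normc_gt0.
  case: x tn hx => [[a b] t t0] /= tn; case: u u0 nn => p q u0; rewrite /cdot /=.
  set m := Num.sqrt _ => nn hx; congr (_, _).
    by apply: complex_eq => /=; field.
  have -> : s = p * a + q * b by lra.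
  by field; rewrite nn tn.
have rn : r != 0 by rewrite gt_eqF.
move: hx; rewrite normc_sqr; case: x tn => [[a b] t t0] /= tn; case: c => p q /= hx.
congr (_, _); first by apply: complex_eq => /=; field.
have t2 : r ^+ 2 - (a - p) ^+ 2 - (b - q) ^+ 2 = t ^+ 2 by lra.
have -> : e * t = e * (t ^+ 2 + (r ^+ 2 - (a - p) ^+ 2 - (b - q) ^+ 2)) / (2 * t).
  by rewrite t2; field.
by field; rewrite rn tn.
Qed.

Lemma edot_frame x v w (a b : R) : lb v (emb x) = 0 -> lb w (emb x) = 0 ->
  edot (frame_scale x v a) (frame_scale x w b) = a * b * lb v w.
Proof.
move=> vx wx; have := lb_frame x v w; rewrite vx mul0r addr0 => ->.
by rewrite /edot /cdot /frame_scale /=; ring.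
Qed.

Lemma dihedral_angleE h k x : hplane_set h.1 x -> hplane_set k.1 x ->
  dihedral_angle h k x = pi - acos (lb (nrm h) (nrm k)).
Proof.
move=> hx kx; rewrite /dihedral_angle /eangle !onormal_frame//.
move: hx kx => /hplane_setP hx /hplane_setP kx; rewrite lbC in hx; rewrite lbC in kx.
have p0 := pnorm_gt0 h.1; have q0 := pnorm_gt0 k.1.
rewrite !edot_frame// !nrm1 !mulr1 -!expr2 !sqrtr_sqr !gtr0_norm//.
by rewrite mulrC mulKf// gt_eqF// mulr_gt0.
Qed.

End Planes.

(** * Moebius transformations *)

Section Mobius.
Variable R : realType.
Implicit Types (x y : H3 R) (n v w : lorentz R) (A B M : 'M[R[i]]_2).

Lemma lift00 : lift ord0 ord0 = ord_max :> 'I_2.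
Proof. exact/val_inj. Qed.

Lemma ord2P (P : 'I_2 -> Prop) : P ord0 -> P ord_max -> forall i, P i.
Proof.
move=> P0 P1 [[|[|//]] h].
- by rewrite (_ : Ordinal h = ord0)//; exact/val_inj.
- by rewrite (_ : Ordinal h = ord_max)//; exact/val_inj.
Qed.

Lemma mx2P (T : Type) (A B : 'M[T]_2) : A ord0 ord0 = B ord0 ord0 ->
  A ord0 ord_max = B ord0 ord_max -> A ord_max ord0 = B ord_max ord0 ->
  A ord_max ord_max = B ord_max ord_max -> A = B.
Proof. by move=> *; apply/matrixP; apply: ord2P; apply: ord2P. Qed.

Lemma mulmx2 A B i j : (A *m B) i j = A i ord0 * B ord0 j + A i ord_max * B ord_max j.
Proof. by rewrite mxE !big_ord_recl big_ord0 addr0 lift00. Qed.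

Lemma det2 A : \det A = A ord0 ord0 * A ord_max ord_max - A ord0 ord_max * A ord_max ord0.
Proof.
rewrite (expand_det_row _ ord0) !big_ord_recl big_ord0 addr0 lift00 /cofactor !det_mx11 !mxE.
rewrite lift00 (_ : lift ord_max 0 = ord0); last exact/val_inj.
rewrite /= expr0 expr1 !mul1r mulN1r mulrN; congr (_ * A _ _ - _ * A _ _); exact/val_inj.
Qed.

Lemma ReD (z w : R[i]) : complex.Re (z + w) = complex.Re z + complex.Re w.
Proof. by case: z w => [a b] [c d]. Qed.
Lemma ImD (z w : R[i]) : complex.Im (z + w) = complex.Im z + complex.Im w.
Proof. by case: z w => [a b] [c d]. Qed.
Lemma ReN (z : R[i]) : complex.Re (- z) = - complex.Re z.
Proof. by case: z. Qed.
Lemma ImN (z : R[i]) : complex.Im (- z) = - complex.Im z.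
Proof. by case: z. Qed.
Lemma ReM (z w : R[i]) : complex.Re (z * w) =
  complex.Re z * complex.Re w - complex.Im z * complex.Im w.
Proof. by case: z w => [a b] [c d]. Qed.
Lemma ImM (z w : R[i]) : complex.Im (z * w) =
  complex.Re z * complex.Im w + complex.Im z * complex.Re w.
Proof. by case: z w => [a b] [c d]. Qed.
Lemma ReJ (z : R[i]) : complex.Re (conjc z) = complex.Re z.
Proof. by case: z. Qed.
Lemma ImJ (z : R[i]) : complex.Im (conjc z) = - complex.Im z.
Proof. by case: z. Qed.

Definition ReImE := (ReD, ImD, ReN, ImN, ReM, ImM, ReJ, ImJ).

Definition herm v : 'M[R[i]]_2 := \matrix_(i, j)
  if i == ord0 then if j == ord0 then Complex v.2 0 else Complex v.1.1.1 v.1.1.2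
  else if j == ord0 then Complex v.1.1.1 (- v.1.1.2) else Complex v.1.2 0.

Definition unherm M : lorentz R :=
  (complex.Re (M ord0 ord_max), complex.Im (M ord0 ord_max),
   complex.Re (M ord_max ord_max), complex.Re (M ord0 ord0)).

Definition adjm A : 'M[R[i]]_2 := map_mx conjc A^T.

Lemma adjmK : involutive adjm.
Proof. by move=> A; apply/matrixP => i j; rewrite !mxE conjcK. Qed.

Lemma adjmM A B : adjm (A *m B) = adjm B *m adjm A.
Proof. by rewrite /adjm trmx_mul map_mxM. Qed.

Lemma hermK : cancel herm unherm.
Proof. by case=> [[[a b] c] d]; rewrite /unherm !mxE. Qed.

Lemma adj_herm v : adjm (herm v) = herm v.
Proof. by apply: mx2P; rewrite !mxE /= ?oppr0 ?opprK. Qed.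

Lemma unhermK M : adjm M = M -> herm (unherm M) = M.
Proof.
move=> /matrixP h; have Mij i j : conjc (M j i) = M i j by rewrite -[RHS]h !mxE.
apply: mx2P; rewrite !mxE /=.
- move: (Mij ord0 ord0); case: (M _ _) => a b /= -[bb]; congr Complex; lra.
- by case: (M _ _).
- by rewrite -(Mij ord_max ord0); case: (M _ _).
- move: (Mij ord_max ord_max); case: (M _ _) => a b /= -[bb]; congr Complex; lra.
Qed.

Lemma hermD v w : herm (v + w) = herm v + herm w.
Proof.
apply: mx2P; rewrite !mxE /=; apply: complex_eq => //=; rewrite ?addr0// opprD//.
Qed.

Lemma hermZ a v : herm (a *: v) = (Complex a 0) *: herm v.
Proof.
apply: mx2P; rewrite !mxE /=; apply: complex_eq; rewrite !ReImE /= /GRing.scale /=; ring.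
Qed.

(** The action [H -> A H A^*] of SL2(C) on Hermitian matrices, which preserves the determinant. *)
Definition lor A v : lorentz R := unherm (A *m herm v *m adjm A).

Lemma herm_lor A v : herm (lor A v) = A *m herm v *m adjm A.
Proof. by rewrite unhermK// !adjmM adjmK adj_herm mulmxA. Qed.

Lemma herm_inj : injective herm.
Proof. exact: can_inj hermK. Qed.

Lemma lorM A B v : lor (A *m B) v = lor A (lor B v).
Proof. by apply: herm_inj; rewrite !herm_lor adjmM !mulmxA. Qed.

Lemma lor1 v : lor 1%:M v = v.
Proof.
by apply: herm_inj; rewrite herm_lor /adjm trmx1 map_mx1 mul1mx mulmx1.
Qed.

Lemma lorD A v w : lor A (v + w) = lor A v + lor A w.
Proof. by apply: herm_inj; rewrite [LHS]herm_lor [RHS]hermD !herm_lor hermD mulmxDr mulmxDl. Qed.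

Lemma lorZ A a v : lor A (a *: v) = a *: lor A v.
Proof. by apply: herm_inj; rewrite [LHS]herm_lor [RHS]hermZ herm_lor hermZ -scalemxAr -scalemxAl. Qed.

Lemma lorB A v w : lor A (v - w) = lor A v - lor A w.
Proof. by rewrite lorD -scaleN1r lorZ scaleN1r. Qed.

Lemma det_herm v : \det (herm v) = Complex (- lb v v) 0.
Proof.
by rewrite det2 !mxE /=; apply: complex_eq; rewrite !ReImE /= /lb; field.
Qed.

Lemma lb_lor_self A v : \det A = 1 -> lb (lor A v) (lor A v) = lb v v.
Proof.
move=> A1; apply/eqP; rewrite -eqr_opp; apply/eqP.
suff : \det (herm (lor A v)) = \det (herm v) by rewrite !det_herm => -[].
have a1 : \det (adjm A) = 1 by rewrite /adjm det_map_mx det_tr A1 rmorph1.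
by rewrite herm_lor !det_mulmx A1 a1 mul1r mulr1.
Qed.

Lemma lb_polar v w : lb (v + w) (v + w) = lb v v + lb w w + 2 * lb v w.
Proof.
rewrite lbDl (lbDr v) (lbDr w) (lbC w v).
move: (lb v v) (lb v w) (lb w w) => a b c.
lra.
Qed.

Lemma lb_lor A v w : \det A = 1 -> lb (lor A v) (lor A w) = lb v w.
Proof.
move=> A1; have := lb_lor_self (v + w) A1; rewrite lorD.
rewrite (lb_polar (lor A v) (lor A w)) (lb_polar v w).
rewrite (lb_lor_self v A1) (lb_lor_self w A1).
by move=> /addrI/mulfI; apply; rewrite pnatr_eq0.
Qed.

Lemma emb_mobius (A : SL2 R) x : emb (mobius A x) = lor (val A) (emb x).
Proof.
have tn := ht_neq0 x; have D0 := mobius_denom_gt0 A x.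
set v := emb (mobius A x); set w := lor _ _.
have vw : lb v v = lb w w.
  by rewrite lb_emb lb_lor ?lb_emb//; exact/eqP/(valP A).
have v3 : v.1.2 = w.1.2.
  rewrite /v /w /= invf_div /mobius_denom !mulmx2 !mxE /= !normc_sqr.
  rewrite -/(ma A) -/(mb A) -/(mc A) -/(md A) !ReImE /=.
  by field.
have v1 : v.1.1.1 = w.1.1.1.
  have -> : v.1.1.1 = complex.Re ((ma A * hz x + mb A) * conjc (mc A * hz x + md A)
         + ma A * conjc (mc A) * (Complex (ht x ^+ 2) 0)) / ht x.
    by rewrite /v /= ReM /= mulr0 subr0; field; rewrite tn gt_eqF.
  rewrite /w /= !mulmx2 !mxE /= -/(ma A) -/(mb A) -/(mc A) -/(md A) !ReImE /=.
  by field.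
have v2 : v.1.1.2 = w.1.1.2.
  have -> : v.1.1.2 = complex.Im ((ma A * hz x + mb A) * conjc (mc A * hz x + md A)
         + ma A * conjc (mc A) * (Complex (ht x ^+ 2) 0)) / ht x.
    by rewrite /v /= ImM /= mulr0 add0r; field; rewrite tn gt_eqF.
  rewrite /w /= !mulmx2 !mxE /= -/(ma A) -/(mb A) -/(mc A) -/(md A) !ReImE /=.
  by field.
apply: lorentz_eq => //.
(* The last coordinate is forced by [lb v v = lb w w], where its coefficient is [- v.1.2]. *)
have v30 : v.1.2 != 0 by rewrite gt_eqF// emb3_gt0.
by apply: (mulfI v30); move: vw; rewrite /lb v1 v2 v3; lra.
Qed.

Definition mulS (A B : SL2 R) : SL2 R.
Proof.
by exists (val A *m val B); rewrite det_mulmx (eqP (valP A)) (eqP (valP B)) mulr1.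
Defined.

Definition invS (A : SL2 R) : SL2 R.
Proof. by exists (invmx (val A)); rewrite det_inv (eqP (valP A)) invr1. Defined.

Lemma SL2_unit (A : SL2 R) : val A \in unitmx.
Proof. by rewrite unitmxE (eqP (valP A)) unitr1. Qed.

Lemma lor_mulS (A B : SL2 R) v : lor (val (mulS A B)) v = lor (val A) (lor (val B) v).
Proof. exact: lorM. Qed.

Lemma lor_invSK (A : SL2 R) v : lor (val (invS A)) (lor (val A) v) = v.
Proof. by rewrite -lorM /= mulVmx ?SL2_unit// lor1. Qed.

Lemma lorK_invS (A : SL2 R) v : lor (val A) (lor (val (invS A)) v) = v.
Proof. by rewrite -lorM /= mulmxV ?SL2_unit// lor1. Qed.

Lemma lb_lorS (A : SL2 R) v w : lb (lor (val A) v) (lor (val A) w) = lb v w.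
Proof. by rewrite lb_lor//; exact/eqP/(valP A). Qed.

Lemma mobiusK_inv (A : SL2 R) x : mobius A (mobius (invS A) x) = x.
Proof. by apply: emb_inj; rewrite !emb_mobius lorK_invS. Qed.

(** Entrywise conjugation, the reflection in the vertical plane over the real axis; the model of an
    orientation-reversing isometry. *)
Definition conjv v : lorentz R := (v.1.1.1, - v.1.1.2, v.1.2, v.2).

Lemma herm_conjv v : herm (conjv v) = map_mx conjc (herm v).
Proof. by apply: mx2P; rewrite !mxE /= ?oppr0. Qed.

Lemma conjvK : involutive conjv.
Proof. by case=> [[[a b] c] d]; rewrite /conjv /= opprK. Qed.

Lemma conjv_lor A v : conjv (lor A v) = lor (map_mx conjc A) (conjv v).
Proof.
apply: herm_inj; rewrite herm_conjv !herm_lor herm_conjv !map_mxM.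
by rewrite /adjm map_trmx.
Qed.

(* refl n v = N adj(v) N = (i N J) conj(v) (i N J)^*, as herm n has determinant -1 *)
Definition reflm n : 'M[R[i]]_2 := \matrix_(i, j)
  if i == ord0 then if j == ord0 then Complex n.1.1.2 (- n.1.1.1) else Complex 0 n.2
  else if j == ord0 then Complex 0 (- n.1.2) else Complex n.1.1.2 n.1.1.1.

Lemma det_reflm n : lb n n = 1 -> \det (reflm n) = 1.
Proof.
by move=> n1; rewrite det2 !mxE /=; apply: complex_eq; rewrite !ReImE /= -?n1 /lb; field.
Qed.

Lemma refl_lor n v : lb n n = 1 -> refl n v = lor (reflm n) (conjv v).
Proof.
move=> n1; have E : refl n v = lb n n *: v - (2 * lb v n) *: n by rewrite n1 scale1r.
rewrite E; case: n {n1 E} => [[[a b] c] d]; case: v => [[[p q] r] s].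
apply: lorentz_eq; rewrite /= /GRing.scale /lb /= !mulmx2 !mxE /= ?ReImE /=; by field.
Qed.

Definition reflS n (n1 : lb n n = 1) : SL2 R := exist _ (reflm n) (introT eqP (det_reflm n1)).

Definition conjS (A : SL2 R) : SL2 R.
Proof. by exists (map_mx conjc (val A)); rewrite det_map_mx (eqP (valP A)) rmorph1. Defined.

Lemma lor_conjS (A : SL2 R) v : lor (val (conjS A)) v = conjv (lor (val A) (conjv v)).
Proof. by rewrite conjv_lor conjvK. Qed.

(** The isotropic vectors of the boundary points 0 and infinity. *)
Definition pole0 : lorentz R := (0, 0, 1, 0).
Definition poleI : lorentz R := (0, 0, 0, 1).

Lemma sqr_sum_eq0 (a b : R) : a * a + b * b = 0 -> a = 0 /\ b = 0.
Proof.
move/eqP; rewrite paddr_eq0 -?expr2 ?sqr_ge0// !sqrf_eq0 => /andP[/eqP-> /eqP->] //.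
Qed.

Lemma lor_poleI A : (lor A poleI).1.2 =
  complex.Re (A ord_max ord0) ^+ 2 + complex.Im (A ord_max ord0) ^+ 2.
Proof. rewrite /= !mulmx2 !mxE /= !ReImE /=; ring. Qed.

Lemma lor_poleI_eq (A : SL2 R) : mc A = 0 ->
  lor (val A) poleI = (normc (ma A) ^+ 2) *: poleI.
Proof.
move=> c0; apply: lorentz_eq; rewrite /= !mulmx2 !mxE /= -/(ma A) -/(mc A) ?c0 ?normc_sqr !ReImE /=;
  rewrite /GRing.scale /=; ring.
Qed.

Lemma lor_pole0 A : (lor A pole0).2 =
  complex.Re (A ord0 ord_max) ^+ 2 + complex.Im (A ord0 ord_max) ^+ 2.
Proof. rewrite /= !mulmx2 !mxE /= !ReImE /=; ring. Qed.

Lemma lor_poles_diag A : \det A = 1 -> (lor A poleI).1.2 = 0 -> (lor A pole0).2 = 0 ->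
  [/\ A ord_max ord0 = 0, A ord0 ord_max = 0 & A ord0 ord0 * A ord_max ord_max = 1].
Proof.
rewrite lor_poleI lor_pole0 => A1 h h'.
have c0 : A ord_max ord0 = 0.
  by have [? ?] := sqr_sum_eq0 h; apply: complex_eq.
have b0 : A ord0 ord_max = 0.
  by have [? ?] := sqr_sum_eq0 h'; apply: complex_eq.
by split=> //; rewrite -A1 det2 b0 mul0r subr0.
Qed.

(** Fixing both poles makes A diagonal, so it acts on the first two coordinates by a complex
    multiplication, which is never a conjugation. *)
Lemma lor_not_conjv A : \det A = 1 -> ~ (forall v, lor A v = conjv v).
Proof.
move=> A1 h; have hI : (lor A poleI).1.2 = 0 by rewrite h.
have h0 : (lor A pole0).2 = 0 by rewrite h.
have [c0 b0 ad] := lor_poles_diag A1 hI h0.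
have := congr1 (fun v => v.1.1.1) (h (1, 0, 0, 0)).
have := congr1 (fun v => v.1.1.2) (h (0, 1, 0, 0)).
rewrite /conjv /= !mulmx2 !mxE /= ?mulmx2 ?mxE /= c0 b0 !ReImE /=.
lra.
Qed.

Lemma lor_eq_id A : \det A = 1 -> (forall v, lor A v = v) -> A = 1%:M \/ A = - 1%:M.
Proof.
move=> A1 h; have hI : (lor A poleI).1.2 = 0 by rewrite h.
have h0 : (lor A pole0).2 = 0 by rewrite h.
have [c0 b0 ad] := lor_poles_diag A1 hI h0.
have aJ : A ord0 ord0 * conjc (A ord0 ord0) = 1.
  have h1 : herm (lor A poleI) ord0 ord0 = 1 by rewrite h !mxE.
  by rewrite -h1 herm_lor !mulmx2 !mxE /=; apply: complex_eq; rewrite !ReImE /=; ring.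
have aJd : A ord0 ord0 * conjc (A ord_max ord_max) = 1.
  have h1 : herm (lor A (1, 0, 0, 0)) ord0 ord_max = 1 by rewrite h !mxE.
  by rewrite -h1 herm_lor !mulmx2 !mxE /= c0 b0; apply: complex_eq; rewrite !ReImE /=; ring.
have a0 : A ord0 ord0 != 0.
  by apply/eqP => a0; move: ad; rewrite a0 mul0r => /eqP; rewrite eq_sym oner_eq0.
have da : A ord_max ord_max = A ord0 ord0.
  by rewrite -[LHS]conjcK -[RHS]conjcK; congr conjc; apply: (mulfI a0); rewrite aJ aJd.
move: ad; rewrite da -expr2 => /eqP; rewrite sqrf_eq1 => /orP[] /eqP aE.
- by left; apply: mx2P; rewrite ?da ?c0 ?b0 ?aE !mxE.
- by right; apply: mx2P; rewrite ?da ?c0 ?b0 ?aE !mxE /= ?oppr0.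
Qed.

(** Isometry replaces linearity here: [f v - g v] is orthogonal to all [f (emb y) = g (emb y)],
    which exhaust the hyperboloid. *)
Lemma lor_span (f g : lorentz R -> lorentz R) :
  (forall v w, lb (f v) (f w) = lb v w) -> (forall v w, lb (g v) (g w) = lb v w) ->
  (forall x, exists y, emb x = f (emb y)) ->
  (forall x, f (emb x) = g (emb x)) -> forall v, f v = g v.
Proof.
move=> lf lg sf fg v; apply/eqP; rewrite -subr_eq0; apply/eqP/span => x.
have [y ->] := sf x.
by rewrite lbC lbBl lf fg lg subrr.
Qed.

Lemma mobius_eq_lor (A B : SL2 R) : mobius A = mobius B ->
  forall v, lor (val A) v = lor (val B) v.
Proof.
move=> AB; apply: lor_span; [exact: lb_lorS|exact: lb_lorS| |].
- by move=> x; exists (mobius (invS A) x); rewrite -emb_mobius mobiusK_inv.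
- by move=> x; rewrite -!emb_mobius AB.
Qed.

Lemma mobius_eq (A B : SL2 R) : mobius A = mobius B -> A = B \/ val A = - val B.
Proof.
move=> /mobius_eq_lor h.
have [||E|E] := @lor_eq_id (val (mulS (invS B) A)).
- exact/eqP/(valP (mulS (invS B) A)).
- by move=> v; rewrite lor_mulS h lor_invSK.
- left; apply/val_inj; rewrite -[LHS]mul1mx -(mulmxV (SL2_unit B)) -mulmxA.
  by move: E => /= ->; rewrite mulmx1.
- right; rewrite -[LHS]mul1mx -(mulmxV (SL2_unit B)) -mulmxA.
  by move: E => /= ->; rewrite mulmxN mulmx1.
Qed.

Lemma lor_neq_conjv (A B : SL2 R) : ~ (forall v, lor (val A) v = lor (val B) (conjv v)).
Proof.
move=> h; apply: (@lor_not_conjv (val (mulS (invS B) A))).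
  exact/eqP/(valP (mulS (invS B) A)).
by move=> v; rewrite lor_mulS h lor_invSK.
Qed.

Section WordsMobius.
Variables (I : eqType) (e : I -> lorentz R).
Hypothesis e1 : forall i, lb (e i) (e i) = 1.

(** Each letter contributes one conjugation and conjugations cancel in pairs, so the parity of a
    word can be read off its action. *)
Lemma act_mobius (w : seq I) : exists A : SL2 R, forall v,
  act e w v = lor (val A) (if odd (size w) then conjv v else v).
Proof.
have id2 : \det (1%:M : 'M[R[i]]_2) == 1 by rewrite det1.
elim: w => [|s w [A IH]]; first by exists (exist _ 1%:M id2) => v /=; rewrite lor1.
exists (mulS (reflS (e1 s)) (conjS A)) => v.
have -> : act e (s :: w) v = refl (e s) (act e w v) by [].
rewrite IH (refl_lor _ (e1 s)) [RHS]lor_mulS lor_conjS.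
congr (lor _ (conjv (lor _ _))).
by rewrite /=; case: (odd (size w)) => //=; rewrite conjvK.
Qed.

End WordsMobius.
End Mobius.

(** * Convex polyhedra and their Gram matrices *)

Section Convexity.
Variable R : realType.
Implicit Types (x y : H3 R) (n v w : lorentz R).

Lemma lb_unfold v w : lb v w =
  v.1.1.1 * w.1.1.1 + v.1.1.2 * w.1.1.2 - (v.1.2 * w.2 + v.2 * w.1.2) / 2.
Proof. by []. Qed.

(** Row vectors carry the normed topology in which closed bounded sets are compact. *)
Definition rvl (r : 'rV[R]_4) : lorentz R :=
  (r ord0 (inord 0), r ord0 (inord 1), r ord0 (inord 2), r ord0 (inord 3)).

Definition lrv v : 'rV[R]_4 :=
  \row_(j < 4) nth 0 [:: v.1.1.1 : R; v.1.1.2 : R; v.1.2 : R; v.2 : R] j.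

Lemma lrvK v : rvl (lrv v) = v.
Proof. by apply: lorentz_eq; rewrite /= mxE inordK. Qed.

Section LbContinuous.
Let cD (f g : 'rV[R]_4 -> R) : continuous f -> continuous g ->
  continuous (fun r => f r + g r).
Proof. by move=> cf cg r; exact: (@continuousD R R _ f g r (cf r) (cg r)). Qed.
Let cM (f g : 'rV[R]_4 -> R) : continuous f -> continuous g ->
  continuous (fun r => f r * g r).
Proof. by move=> cf cg r; exact: (@continuousM R _ f g r (cf r) (cg r)). Qed.
Let cN (f : 'rV[R]_4 -> R) : continuous f -> continuous (fun r => - f r).
Proof. by move=> cf r; exact: (@continuousN R R _ f r (cf r)). Qed.
Let cK (a : R) : continuous (fun _ : 'rV[R]_4 => a).
Proof. by move=> r; exact: cst_continuous. Qed.
Let cC (j : 'I_4) : continuous (fun r : 'rV[R]_4 => r ord0 j : R).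
Proof. exact: coord_continuous. Qed.

Lemma lb_continuous v : continuous (fun r => lb v (rvl r)).
Proof.
suff H (a b c d : R) (i j k l : 'I_4) : continuous (fun r : 'rV[R]_4 =>
    a * r ord0 i + b * r ord0 j - (c * r ord0 k + d * r ord0 l) / 2 : R) by exact: H.
apply: cD; first by apply: cD; apply: cM.
by apply: cN; apply: cM => //; apply: cD; apply: cM.
Qed.

Lemma lb_sqr_continuous : continuous (fun r => lb (rvl r) (rvl r)).
Proof.
suff H (i j k l : 'I_4) : continuous (fun r : 'rV[R]_4 =>
    r ord0 i * r ord0 i + r ord0 j * r ord0 j -
    (r ord0 k * r ord0 l + r ord0 l * r ord0 k) / 2 : R) by exact: H.
apply: cD; first by apply: cD; apply: cM.
by apply: cN; apply: cM => //; apply: cD; apply: cM.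
Qed.

End LbContinuous.

Opaque lb.

Lemma lb_sumr (I : finType) (P : pred I) (F : I -> lorentz R) v :
  lb v (\sum_(k | P k) F k) = \sum_(k | P k) lb v (F k).
Proof. by apply: (big_morph (lb v)) => [a b|]; [exact: lbDr|exact: lb0r]. Qed.

(* Bartl's inductive proof of the Farkas lemma. *)
Lemma farkas (I : finType) (A : {set I}) (a : I -> lorentz R) (b : lorentz R) :
  (forall w, (forall k, k \in A -> lb w (a k) <= 0) -> lb w b <= 0) ->
  exists c : I -> R, (forall k, 0 <= c k) /\ b = \sum_(k in A) c k *: a k.
Proof.
have [m] := ubnP #|A|; elim: m A a b => // m IH A a b Am h.
have [A0|[k0 k0A]] := set_0Vmem A.
  exists (fun=> 0); split=> //; rewrite A0 big_set0; apply: span => x.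
  apply/eqP; rewrite eq_le h => [|k]; last by rewrite A0 inE.
  by rewrite -oppr_le0 -lbNl h// => k; rewrite A0 inE.
have A' : (#|A :\ k0| < m)%N by rewrite (cardsD1 k0 A) k0A in Am; exact: Am.
have [h1|] := pselect (forall w, (forall k, k \in A :\ k0 -> lb w (a k) <= 0) -> lb w b <= 0).
  have [c [c0 bE]] := IH _ _ _ A' h1.
  exists (fun k => if k == k0 then 0 else c k); split.
    by move=> k; case: ifP.
  rewrite (big_setD1 k0)//= eqxx scale0r add0r bE.
  by apply: eq_bigr => k; rewrite !inE => /andP[/negbTE -> _].
(* Otherwise some w is nonpositive on the other generators and positive on b, hence positive on
   [a k0]. Subtracting multiples of [a k0] projects the problem to the kernel of w; the coefficient
   of [a k0] recovered at the end is nonnegative by the signs of w. *)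
move/existsNP => [w /not_implyP [wA /negP]]; rewrite -ltNge => wb.
have wa : 0 < lb w (a k0).
  rewrite ltNge; apply/negP => wk; have := h w; rewrite leNgt wb => /(_ _)/negP; apply => //.
  by move=> k kA; have [->//|kk] := eqVneq k k0; apply: wA; rewrite !inE kk.
pose r := (lb w (a k0))^-1; have r0 : 0 < r by rewrite invr_gt0.
pose w0 := r *: w.
have w0a : lb w0 (a k0) = 1 by rewrite lbZl mulVf// gt_eqF.
have [k|c [c0 bE]] := IH (A :\ k0) (fun k => a k - lb w0 (a k) *: a k0)
    (b - lb w0 b *: a k0) A'.
  move=> hk; have := h (k - lb k (a k0) *: w0).
  have E d : lb (k - lb k (a k0) *: w0) d = lb k (d - lb w0 d *: a k0).
    by rewrite lbBl lbZl lbBr lbZr (mulrC (lb w0 d)).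
  rewrite E; apply => l lA; rewrite E; have [->|ll] := eqVneq l k0.
    by rewrite w0a scale1r subrr lb0r.
  by apply: hk; rewrite !inE ll.
exists (fun k => if k == k0 then lb w0 b - \sum_(k in A :\ k0) c k * lb w0 (a k) else c k).
split=> [k|].
  case: ifP => // _; rewrite subr_ge0 (@le_trans _ _ 0)//; last first.
    by rewrite lbZl mulr_ge0// ltW.
  apply: sumr_le0 => l lA; rewrite mulr_ge0_le0// lbZl mulr_ge0_le0 ?(ltW r0)//.
  exact: wA.
rewrite (big_setD1 k0)//= eqxx.
have -> : \sum_(k in A :\ k0) (if k == k0 then lb w0 b - \sum_(k in A :\ k0) c k * lb w0 (a k)
    else c k) *: a k = \sum_(k in A :\ k0) c k *: a k.
  by apply: eq_bigr => k; rewrite !inE => /andP[/negbTE -> _].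
rewrite -[LHS](subrK (lb w0 b *: a k0)) bE.
have -> : \sum_(k in A :\ k0) c k *: (a k - lb w0 (a k) *: a k0) =
    \sum_(k in A :\ k0) c k *: a k - (\sum_(k in A :\ k0) c k * lb w0 (a k)) *: a k0.
  by rewrite scaler_suml -sumrB; apply: eq_bigr => k _; rewrite scalerBr scalerA.
rewrite (scalerBl (lb w0 b)) [LHS]addrAC [RHS]addrAC.
by congr (_ - _); exact: addrC.
Qed.

Lemma frame_bound x (m : R) : exists M : R, forall v, `|lb v (emb x)| <= m -> lb v v <= 0 ->
  forall j, `|lrv v ord0 j| <= M.
Proof.
have tn := ht_neq0 x; have t0 := ht_gt0 x.
pose t := ht x; pose a := complex.Re (hz x); pose b := complex.Im (hz x).
pose M3 := (m + m) / t; pose M1 := m + `|a| * M3; pose M2 := m + `|b| * M3.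
pose M4 := (m + m) * t + 2 * (`|a| * M1 + `|b| * M2) + (a ^+ 2 + b ^+ 2) * M3.
exists (M1 + M2 + M3 + M4) => v vm vv.
have m0 : 0 <= m by apply: le_trans vm.
have M30 : 0 <= M3 by rewrite divr_ge0 ?addr_ge0// ltW.
have M10 : 0 <= M1 by rewrite addr_ge0// mulr_ge0.
have M20 : 0 <= M2 by rewrite addr_ge0// mulr_ge0.
have M40 : 0 <= M4.
  apply: addr_ge0; first apply: addr_ge0; apply: mulr_ge0 => //.
  - exact: addr_ge0.
  - exact: ltW.
  - by apply: addr_ge0; exact: mulr_ge0.
  - by apply: addr_ge0; exact: sqr_ge0.
have fr : fr1 x v ^+ 2 + fr2 x v ^+ 2 + fr3 x v ^+ 2 <= m ^+ 2.
  rewrite !expr2 -lb_frame -!expr2 -[X in _ + X]real_normK ?num_real//.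
  by rewrite -[leRHS]add0r lerD// lerXn2r// nnegrE.
have bnd (u : R) : u ^+ 2 <= m ^+ 2 -> `|u| <= m.
  by rewrite -[u ^+ 2]real_normK ?num_real// ler_pXn2r ?nnegrE.
have f1 : `|fr1 x v| <= m.
  by apply: bnd; have := sqr_ge0 (fr2 x v); have := sqr_ge0 (fr3 x v); lra.
have f2 : `|fr2 x v| <= m.
  by apply: bnd; have := sqr_ge0 (fr1 x v); have := sqr_ge0 (fr3 x v); lra.
have f3 : `|fr3 x v| <= m.
  by apply: bnd; have := sqr_ge0 (fr1 x v); have := sqr_ge0 (fr2 x v); lra.
have E3 : v.1.2 = - (lb v (emb x) + fr3 x v) / t.
  by rewrite lb_unfold /fr3 /t /=; field; rewrite tn.
have E1 : v.1.1.1 = fr1 x v + a * v.1.2 by rewrite /fr1 subrK.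
have E2 : v.1.1.2 = fr2 x v + b * v.1.2 by rewrite /fr2 subrK.
have E4 : v.2 = (fr3 x v - lb v (emb x)) * t + 2 * (a * v.1.1.1 + b * v.1.1.2)
    - (a ^+ 2 + b ^+ 2) * v.1.2.
  by rewrite lb_unfold /fr3 /t /a /b /=; field; rewrite tn.
have b3 : `|v.1.2| <= M3.
  rewrite E3 normrM normrN normfV (gtr0_norm t0) ler_wpM2r ?invr_ge0 ?(ltW t0)//.
  by rewrite (le_trans (ler_normD _ _))// lerD.
have b1 : `|v.1.1.1| <= M1.
  by rewrite E1 (le_trans (ler_normD _ _))// lerD// normrM ler_wpM2l.
have b2 : `|v.1.1.2| <= M2.
  by rewrite E2 (le_trans (ler_normD _ _))// lerD// normrM ler_wpM2l.
have b4 : `|v.2| <= M4.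
  rewrite E4 (le_trans (ler_normB _ _))// lerD//; last first.
    by rewrite normrM ger0_norm ?addr_ge0 ?sqr_ge0// ler_wpM2l// addr_ge0 ?sqr_ge0.
  rewrite (le_trans (ler_normD _ _))// lerD//.
    rewrite normrM (gtr0_norm t0) ler_wpM2r ?(ltW t0)// (le_trans (ler_normB _ _))// lerD//.
  rewrite normrM gtr0_norm// ler_wpM2l// (le_trans (ler_normD _ _))//.
  by rewrite !normrM lerD// ler_wpM2l.
case=> [[|[|[|[|//]]]] jlt]; rewrite mxE /=; lra.
Qed.

Opaque emb.

Lemma nearest_point x y0 (F : set (lorentz R)) :
  (forall n, F n -> lb (emb y0) n <= 0) ->
  exists2 a, forall n, F n -> lb (emb a) n <= 0 &
    forall y, (forall n, F n -> lb (emb y) n <= 0) -> ch x a <= ch x y.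
Proof.
move=> y0F.
(* The bound -1 selects the sheet of [emb], and the bound by [ch x y0] makes the set compact. *)
pose S := [set r : 'rV[R]_4 | [/\ lb (rvl r) (rvl r) = -1, lb (emb x) (rvl r) <= -1,
  - ch x y0 <= lb (emb x) (rvl r) & forall n, F n -> lb n (rvl r) <= 0]].
have chn y : lb (emb x) (emb y) <= -1 by have := ch_ge1 x y; rewrite /ch; lra.
have S0 : S (lrv (emb y0)).
  by rewrite /S /= lrvK; split; rewrite ?lb_emb ?/ch ?opprK// => n Fn; rewrite lbC; exact: y0F.
have cS : compact S.
  apply: bounded_closed_compact.
    have [M MP] := frame_bound x (ch x y0).
    exists M; split; first exact: num_real.
    move=> M' MM' r [r1 r2 r3 _]; rewrite /= [leLHS]/Num.norm /= mx_normrE.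
    apply/bigmax_leP; split=> [|[i j] _ /=].
      rewrite (le_trans _ (ltW MM'))// (le_trans _ (MP (emb x) _ _ ord0))//.
        by rewrite lb_emb normrN normr1 ch_ge1.
      by rewrite lb_emb lerN10.
    have rE : r = lrv (rvl r).
      apply/rowP => k; rewrite mxE; case: k => [[|[|[|[|//]]]] klt] /=;
      by congr (r _ _); apply/val_inj; rewrite /= inordK.
    rewrite (ord1 i) rE (le_trans (MP (rvl r) _ _ j)) ?(ltW MM')//; last by rewrite r1 lerN10.
    by rewrite lbC ler_norml; apply/andP; split=> //; have := ch_ge1 x y0; lra.
  have -> : S = [set r | lb (rvl r) (rvl r) = -1] `&` ([set r | lb (emb x) (rvl r) <= -1] `&`
     ([set r | - ch x y0 <= lb (emb x) (rvl r)] `&`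
      \bigcap_(n in F) [set r | lb n (rvl r) <= 0])).
    by apply/seteqP; split => [r [? ? ? ?]|r [? [? [? ?]]]]; split.
  apply: closedI.
    apply: (@preimage_closed _ _ (fun r => lb (rvl r) (rvl r)) [set -1]).
      by move=> r _; exact: lb_sqr_continuous.
    exact: closed_eq.
  apply: closedI.
    apply: (@preimage_closed _ _ (fun r => lb (emb x) (rvl r)) [set u | u <= -1]).
      by move=> r _; exact: lb_continuous.
    exact: closed_le.
  apply: closedI.
    apply: (@preimage_closed _ _ (fun r => lb (emb x) (rvl r)) [set u | - ch x y0 <= u]).
      by move=> r _; exact: lb_continuous.
    exact: closed_ge.
  apply: closed_bigI => n _.
  apply: (@preimage_closed _ _ (fun r => lb n (rvl r)) [set u | u <= 0]).
    by move=> r _; exact: lb_continuous.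
  exact: closed_le.
have [|c cS' cmax] := @compact_EVT_max _ R (fun r => lb (emb x) (rvl r)) S
  (ex_intro _ _ S0) cS.
  by apply: continuous_subspaceT => r; exact: lb_continuous.
move: cS'; rewrite inE => -[c1 c2 c3 c4].
have c5 : 0 < (rvl c).1.2.
  by apply: (lb_future (x := x)); rewrite ?c1 ?ltrN10// lbC (le_lt_trans c2)// ltrN10.
have [a aE] := emb_surj c1 c5.
exists a => [n Fn|y yF]; first by rewrite aE lbC; exact: c4.
have [yy|yy] := leP (ch x y) (ch x y0); last first.
  by rewrite (le_trans _ (ltW yy))// /ch aE lerNl.
rewrite {1}/ch aE lerNl /ch opprK -[emb y]lrvK; apply: cmax; rewrite inE /S /= lrvK.
split; [exact: lb_emb|exact: chn|by rewrite lerNl|move=> n Fn; rewrite lbC; exact: yF].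
Qed.

End Convexity.

Opaque lb emb lor.

Section Facets.
Variable R : realType.
Implicit Types (x y z a : H3 R) (n v w : lorentz R).

Lemma orth3 (a b c : lorentz R) :
  exists2 v : lorentz R, v != 0 & [/\ lb v a = 0, lb v b = 0 & lb v c = 0].
Proof.
pose f (u : lorentz R) : 'cV[R]_4 := \col_(i < 4)
  nth 0 [:: u.1.1.1 : R; u.1.1.2 : R; - u.2 / 2; - u.1.2 / 2] i.
pose M : 'M[R]_(4, 3) := row_mx (f a) (row_mx (f b) (f c)).
have : kermx M != 0.
  rewrite -mxrank_eq0 mxrank_ker -lt0n subn_gt0; apply: leq_ltn_trans (rank_leq_col _) _.
  by [].
move=> /rowV0Pn [r rM r0].
have rM0 : r *m M = 0 by apply/eqP; rewrite -sub_kermx.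
have fE u : r *m f u = (lb (rvl r) u)%:M.
  apply/matrixP => i j; rewrite !ord1 !mxE lb_unfold /= !big_ord_recl big_ord0 !mxE /=.
  rewrite mulr1n.
  have E k (h : (k < 4)%N) (i0 : 'I_4) : val i0 = k -> r ord0 (inord k) = r ord0 i0.
    by move=> <-; congr (r _ _); apply/val_inj; rewrite /= inordK.
  rewrite (E 0%N _ ord0)// (E 1%N _ (lift ord0 ord0))//.
  rewrite (E 2%N _ (lift ord0 (lift ord0 ord0)))// (E 3%N _ (lift ord0 (lift ord0 (lift ord0 ord0))))//.
  by field.
exists (rvl r).
  apply: contraNneq r0 => r0; apply/eqP/rowP => i; rewrite mxE.
  have r00 : lrv (rvl r) = lrv 0 by rewrite r0.
  have := congr1 (fun m : 'rV_4 => m ord0 i) r00; rewrite !mxE.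
  case: i => [[|[|[|[|//]]]] ilt] /= <-; by congr (r _ _); apply/val_inj; rewrite /= inordK.
have : row_mx (r *m f a) (row_mx (r *m f b) (r *m f c)) = row_mx 0 (row_mx 0 0).
  by rewrite !row_mx0 -!mul_mx_row.
rewrite !fE => /eq_row_mx[a0 /eq_row_mx[b0 c0]].
have sc (k : R) : @scalar_mx R 1 k = 0 -> k = 0.
  by move=> /matrixP/(_ ord0 ord0); rewrite !mxE eqxx mulr1n.
by split; exact: sc.
Qed.

(** If b were nonpositive, [lb_CS] would give [(s c)^2 <= s^2 (c^2 - 1)]. So a causal vector has one
    sign on the whole hyperboloid. *)
Lemma causal_sign v x y : lb v v <= 0 -> 0 < lb v (emb x) -> 0 < lb v (emb y).
Proof.
move=> v0 vx; have := lb_CS x v (emb y); rewrite lb_emb (lbC (emb y)).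
have := ch_ge1 x y; rewrite /ch; set c := lb (emb x) (emb y); set s := lb v (emb x) in vx *.
set b := lb v (emb y); move=> c1 h; rewrite ltNge; apply/negP => b0.
have : (s * c) ^+ 2 <= (b + s * c) ^+ 2.
  have : s * c <= 0 by nra.
  nra.
have c2 : 0 <= c ^+ 2 - 1 by nra.
have := mulr_le0_ge0 v0 c2.
have : 0 < s ^+ 2 by rewrite exprn_gt0.
by nra.
Qed.

Section Family.
Variables (I : finType) (e : I -> lorentz R).
Hypothesis e1 : forall i, lb (e i) (e i) = 1.

Lemma stay_all x (A : {set I}) : (forall k, k \in A -> lb (emb x) (e k) < 0) ->
  exists2 d : R, 0 < d & forall y, ch x y < 1 + d -> forall k, k \in A -> lb (emb y) (e k) < 0.
Proof.
move=> h; suff [d d0 hd] : exists2 d : R, 0 < d & forall k, k \in enum A ->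
    forall y, ch x y < 1 + d -> lb (emb y) (e k) < 0.
  by exists d => // y xy k kA; apply: hd => //; rewrite mem_enum.
have : all [in A] (enum A) by apply/allP => k; rewrite mem_enum.
elim: (enum A) => [_|k s IH /= /andP[kA /IH[d d0 hd]]]; first by exists 1.
(* Chosen so that [(1 + t) ^+ 2] is the bound in [lb_stay_lt0]. *)
pose t := Num.sqrt (1 + lb (emb x) (e k) ^+ 2) - 1.
have a0 : 0 < lb (emb x) (e k) ^+ 2 by rewrite exprn_even_gt0//= lt_eqF// h.
have t0 : 0 < t by rewrite subr_gt0 -[ltLHS]sqrtr1 ltr_sqrt ?addr_gt0// ltrDl.
exists (Num.min d t); first by rewrite lt_min d0.
move=> l; rewrite inE => /orP[/eqP ->|ls] y; last first.
  by move=> xy; apply: hd => //; apply: lt_le_trans xy _; rewrite lerD2l ge_min lexx.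
move=> xy; have xt : ch x y < 1 + t.
  by apply: lt_le_trans xy _; rewrite lerD2l ge_min lexx orbT.
apply: (lb_stay_lt0 (x := x)) => //; first exact: h.
have -> : 1 + lb (emb x) (e k) ^+ 2 = (1 + t) ^+ 2.
  by rewrite /t [1 + (_ - _)]addrC subrK sqr_sqrtr// addr_ge0// ltW.
by rewrite ltrXn2r// ?nnegrE ?(le_trans ler01)// ?ch_ge1//; rewrite lerDl ltW.
Qed.

(* A ray from a facet of an irredundant family of half-spaces leaves through
   the facet it violates. *)
Lemma facet_point (F : set (lorentz R)) (A : {set I}) z k :
  (forall n, F n -> lb (emb z) n = 0) ->
  (forall l, l \in A -> lb (emb z) (e l) < 0) -> k \in A ->
  (exists y, [/\ forall n, F n -> lb (emb y) n = 0,
    forall l, l \in A -> l != k -> lb (emb y) (e l) <= 0 & 0 < lb (emb y) (e k)]) ->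
  exists w : H3 R, [/\ forall n, F n -> lb (emb w) n = 0,
    lb (emb w) (e k) = 0 & forall l, l \in A -> l != k -> lb (emb w) (e l) < 0].
Proof.
move=> zF zA kA [y [yF yA yk]]; have zk := zA k kA.
(* The weights make the values of [e k] at y and z cancel. *)
have [|||w [c [c0 wE]]] := @emb_combo R z y (lb (emb y) (e k)) (- lb (emb z) (e k)); try lra.
exists w; split.
- move=> n Fn; rewrite wE lbZl lbDl !lbZl.
  by rewrite (zF n Fn) (yF n Fn) !mulr0 addr0 mulr0.
- by rewrite wE lbZl lbDl !lbZl mulrC; ring.
- move=> l lA lk; rewrite wE lbZl lbDl !lbZl pmulr_rlt0//.
  have := zA l lA; have := yA l lA lk; nra.
Qed.

(** In a minimal subset cutting out the same polyhedron, dropping k admits a point that violates k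
    alone. Taking [F] empty treats Q itself, and [F = [set e i]] treats a side inside its plane. *)
Lemma ex_irredundant (F : set (lorentz R)) (A0 : {set I}) : exists2 A : {set I}, A \subset A0 &
  (forall y, (forall n, F n -> lb (emb y) n = 0) ->
    (forall l, l \in A -> lb (emb y) (e l) <= 0) ->
    forall l, l \in A0 -> lb (emb y) (e l) <= 0) /\
  forall k, k \in A -> exists y, [/\ forall n, F n -> lb (emb y) n = 0,
    forall l, l \in A -> l != k -> lb (emb y) (e l) <= 0 & 0 < lb (emb y) (e k)].
Proof.
pose P (A : {set I}) := `[< forall y, (forall n, F n -> lb (emb y) n = 0) ->
    (forall l, l \in A -> lb (emb y) (e l) <= 0) ->
    forall l, l \in A0 -> lb (emb y) (e l) <= 0 >].
have [|A /minsetP[/asboolP PA minA] AA0] := @minset_exists _ P A0.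
  exact/asboolP.
exists A => //; split=> // k kA.
have : ~ P (A :\ k).
  move=> /minA; rewrite subsetDl => /(_ isT) E.
  by have := kA; rewrite -E !inE eqxx.
move=> /negP/asboolPn/existsNP[y /not_implyP[yF /not_implyP[yA yA0]]].
exists y; split=> //.
  by move=> l lA lk; apply: yA; rewrite !inE lk.
rewrite ltNge; apply/negP => yk; apply: yA0; apply: PA => // l lA.
by have [->//|lk] := eqVneq l k; apply: yA; rewrite !inE lk.
Qed.

End Family.
End Facets.

Section Polyhedron.
Variables (R : realType) (Q : set (H3 R)) (I : finType) (e : I -> lorentz R).
Hypothesis e1 : forall i, lb (e i) (e i) = 1.
Hypothesis QE : forall x, Q x <-> forall i, lb (emb x) (e i) <= 0.
Variable p0 : H3 R.
Hypothesis p0Q : forall i, lb (emb p0) (e i) < 0.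
Hypothesis irr : forall i, exists w : H3 R, lb (emb w) (e i) = 0 /\
  forall j, j != i -> lb (emb w) (e j) < 0.
Hypothesis angles : dihedral_angles_submultiples Q.
Implicit Types (x y z a w : H3 R) (n v : lorentz R) (h : oplane R).

Lemma side_of i h : nrm h = e i -> is_side Q h.
Proof.
move=> hi; split; first by move=> x /QE /(_ i); rewrite -hi => /halfspaceP.
have [w [wi wj]] := irr i; exists w; split; first by apply/hplane_setP; rewrite hi.
have [|d d0 hd] := @stay_all R I e e1 w (~: [set i]).
  by move=> k; rewrite !inE => ki; exact: wj.
have [r r0 hr] := ch_hball d0; exists r => // y [/hplane_setP yi /hr wy].
apply/QE => j; have [->|ji] := eqVneq j i; first by rewrite -hi yi.
by apply/ltW/(hd y wy); rewrite !inE.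
Qed.

Lemma meet_cox i j x y : i != j -> Q x -> Q y -> x <> y ->
  lb (emb x) (e i) = 0 -> lb (emb x) (e j) = 0 ->
  lb (emb y) (e i) = 0 -> lb (emb y) (e j) = 0 -> coxeter_pair (e i) (e j).
Proof.
move=> ij Qx Qy xy xi xj yi yj; right.
have [h hi] := nrm_surj (e1 i); have [k kj] := nrm_surj (e1 j).
have hx : hplane_set h.1 x by apply/hplane_setP; rewrite hi.
have kx : hplane_set k.1 x by apply/hplane_setP; rewrite kj.
have hy : hplane_set h.1 y by apply/hplane_setP; rewrite hi.
have ky : hplane_set k.1 y by apply/hplane_setP; rewrite kj.
have sx : side_inter Q h k x by [].
have sy : side_inter Q h k y by [].
have adj : adjacent_sides Q h k.
  split; [exact: side_of hi|exact: side_of kj| |by exists x, y].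
  move=> E; have [w [wi wj]] := irr i.
  have /hplane_setP : hplane_set k.1 w by rewrite -E; apply/hplane_setP; rewrite hi.
  by rewrite kj => w0; have := wj j; rewrite eq_sym ij w0 ltxx => /(_ isT).
have [m m2 am] := angles adj sx; exists m => //.
rewrite -hi -kj; move: am; rewrite dihedral_angleE//.
(* Both normals are tangent at x, so [lb_CS] bounds their product and [acos] can be inverted. *)
have lx : (lb (nrm h) (nrm k)) ^+ 2 <= 1.
  have := lb_CS x (nrm h) (nrm k); rewrite !nrm1 (lbC _ (emb x)) (lbC (nrm k) (emb x)).
  by rewrite hi kj xi xj mulr0 addr0 expr0n/= !addr0 mulr1.
have l1 : -1 <= lb (nrm h) (nrm k) <= 1 by move: lx; move: (lb _ _) => b lx; apply/andP; split; nra.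
move=> E; have -> : lb (nrm h) (nrm k) = cos (pi - pi / m%:R).
  by rewrite -E subKr acosK.
by rewrite cosB cospi sinpi mul0r addr0 mulN1r.
Qed.

(** From a point interior to the common face one can slide along the intersection of the two planes;
    this gives the second common point required by [adjacent_sides]. *)
Lemma edge_cox i k (A : {set I}) w : i != k -> lb (emb w) (e i) = 0 -> lb (emb w) (e k) = 0 ->
  (forall l, l \in A -> lb (emb w) (e l) < 0) ->
  (forall y, lb (emb y) (e i) = 0 -> lb (emb y) (e k) = 0 ->
    (forall l, l \in A -> lb (emb y) (e l) <= 0) -> Q y) ->
  coxeter_pair (e i) (e k).
Proof.
move=> ik wi wk wA AQ.
have [d d0 hd] := stay_all e1 wA.
have [v v0 [vw vi vk]] := orth3 (emb w) (e i) (e k).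
have [r r0 hr] := perturb vw d0.
have [|y [c [c0 yE wy cd]]] := hr (r / 2).
  by rewrite gtr0_norm ?divr_gt0// ltr_pdivrMr// ltr_pMr// ltr1n.
have yn n : lb v n = 0 -> lb (emb w) n = 0 -> lb (emb y) n = 0.
  by move=> vn wn; rewrite yE lbZl lbDl lbZl vn wn mulr0 addr0 mulr0.
apply: (@meet_cox i k w y ik _ _ _ wi wk (yn _ vi wi) (yn _ vk wk)).
- by apply: AQ => // l lA; exact/ltW/wA.
- apply: AQ => [||l lA]; [exact: yn|exact: yn|].
  by apply/ltW/hd => //; rewrite wy.
- move=> E; move: yE; rewrite -E => yE.
  have cE : c = 1 by rewrite -wy -E chxx.
  move: yE; rewrite cE scale1r => /eqP; rewrite -[X in X == _]addr0 => /eqP/addrI/eqP.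
  by rewrite eq_sym scaler_eq0 (negbTE v0) orbF gt_eqF// divr_gt0.
Qed.

(* Non-obtuse dihedral angles: the nearest point of a side to a point of its
   plane is also the nearest point of the whole polyhedron. *)
Lemma side_projection i x : lb (emb x) (e i) = 0 -> exists a,
  [/\ Q a, lb (emb a) (e i) = 0 & forall q, Q q -> ch x a * ch a q <= ch x q].
Proof.
move=> xi; have [w [wi wj]] := irr i.
pose F := [set e i].
have [A Ai [Agen Airr]] := @ex_irredundant R I e F (~: [set i]).
have ki k : k \in A -> k != i by move=> /(fintype.subsetP Ai); rewrite !inE.
have AQ y : lb (emb y) (e i) = 0 -> (forall l, l \in A -> lb (emb y) (e l) <= 0) -> Q y.
  move=> yi yA; apply/QE => j; have [->|ji] := eqVneq j i; first by rewrite yi.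
  by apply: (Agen y) => //; [move=> n ->|rewrite !inE].
(* Every facet of the side, cut out within its plane, is a true edge of Q, so the angle hypothesis
   applies to it. *)
have nonpos k : k \in A -> lb (e k) (e i) <= 0.
  move=> kA; have wF n : F n -> lb (emb w) n = 0 by move=> ->.
  have wA l : l \in A -> lb (emb w) (e l) < 0 by move=> /ki; exact: wj.
  have [u [uF uk uA]] := facet_point wF wA kA (Airr k kA).
  rewrite lbC; apply: coxeter_pair_le0; apply: (@edge_cox i k (A :\ k) u).
  - by rewrite eq_sym ki.
  - exact: uF.
  - exact: uk.
  - by move=> l; rewrite !inE => /andP[lk lA]; exact: uA.
  - move=> y yi yk yA; apply: AQ => // l lA; have [->|lk] := eqVneq l k; first by rewrite yk.
    by apply: yA; rewrite !inE lk.
(* Including both [e i] and [- e i] confines the minimization to the plane. *)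
pose F' := [set n | n = e i \/ n = - e i \/ exists2 k, k \in A & n = e k].
have F'P y : (forall n, F' n -> lb (emb y) n <= 0) <->
    (lb (emb y) (e i) = 0 /\ forall l, l \in A -> lb (emb y) (e l) <= 0).
  split=> [h|[yi yA] n [->|[->|[k kA ->]]]]; last exact: yA.
  - split=> [|l lA]; last by apply: h; right; right; exists l.
    apply/eqP; rewrite eq_le h; last by left.
    by rewrite -oppr_le0 -lbNr h//; right; left.
  - by rewrite yi.
  - by rewrite lbNr yi oppr0.
have wF' : forall n, F' n -> lb (emb w) n <= 0.
  by apply/F'P; split=> // l /ki li; exact/ltW/wj.
have [a /F'P[ai aA] amin] := nearest_point x wF'.
have Qa : Q a by exact: AQ.
exists a; split=> // q Qq.
set al := ch x a; have al1 : 1 <= al by exact: ch_ge1.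
pose Act := [set k in A | lb (emb a) (e k) == 0].
pose u := emb x - al *: emb a.
have ua : lb u (emb a) = 0 by rewrite /u lbBl lbZl lb_emb mulrN1 opprK /al /ch subrr.
have ui : lb u (e i) = 0 by rewrite /u lbBl lbZl xi ai mulr0 subrr.
(* First variation: u is tangent at a and directed towards x, and no admissible direction v from a
   may decrease the distance to x. *)
have var v : lb v (emb a) = 0 -> lb v (e i) = 0 ->
    (forall k, k \in Act -> lb v (e k) <= 0) -> lb v u <= 0.
  move=> va vi vA.
  have -> : lb v u = lb v (emb x) by rewrite /u lbBr lbZr va mulr0 subr0.
  rewrite leNgt; apply/negP => vx; set b := lb v (emb x) in vx.
  have [k|d d0 hd] := @stay_all R I e e1 a (A :\: Act).
    rewrite !inE => /andP[+ kA]; rewrite kA /= => ak.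
    by rewrite lt_neqAle ak aA.
  have [r r0 hr] := perturb va d0.
  pose W := lb v v; have W0 : 0 <= W by exact: lb_tangent_ge0 va.
  (* After a step t the cosine is [c (al - t b)] with [c^2 (1 - t^2 W) = 1]. It is less than al once
     [t (b^2 + al^2 W) < 2 al b], and t is taken within half of this bound. *)
  pose den := b ^+ 2 + al ^+ 2 * W + 1.
  have den0 : 0 < den.
    by apply: ltr_wpDl => //; apply: addr_ge0; [exact: sqr_ge0|rewrite mulr_ge0 ?sqr_ge0].
  pose t := Num.min (r / 2) (al * b / den).
  have alb : 0 < al * b by rewrite mulr_gt0// (lt_le_trans ltr01).
  have t0 : 0 < t by rewrite lt_min !divr_gt0.
  have tr : `|t| < r.
    rewrite gtr0_norm// /t gt_min ltr_pdivrMr// ltr_pMr// ltr1n//.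
  have tden : t * den <= al * b by rewrite -ler_pdivlMr// ge_min lexx orbT.
  have [y [c [c0 yE ay cd]]] := hr t tr.
  have yF : forall n, F' n -> lb (emb y) n <= 0.
    apply/F'P; split; first by rewrite yE lbZl lbDl lbZl ai vi mulr0 addr0 mulr0.
    move=> l lA; have [lAct|lAct] := boolP (l \in Act).
      rewrite yE lbZl lbDl lbZl; move: (lAct); rewrite inE => /andP[_ /eqP ->].
      by rewrite add0r pmulr_rle0// pmulr_rle0// vA.
    by apply/ltW/(hd y); [rewrite ay|rewrite finset.in_setD lAct lA].
  have := amin y yF; rewrite -/al.
  have -> : ch x y = c * (al - t * b).
    by rewrite /ch yE lbZr lbDr lbZr (lbC _ v) -/b /al /ch; ring.
  have cc : c ^+ 2 * (1 - t ^+ 2 * W) = 1.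
    have := lb_emb y; rewrite yE lbZl lbZr lbDl !lbDr lb_emb !lbZl !lbZr va (lbC _ v) va -/W.
    by lra.
  move=> h; have h2 : al ^+ 2 <= c ^+ 2 * (al - t * b) ^+ 2.
    by rewrite -exprMn ler_pXn2r// nnegrE; lra.
  have W1 : 0 < 1 - t ^+ 2 * W.
    by rewrite -(pmulr_rgt0 _ (exprn_gt0 2 c0)) cc.
  have h3 : al ^+ 2 * (1 - t ^+ 2 * W) <= (al - t * b) ^+ 2.
    by have := ler_wpM2r (ltW W1) h2; rewrite [leRHS]mulrAC cc mul1r.
  have h4 : 2 * (al * b) * t <= t * (t * (b ^+ 2 + al ^+ 2 * W)) by nra.
  have h5 : t * (b ^+ 2 + al ^+ 2 * W) <= al * b.
    by apply: le_trans tden; rewrite ler_wpM2l ?(ltW t0)// lerDl.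
  have : 2 * (al * b) <= t * (b ^+ 2 + al ^+ 2 * W).
    by rewrite -(ler_pM2r t0) (le_trans h4)// [leRHS]mulrC.
  by lra.
(* By duality u is a nonnegative combination of the active normals projected to the plane of i. *)
have Farkas : exists c : I -> R, (forall k, 0 <= c k) /\
    u = \sum_(k in Act) c k *: (e k - lb (e k) (e i) *: e i).
  apply: farkas => v vA.
  pose v' := v - lb v (e i) *: e i + lb v (emb a) *: emb a.
  have <- : lb v' u = lb v u.
    by rewrite /v' lbDl lbBl !lbZl (lbC (e i)) ui (lbC (emb a)) ua !mulr0 subr0 addr0.
  apply: var.
  - by rewrite /v' lbDl lbBl !lbZl lb_emb (lbC (e i)) ai; ring.
  - by rewrite /v' lbDl lbBl !lbZl ai e1; ring.
  - move=> k kAct; have := vA k kAct; rewrite lbBr lbZr /v' lbDl lbBl !lbZl.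
    move: kAct; rewrite inE => /andP[_ /eqP ->]; rewrite (lbC (e i)).
    by lra.
have [c [c0 uE]] := Farkas.
(* Non-obtuse angles enter here: the projected normal is [e k] plus a nonnegative multiple of [e i],
   so it is nonpositive on all of Q, not only on the side. *)
have uq : lb (emb q) u <= 0.
  rewrite uE lb_sumr; apply: sumr_le0 => k; rewrite inE => /andP[kA _].
  rewrite lbZr lbBr lbZr mulr_ge0_le0//.
  have := nonpos k kA; have /QE Qq' := Qq; have := Qq' k; have := Qq' i; nra.
by move: uq; rewrite /u lbBr lbZr /ch (lbC (emb a) (emb q)) (lbC (emb x) (emb q)); lra.
Qed.

(* The projections of a common point of the two planes onto the two sides
   coincide, so the sides meet.  If they met in a vertex a only, all points of
   the common line would project to a, and Q would lie in the plane through a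
   orthogonal to that line. *)
Lemma planes_meet_cox i j x : i != j -> lb (emb x) (e i) = 0 -> lb (emb x) (e j) = 0 ->
  coxeter_pair (e i) (e j).
Proof.
move=> ij xi xj.
have common z : lb (emb z) (e i) = 0 -> lb (emb z) (e j) = 0 -> exists a,
    [/\ Q a, lb (emb a) (e i) = 0, lb (emb a) (e j) = 0 &
      forall q, Q q -> ch z a * ch a q <= ch z q].
  move=> zi zj; have [a [Qa ai az]] := side_projection zi.
  have [b [Qb bj bz]] := side_projection zj.
  (* Applying each projection inequality to the other foot gives [ch a b <= 1]. *)
  have : a = b.
    apply: ch_eq1; have := az b Qb; have := bz a Qa; rewrite (chC b a).
    have := ch_ge1 a b; have := ch_ge1 z a; have := ch_ge1 z b.
    move: (ch z a) (ch z b) (ch a b) => p q r p1 q1 r1 h1 h2.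
    by apply/eqP; rewrite eq_le r1 andbT; nra.
  by move=> E; exists a; split=> //; rewrite E.
have [a [Qa ai aj _]] := common x xi xj.
have [v v0 [va vi vj]] := orth3 (emb a) (e i) (e j).
have [r r0 hr] := perturb va ltr01.
have r2 : `|r / 2| < r by rewrite gtr0_norm ?divr_gt0// ltr_pdivrMr// ltr_pMr// ltr1n.
have r2' : `|- (r / 2)| < r by rewrite normrN.
have [[b [Qb bi bj ba]]|nob] := pselect (exists b, [/\ Q b, lb (emb b) (e i) = 0, lb (emb b) (e j) = 0 & a <> b]).
  exact: (@meet_cox i j a b).
exfalso.
(* A point of the common line on either side of a projects to a, so every q satisfies this
   inequality for both signs of s. *)
have half s : `|s| < r -> forall q, Q q -> lb (s *: v) (emb q) <= 0.
  move=> sr q Qq; have [y [c [c0 yE ay cd]]] := hr s sr.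
  have yn n : lb v n = 0 -> lb (emb a) n = 0 -> lb (emb y) n = 0.
    by move=> vn wn; rewrite yE lbZl lbDl lbZl vn wn mulr0 addr0 mulr0.
  have [a' [Qa' ai' aj' h]] := common y (yn _ vi ai) (yn _ vj aj).
  have aa : a' = a by apply: contrapT => aa; apply: nob; exists a'; split=> // E; exact: aa.
  have := h q Qq; rewrite aa chC ay {2}/ch yE lbZl lbDl /ch.
  rewrite -mulrN (ler_pM2l c0).
  by move: (lb (emb a) (emb q)) (lb (s *: v) (emb q)) => X Y; lra.
have vq q : Q q -> lb (emb q) v = 0.
  move=> Qq; have := half _ r2 q Qq; have := half _ r2' q Qq.
  rewrite !lbZl (lbC v) => h1 h2; have r20 : 0 < r / 2 by rewrite divr_gt0.
  by apply/eqP; rewrite eq_le; apply/andP; split; nra.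
have [|d d0 hd] := @stay_all R I e e1 p0 [set: I]; first by move=> k _; exact: p0Q.
move/eqP: v0; apply; apply: (span_local (x := p0) d0) => y y0.
by apply: vq; apply/QE => k; apply/ltW/hd.
Qed.

(** For planes that do not meet, [m ^+ 2 >= 1]. The case [m >= 1] would mean nested half-spaces, one
    of them redundant. *)
Lemma gram_cox i j : i != j -> coxeter_pair (e i) (e j).
Proof.
move=> ij; have [[x [xi xj]]|nox] := pselect (exists x, lb (emb x) (e i) = 0 /\ lb (emb x) (e j) = 0).
  exact: planes_meet_cox xi xj.
left; set m := lb (e i) (e j).
have m1 : 1 <= m ^+ 2.
  rewrite leNgt; apply/negP => m1; apply: nox.
  have D0 : 1 - m ^+ 2 != 0 by rewrite gt_eqF// subr_gt0.
  (* If [m ^+ 2 < 1], removing from [emb p0] its components along the two normals leaves a timelike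
     vector, that is, a common point of the planes. *)
  pose A := lb (emb p0) (e i); pose B := lb (emb p0) (e j).
  pose a := (A - m * B) / (1 - m ^+ 2); pose b := (B - m * A) / (1 - m ^+ 2).
  pose v := emb p0 - a *: e i - b *: e j.
  have vi : lb v (e i) = 0.
    by rewrite /v !lbBl !lbZl e1 (lbC (e j)) -/m -/A /a /b; field.
  have vj : lb v (e j) = 0.
    by rewrite /v !lbBl !lbZl e1 -/m -/B /a /b; field.
  have vp : lb v (emb p0) = -1 - (a * A + b * B).
    by rewrite /v !lbBl !lbZl lb_emb !(lbC _ (emb p0)) -/A -/B; ring.
  have vv : lb v v = -1 - (a * A + b * B).
    by rewrite {2}/v !lbBr !lbZr vi vj !mulr0 !subr0 vp.
  have pos : 0 <= a * A + b * B.
    have -> : a * A + b * B = ((A - m * B) ^+ 2 / (1 - m ^+ 2)) + B ^+ 2.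
      by rewrite /a /b; field.
    by rewrite addr_ge0 ?sqr_ge0// divr_ge0 ?sqr_ge0// subr_ge0 ltW.
  have vv0 : lb v v < 0 by rewrite vv; lra.
  have [|x [c [c0 _ xE]]] := emb_scale vv0.
    by apply: (lb_future (x := p0)) => //; rewrite vp; lra.
  by exists x; rewrite xE !lbZl vi vj !mulr0.
have [m0|m0] := leP m 0; first by nra.
(* Now [e i - e j] is causal, yet it takes opposite signs at interior points of the two sides. *)
exfalso; have [w [wi wj]] := irr i; have [u [uj ui]] := irr j.
have n0 : lb (e i - e j) (e i - e j) <= 0.
  by rewrite lbBl !lbBr !e1 (lbC (e j)) -/m; nra.
have h1 : 0 < lb (e i - e j) (emb w).
  by rewrite lbBl !(lbC _ (emb w)) wi sub0r oppr_gt0; apply: wj; rewrite eq_sym.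
have := causal_sign u n0 h1.
by rewrite lbBl !(lbC _ (emb u)) uj subr0 ltNge (ltW (ui _ ij)).
Qed.

End Polyhedron.

(** * The group of even words and the doubled chamber *)

Section Words.
Variable R : realType.
Implicit Types (x y z : H3 R) (n v : lorentz R).

(** A total function of n, so that words can act; the identity is a junk value for vectors that are
    not unit. *)
Definition hrefl n : H3 R -> H3 R :=
  if pselect (lb n n = 1) is left n1 then reflect (projT1 (cid (nrm_surj n1))).1 else id.

Lemma emb_hrefl n x : lb n n = 1 -> emb (hrefl n x) = refl n (emb x).
Proof.
rewrite /hrefl; case: pselect => // n1 _; case: cid => h /= hn.
by rewrite emb_reflect hn.
Qed.

Lemma hrefl_nrm h : hrefl (nrm h) = reflect h.1.
Proof. by apply/funext => x; apply: emb_inj; rewrite emb_hrefl ?nrm1// emb_reflect. Qed.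

Section Action.
Variables (I : finType) (e : I -> lorentz R).
Hypothesis e1 : forall i, lb (e i) (e i) = 1.
Implicit Types (w u : seq I).

Definition hact w : H3 R -> H3 R := foldr (fun i f => hrefl (e i) \o f) id w.

Lemma emb_hact w x : emb (hact w x) = act e w (emb x).
Proof. by elim: w => //= i w IH; rewrite emb_hrefl// IH. Qed.

Lemma hact_cat w u : hact (w ++ u) = hact w \o hact u.
Proof. by elim: w => //= i w ->. Qed.

Lemma hactE w u : hact w = hact u <-> aeq e w u.
Proof.
split=> [wu|wu]; last by apply/funext => x; apply: emb_inj; rewrite !emb_hact wu.
apply: lor_span => [v v'|v v'|x|x]; [exact: lb_act|exact: lb_act| |].
- by exists (hact (rev w) x); rewrite emb_hact act_Krev.
- by rewrite -!emb_hact wu.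
Qed.

Lemma hact_revK w x : hact (rev w) (hact w x) = x.
Proof. by apply: emb_inj; rewrite !emb_hact act_revK. Qed.

Lemma hact_Krev w x : hact w (hact (rev w) x) = x.
Proof. by apply: emb_inj; rewrite !emb_hact act_Krev. Qed.

Lemma ch_hact w x y : ch (hact w x) (hact w y) = ch x y.
Proof. by rewrite /ch !emb_hact lb_act. Qed.

Lemma hact_parity w u : hact w = hact u -> odd (size w) = odd (size u).
Proof.
move=> /hactE wu; have [A wA] := act_mobius e1 w; have [B uB] := act_mobius e1 u.
have AB v : lor (val A) (if odd (size w) then conjv v else v) =
    lor (val B) (if odd (size u) then conjv v else v) by rewrite -wA -uB wu.
case: (odd (size w)) AB; case: (odd (size u)) => // AB; exfalso.
- by apply: (@lor_neq_conjv _ B A) => v; rewrite AB.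
- by apply: (@lor_neq_conjv _ A B).
Qed.

Lemma hact_even_mobius w : ~~ odd (size w) -> exists A, hact w = mobius A.
Proof.
move=> /negbTE ew; have [A wA] := act_mobius e1 w; exists A; apply/funext => x.
by apply: emb_inj; rewrite emb_hact emb_mobius wA ew.
Qed.

Definition wgroup : set (H3 R -> H3 R) := range hact.
Definition egroup : set (H3 R -> H3 R) := [set hact w | w in [set w | ~~ odd (size w)]].

Lemma wgroup_group : is_group wgroup.
Proof.
split; first by exists [::].
- by move=> _ _ [w _ <-] [u _ <-]; exists (w ++ u) => //; exact: hact_cat.
- move=> _ [w _ <-]; exists (hact (rev w)); split; first by exists (rev w).
  + by apply/funext => x; exact: hact_Krev.
  + by apply/funext => x; exact: hact_revK.
Qed.

Lemma egroup_group : is_group egroup.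
Proof.
split; first by exists [::].
- move=> _ _ [w we <-] [u ue <-]; exists (w ++ u); last exact: hact_cat.
  by rewrite /= size_cat oddD (negbTE we) (negbTE ue).
- move=> _ [w we <-]; exists (hact (rev w)); split; first by exists (rev w); rewrite //= size_rev.
  + by apply/funext => x; exact: hact_Krev.
  + by apply/funext => x; exact: hact_revK.
Qed.

Lemma egroupP w : egroup (hact w) <-> ~~ odd (size w).
Proof. by split=> [[u ue /hact_parity <-]|we]; [|exists w]. Qed.

Lemma wgroup_gen (S : set (H3 R -> H3 R)) : (forall i, S (hrefl (e i))) ->
  (forall f, S f -> exists i, f = hrefl (e i)) -> generated S = wgroup.
Proof.
move=> eS Se; apply/seteqP; split.
- move=> f; apply; split; first exact: wgroup_group.
  by move=> g /Se[i ->]; exists [:: i].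
- move=> _ [w _ <-] G [[Gid Gm _] SG].
  by elim: w => //= i w IH; apply: Gm => //; exact/SG/eS.
Qed.

Lemma egroup_index2 (t : I) : index2_subgroup wgroup egroup.
Proof.
split; first exact: egroup_group.
- by move=> _ [w _ <-]; exists w.
have Ee w : ~~ odd (size w) -> [set hact w \o k | k in egroup] = egroup.
  move=> we; apply/seteqP; split => [_ [_ [u ue <-] <-]|_ [u ue <-]].
    by exists (w ++ u); rewrite ?hact_cat//= size_cat oddD (negbTE we).
  exists (hact (rev w ++ u)).
    by apply/egroupP; rewrite size_cat size_rev oddD (negbTE we).
  by apply/funext => x; rewrite hact_cat /= hact_Krev.
have Eo w : odd (size w) -> [set hact w \o k | k in egroup] = [set hact w | w in [set w | odd (size w)]].
  move=> we; apply/seteqP; split => [_ [_ [u ue <-] <-]|_ [u /= ue <-]].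
    by exists (w ++ u); rewrite ?hact_cat//= size_cat oddD we (negbTE ue).
  exists (hact (rev w ++ u)).
    by apply/egroupP; rewrite size_cat size_rev oddD we ue.
  by apply/funext => x; rewrite hact_cat /= hact_Krev.
pose f (n : nat) := if n is 0%N then egroup else [set hact w | w in [set w | odd (size w)]].
have -> : left_cosets wgroup egroup = f @` `I_2.
  apply/seteqP; split => [_ [_ [w _ <-] <-]|_ [[|[|//]] _ <-] /=].
  - have [wo|we] := boolP (odd (size w)); last by exists 0%N; rewrite //= Ee.
    by exists 1%N; rewrite //= Eo.
  - by exists (hact [::]); [exists [::]|rewrite Ee].
  - by exists (hact [:: t]); [exists [:: t]|rewrite Eo].
have EO : egroup <> [set hact w | w in [set w | odd (size w)]].
  move=> E; have : egroup (hact [:: t]) by rewrite E; exists [:: t].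
  by move/egroupP.
apply: inj_card_eq => [[|[|m]] [|[|k]]]; rewrite ?inE//= => _ _ E.
by case: EO.
Qed.

Definition cell : set (H3 R) := [set x | forall i, lb (emb x) (e i) <= 0].

Hypothesis e_cox : forall i j, i != j -> coxeter_pair (e i) (e j).
Variable p0 : H3 R.
Hypothesis p0C : forall i, lb (emb p0) (e i) < 0.

Lemma stab_p0 w : hact w p0 = p0 -> hact w = id.
Proof.
move=> /(congr1 (@emb R)); rewrite emb_hact => h.
have Cp : cone e (emb p0) by move=> i; exact/ltW/p0C.
have [[|i u] wu] := stab_cone e1 e_cox Cp h; first by move=> _; apply/(hactE w [::]).
by rewrite /= lt_eqF// p0C.
Qed.

(** Points near [p0] lie in the chamber, which contains only one point of the orbit. *)
Lemma orbit_sep : exists2 d : R, 0 < d & forall w, ch p0 (hact w p0) < 1 + d -> hact w = id.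
Proof.
have [|d d0 hd] := @stay_all R I e e1 p0 [set: I]; first by move=> k _; exact: p0C.
exists d => // w wd; apply: stab_p0; apply: emb_inj; rewrite emb_hact.
apply: (act_cone_fix e1 e_cox) => [i|i]; first exact/ltW/p0C.
by rewrite -emb_hact; exact/ltW/hd.
Qed.

(* Pigeonhole principle on a grid: a ball contains finitely many orbit points. *)
Lemma orbit_min x : exists w0, forall w, ch x (hact w0 p0) <= ch x (hact w p0).
Proof.
have [d d0 sep] := orbit_sep.
have [M MP] := frame_bound x (ch x p0).
pose eta := Num.min 1 (d / 3).
have eta0 : 0 < eta by rewrite lt_min ltr01 divr_gt0.
have eta1 : eta <= 1 by rewrite ge_min lexx.
have etad : eta <= d / 3 by rewrite ge_min lexx orbT.
pose N := (Num.truncn ((M + M) / eta)).+1.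
(* The grid cell of mesh eta containing an orbit point; the claim is that each cell holds at most
   one orbit point of the ball. *)
pose code w : {ffun 'I_4 -> 'I_N.+1} :=
  [ffun j => inord (Num.truncn ((lrv (emb (hact w p0)) ord0 j + M) / eta))].
have inball w : ch x (hact w p0) <= ch x p0 -> forall j, `|lrv (emb (hact w p0)) ord0 j| <= M.
  move=> wx; apply: MP; last by rewrite lb_emb lerN10.
  by rewrite lbC -normrN ger0_norm//; have := ch_ge1 x (hact w p0); rewrite /ch; lra.
have codeP w u : ch x (hact w p0) <= ch x p0 -> ch x (hact u p0) <= ch x p0 ->
    code w = code u -> hact w p0 = hact u p0.
  move=> wx ux wu.
  have close j : `|lrv (emb (hact w p0)) ord0 j - lrv (emb (hact u p0)) ord0 j| < eta.
    have := congr1 (fun f : {ffun 'I_4 -> 'I_N.+1} => val (f j)) wu; rewrite !ffunE /=.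
    have := inball w wx j; have := inball u ux j.
    set a := lrv _ _ _; set b := lrv _ _ _; rewrite !ler_norml => /andP[a1 a2] /andP[b1 b2].
    have pos c : - M <= c -> 0 <= (c + M) / eta.
      by move=> c1; rewrite divr_ge0// ?(ltW eta0)//; lra.
    have bnd c : - M <= c -> c <= M -> (Num.truncn ((c + M) / eta) < N.+1)%N.
      move=> c1 c2; rewrite ltnS ltnW// ltnS le_truncn// ler_pM2r ?invr_gt0//; lra.
    rewrite !inordK ?bnd// => E.
    have /andP[t1 t2] := truncn_itv (pos a a1); have /andP[s1 s2] := truncn_itv (pos b b1).
    rewrite E in s1 s2; move: t1 t2 s1 s2; rewrite -natr1; set k := _%:R.
    rewrite !ler_pdivlMr// !ltr_pdivrMr// ltr_norml => *; apply/andP; split; lra.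
  (* Here [ch - 1] is half the [lb]-square of the difference, hence at most [3 eta / 2], which is
     less than d. *)
  have h : ch (hact w p0) (hact u p0) < 1 + d.
    have := close (inord 0); have := close (inord 1); have := close (inord 2); have := close (inord 3).
    rewrite !mxE !inordK//=; move: (lb_emb (hact w p0)) (lb_emb (hact u p0)).
    rewrite /ch !lb_unfold; move: (emb (hact w p0)) (emb (hact u p0)).
    case=> [[[a b] c] f] [[[a' b'] c'] f'] /= E1 E2.
    rewrite !ltr_norml => /andP[h1 h1'] /andP[h2 h2'] /andP[h3 h3'] /andP[h4 h4'].
    have sq (p : R) : - eta < p -> p < eta -> p ^+ 2 <= eta.
      by move=> p1 p2; have := sqr_ge0 p; nra.
    have m1 := sq _ h4 h4'; have m2 := sq _ h3 h3'.
    have m3 : - ((c - c') * (f - f')) <= eta.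
      have /ler_normlP[+ _] : `|(c - c') * (f - f')| <= eta; last by [].
      rewrite normrM -[leRHS]mulr1 ler_pM//.
        by rewrite ler_norml; apply/andP; split; lra.
      by rewrite ler_norml; apply/andP; split; lra.
    lra.
  have : ch p0 (hact (rev w ++ u) p0) < 1 + d.
    by rewrite -(ch_hact w) hact_cat /= hact_Krev.
  move=> /sep/(congr1 (fun f => f p0)); rewrite hact_cat /= => E.
  by rewrite -[RHS](hact_Krev w) E.
pose g (c : {ffun 'I_4 -> 'I_N.+1}) : seq I :=
  if pselect (exists w, ch x (hact w p0) <= ch x p0 /\ code w = c) is left h then projT1 (cid h) else [::].
pose F c := ch x (hact (g c) p0).
case: (@arg_minP _ _ _ (code [::]) xpredT F) => // c _ cmin.
exists (g c) => w; have [wx|wx] := leP (ch x (hact w p0)) (ch x p0).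
  have := cmin (code w) isT; rewrite /F {2}/g; case: pselect => [h|[]]; last by exists w.
  by case: cid => u [ux uw] /=; rewrite (codeP u w).
apply: le_trans (ltW wx); have := cmin (code [::]) isT; rewrite /F {2}/g.
case: pselect => [h|_]; last by [].
by case: cid => u [ux uw] /=; rewrite (codeP u [::]).
Qed.

(** Let [w p0] be an orbit point nearest to x. Seen from the moved point, no reflection brings [p0]
    closer, so that point is on the side of [p0] for every wall. *)
Lemma cell_cover x : exists w, cell (hact w x).
Proof.
have [w wmin] := orbit_min x; exists (rev w) => i.
have := wmin (w ++ [:: i]); rewrite hact_cat /=.
rewrite -(ch_hact (rev w) x) -(ch_hact (rev w) x (hact w _)) !hact_revK.
rewrite /ch emb_hrefl// /refl lbBr lbZr; have := p0C i.
move: (lb (emb (hact (rev w) x)) (emb p0)) (lb (emb p0) (e i))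
  (lb (emb (hact (rev w) x)) (e i)) => a b c b0 h.
rewrite leNgt; apply/negP => c0; have : b * c < 0 by rewrite nmulr_rlt0.
lra.
Qed.

(* t is the side along which the chamber is doubled, w0 an interior point of it. *)
Variables (t : I) (w0 : H3 R).
Hypothesis w0t : lb (emb w0) (e t) = 0.
Hypothesis w0C : forall j, j != t -> lb (emb w0) (e j) < 0.

(** The union of Q and tau Q, written with the half-spaces of both except those bounded by the plane
    of t; in this form it is visibly convex. *)
Definition doubled : set (H3 R) := [set x | forall j, j != t ->
  lb (emb x) (e j) <= 0 /\ lb (emb x) (refl (e t) (e j)) <= 0].

Let tau := hact [:: t].

Let tauK x : tau (tau x) = x.
Proof. exact: (hact_revK [:: t]). Qed.

Let cone_w0 : cone e (emb w0).
Proof. by move=> j; have [->|/w0C/ltW//] := eqVneq j t; rewrite w0t. Qed.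

Let tau_w0 : tau w0 = w0.
Proof. by apply: emb_inj; rewrite emb_hact /= refl_id. Qed.

(** Each copy satisfies the inequalities of the other because [lb (e t) (e j) <= 0]: the angles
    along t are not obtuse. *)
Lemma doubledP x : doubled x <-> cell x \/ cell (hact [:: t] x).
Proof.
have E j : lb (emb (tau x)) (e j) = lb (emb x) (refl (e t) (e j)).
  by rewrite emb_hact /= lb_refl_adj.
have Et : lb (emb (tau x)) (e t) = - lb (emb x) (e t).
  by rewrite emb_hact /= lb_refl_normal.
have npos j : j != t -> lb (e t) (e j) <= 0.
  by move=> jt; apply: coxeter_pair_le0; apply: e_cox; rewrite eq_sym.
split=> [D|[C j jt|C j jt]].
- have [xt|xt] := leP (lb (emb x) (e t)) 0.
    by left=> j; have [->//|/D[]] := eqVneq j t.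
  right=> j; have [->|/D[]] := eqVneq j t; last by rewrite E.
  by rewrite Et oppr_le0 ltW.
- split; first exact: C.
  rewrite -lb_refl_adj lb_refll; have := C j; have := C t; have := npos j jt; nra.
- rewrite -E; split; last exact: C.
  rewrite -(tauK x) emb_hact /= lb_refll; have := C j; have := C t; have := npos j jt.
  by rewrite -/tau; nra.
Qed.

Lemma stab_w0 w : hact w w0 = w0 -> hact w = id \/ hact w = hact [:: t].
Proof.
move=> /(congr1 (@emb R)); rewrite emb_hact => h.
have [u wu ut] := stab_cone e1 e_cox cone_w0 h.
have -> : hact w = hact u by exact/hactE.
elim: u ut {wu} => [|s u IH] /=; first by left.
case/andP => st /IH [] ->; have -> : s = t.
- by apply/eqP; apply: contraLR st => /w0C /lt_eqF ->.
- by right.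
- by apply/eqP; apply: contraLR st => /w0C /lt_eqF ->.
- by left; apply/funext => x; exact: tauK.
Qed.

(* tau fixes w0, so the orbit of w0 under even words is its whole orbit. *)
Lemma doubled_dirichlet : doubled = dirichlet_domain egroup w0.
Proof.
apply/seteqP; split => [x /doubledP Dx _ [w we <-] _|x Dx].
  rewrite le_hdist; case: Dx => Cx.
    by rewrite /ch lerN2 emb_hact; case: (lb_act_cone e1 e_cox w Cx cone_w0).
  rewrite -(ch_hact [:: t] x w0) -(ch_hact [:: t] x (hact w w0)) -/tau tau_w0.
  rewrite /tau -[hact [:: t] (hact w w0)]/(hact (t :: w) w0).
  by rewrite /ch lerN2 [emb (hact (t :: w) w0)]emb_hact;
    case: (lb_act_cone e1 e_cox (t :: w) Cx cone_w0).
(* An odd word may be followed on the right by tau, which fixes [w0]. *)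
have {}Dx u : ch x w0 <= ch x (hact u w0).
  have even (v : seq I) : ~~ odd (size v) -> ch x w0 <= ch x (hact v w0).
    move=> ve; have [->//|vid] := pselect (hact v = id).
    by rewrite -le_hdist; apply: Dx => //; exists v.
  have [uo|] := boolP (odd (size u)); last exact: even.
  have -> : hact u w0 = hact (u ++ [:: t]) w0 by rewrite hact_cat /= -/tau -[in LHS]tau_w0.
  by apply: even; rewrite size_cat addn1 /= uo.
(* Moved into the chamber, x becomes q, and minimality forces equality in [lb_act_cone]. So w and
   some u fixing q agree on [w0], and they differ by an element of the stabilizer of [w0], which is
   the identity or tau. *)
have [w Cw] := cell_cover x; set q := hact w x in Cw.
have h1 := Dx (rev w); rewrite -(ch_hact w x (hact _ _)) hact_Krev -/q in h1.
have [h2 h3] := lb_act_cone e1 e_cox w Cw cone_w0.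
have [|u uq uw] := h3.
  apply/eqP; rewrite eq_le h2 /= -lerN2 -emb_hact -!/(ch _ _).
  by rewrite {1}/q ch_hact.
have uq' : hact u q = q by apply: emb_inj; rewrite emb_hact.
have /stab_w0 H : hact (rev u ++ w) w0 = w0.
  by apply: emb_inj; rewrite hact_cat /= emb_hact emb_hact uw act_revK.
apply/doubledP; move: H; rewrite hact_cat => -[] /(congr1 (fun f => hact u (f x))) /=.
- by rewrite hact_Krev -/q -{1}uq' => /(congr1 (hact (rev u))); rewrite !hact_revK => <-; left.
- rewrite hact_Krev -/q -{1}uq' => /(congr1 (hact (rev u))); rewrite !hact_revK => E.
  by right; rewrite /= -E.
Qed.

Lemma doubled_cover : \bigcup_(g in egroup) (g @` doubled) = setT.
Proof.
apply/seteqP; split => // x _; have [w Cw] := cell_cover x.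
have [wo|we] := boolP (odd (size w)).
- exists (hact (rev w ++ [:: t])).
    by apply/egroupP; rewrite size_cat size_rev addn1 /= wo.
  exists (tau (hact w x)); last by rewrite hact_cat /= -/tau -[hrefl _ _]/(tau _) tauK hact_revK.
  by apply/doubledP; right; rewrite -/tau tauK.
- exists (hact (rev w)); first by apply/egroupP; rewrite size_rev.
  by exists (hact w x); [apply/doubledP; left|rewrite hact_revK].
Qed.

(** A common interior point would be equidistant from [w0] and its image; moving it slightly across
    the bisector contradicts the Dirichlet inequality. The two centers differ because only odd
    nontrivial elements fix [w0]. *)
Lemma doubled_disjoint g : egroup g -> g <> id ->
  hinterior doubled `&` g @` hinterior doubled = set0.
Proof.
move=> [w we <-] wid; apply/seteqP; split => // x [xD [y yD yx]].
have DD z : hinterior doubled z -> doubled z.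
  by move=> /hinteriorP[d d0]; apply; rewrite chxx ltrDl.
have Dle z u : ~~ odd (size u) -> hact u <> id -> doubled z -> ch z w0 <= ch z (hact u w0).
  by rewrite doubled_dirichlet => ue uid Dz; rewrite -le_hdist; apply: Dz => //; exists u.
have h1 := Dle x w we wid (DD x xD).
have h2 : ch x (hact w w0) <= ch x w0.
  rewrite -yx ch_hact -(ch_hact (rev w) (hact w y)) hact_revK.
  apply: Dle; [by rewrite size_rev| |exact: DD].
  by move=> E; apply: wid; apply/funext => z; have := hact_Krev w z; rewrite E.
pose n := emb w0 - emb (hact w w0).
have xn : lb n (emb x) = 0.
  rewrite lbC lbBr; apply/eqP; rewrite subr_eq0 eq_le; apply/andP.
  by move: h1 h2; rewrite /ch; split; lra.
have n0 : lb n n != 0.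
  apply/eqP => /(lb_tangent_eq0 xn)/eqP; rewrite subr_eq0 => /eqP/emb_inj/esym/stab_w0[//|].
  by move=> /hact_parity; rewrite (negbTE we).
have nn : 0 < lb n n by rewrite lt_neqAle eq_sym n0 (lb_tangent_ge0 xn).
move/hinteriorP: xD => [d d0 xD]; have [r r0 hr] := perturb xn d0.
have [|z [k [k0 zE xz kd]]] := hr (- (r / 2)).
  by rewrite normrN gtr0_norm ?divr_gt0// ltr_pdivrMr// ltr_pMr// ltr1n.
have Dz : doubled z by apply: xD; rewrite xz.
have := Dle z w we wid Dz; rewrite leNgt => /negP; apply.
have : lb (emb z) n < 0.
  rewrite zE lbZl lbDl lbZl (lbC _ n) xn add0r.
  by rewrite pmulr_rlt0// nmulr_rlt0// oppr_lt0 divr_gt0.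
by rewrite /n lbBr /ch; lra.
Qed.

(* The second branch is a junk value. *)
Definition pln n : oplane R :=
  if pselect (lb n n = 1) is left n1 then projT1 (cid (nrm_surj n1))
  else projT1 (cid (nrm_surj (e1 t))).

Lemma nrm_pln n : lb n n = 1 -> nrm (pln n) = n.
Proof. by rewrite /pln; case: pselect => // n1 _; case: cid. Qed.

Lemma finite_polyhedron (J : finType) (P : pred J) (n : J -> lorentz R) (D : set (H3 R)) :
  (forall j, lb (n j) (n j) = 1) -> hinterior D !=set0 ->
  D = [set x | forall j, P j -> lb (emb x) (n j) <= 0] -> convex_polyhedron D.
Proof.
move=> n1 D0 DE; split=> //; exists [set pln (n j) | j in [set j | P j]].
  move=> x; exists 1 => //; apply: (@sub_finite_set _ _ [set pln (n j) | j in [set j | P j]]).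
    by move=> h [].
  exact/finite_image/finite_finset.
rewrite DE; apply/seteqP; split => [x Dx _ [j Pj <-]|x Dx j Pj].
  by apply/halfspaceP; rewrite nrm_pln//; exact: Dx.
by rewrite -(nrm_pln (n1 j)); apply/halfspaceP; apply: Dx; exists j.
Qed.

Lemma doubled_interior : hinterior doubled p0.
Proof.
have [|d d0 hd] := @stay_all R I e e1 p0 [set: I]; first by move=> k _; exact: p0C.
apply/hinteriorP; exists d => // y y0; apply/doubledP; left=> j.
by apply/ltW/hd.
Qed.

Lemma doubled_fundamental : fundamental_domain egroup doubled.
Proof.
split; [|exact: doubled_cover|exact: doubled_disjoint].
apply: (@finite_polyhedron (I * bool)%type (fun j => j.1 != t)
  (fun j => if j.2 then e j.1 else refl (e t) (e j.1))).
- by case=> j [] /=; rewrite ?lb_refl.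
- by exists p0; exact: doubled_interior.
- apply/seteqP; split => [x Dx [j []] /= jt|x Dx j jt].
  + exact: (Dx j jt).1.
  + exact: (Dx j jt).2.
  + by split; [exact: (Dx (j, true))|exact: (Dx (j, false))].
Qed.

End Action.
End Words.

(** * Discreteness of the even words in SL2 *)

Section Discrete.
Variable R : realType.
Implicit Types (x y z : H3 R) (n v : lorentz R).

Lemma normc_ge0 (z : R[i]) : 0 <= normc z.
Proof. by case: z => a b; exact: sqrtr_ge0. Qed.

Lemma Re_le_normc (z : R[i]) : `|complex.Re z| <= normc z.
Proof.
rewrite -(ger0_norm (normc_ge0 z)) -ler_sqr ?nnegrE// !real_normK ?num_real//.
by rewrite normc_sqr lerDl sqr_ge0.
Qed.

Lemma Im_le_normc (z : R[i]) : `|complex.Im z| <= normc z.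
Proof.
rewrite -(ger0_norm (normc_ge0 z)) -ler_sqr ?nnegrE// !real_normK ?num_real//.
by rewrite normc_sqr lerDr sqr_ge0.
Qed.

Lemma normc_conj (z : R[i]) : normc (conjc z) = normc z.
Proof. by case: z => a b /=; rewrite sqrrN. Qed.

Lemma normc_sub_sym (z w : R[i]) : normc (z - w) = normc (w - z).
Proof. by rewrite -opprB normcN. Qed.

Lemma normc_mul3 (X H Y : 'M[R[i]]_2) (a h b : R) :
  (forall i j, normc (X i j) <= a) -> (forall i j, normc (H i j) <= h) ->
  (forall i j, normc (Y i j) <= b) ->
  forall i j, normc ((X *m H *m adjm Y) i j) <= (a * h + a * h) * b + (a * h + a * h) * b.
Proof.
move=> Xa Hh Yb i j.
have le2 (u v u' v' : R[i]) (p q : R) : normc u <= p -> normc v <= q ->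
    normc u' <= p -> normc v' <= q -> normc (u * v + u' * v') <= p * q + p * q.
  move=> up vq up' vq'; apply: le_trans (le_normcD _ _) _.
  by rewrite !ComplexField.Normc.normcM lerD// ler_pM// normc_ge0.
have Y'b k : normc (adjm Y k j) <= b by rewrite !mxE normc_conj.
by rewrite mulmx2; apply: (le2) => //; rewrite mulmx2; exact: (le2).
Qed.

Lemma mx_bound (X : 'M[R[i]]_2) : exists a : R, 0 <= a /\ forall i j, normc (X i j) <= a.
Proof.
exists (normc (X ord0 ord0) + normc (X ord0 ord_max) + normc (X ord_max ord0) + normc (X ord_max ord_max)).
have := normc_ge0 (X ord0 ord0); have := normc_ge0 (X ord0 ord_max).
have := normc_ge0 (X ord_max ord0); have := normc_ge0 (X ord_max ord_max).
move=> h1 h2 h3 h4; split; first lra.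
by apply: ord2P; apply: ord2P; lra.
Qed.

Lemma lb_diff_le v w (r : R) : 0 <= r ->
  `|w.1.1.1 - v.1.1.1| <= r -> `|w.1.1.2 - v.1.1.2| <= r ->
  `|w.1.2 - v.1.2| <= r -> `|w.2 - v.2| <= r ->
  `|lb v (w - v)| <= (`|v.1.1.1| + `|v.1.1.2| + `|v.1.2| + `|v.2|) * r.
Proof.
case: v w => [[[a b] c] d] [[[a' b'] c'] d']; rewrite lb_unfold /= => r0 w1 w2 w3 w4.
have bd (p q : R) : `|q| <= r -> `|p * q| <= `|p| * r.
  by move=> qq; rewrite normrM ler_wpM2l.
have := bd a _ w1; have := bd b _ w2; have := bd d _ w3; have := bd c _ w4.
have p1 : 0 <= `|c| * r by rewrite mulr_ge0.
have p2 : 0 <= `|d| * r by rewrite mulr_ge0.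
rewrite !ler_norml => /andP[? ?] /andP[? ?] /andP[? ?] /andP[? ?].
by apply/andP; split; lra.
Qed.

(** The difference [B H B^* - A H A^*] splits as [(B - A) H B^* + A H (B - A)^*]. For [r <= 1] its
    entries are at most [4 h r (a + r) + 4 a h r <= r C]. *)
Lemma mobius_continuous (A : SL2 R) x (d : R) : 0 < d ->
  exists2 r : R, 0 < r & forall B : SL2 R,
    (forall i j, normc (val A i j - val B i j) < r) -> ch (mobius A x) (mobius B x) < 1 + d.
Proof.
move=> d0; have [a [a0 aP]] := mx_bound (val A).
have [h [h0 hP]] := mx_bound (herm (emb x)).
pose v := lor (val A) (emb x).
pose s := `|v.1.1.1| + `|v.1.1.2| + `|v.1.2| + `|v.2| + 1.
have s0 : 0 < s by rewrite ltr_wpDl// !addr_ge0.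
pose C := 4 * h * (2 * a + 1) + 1.
have C0 : 0 < C by rewrite ltr_wpDl// !mulr_ge0// addr_ge0// mulr_ge0.
pose r := Num.min 1 (d / (C * s)).
have r0 : 0 < r by rewrite lt_min ltr01 divr_gt0// mulr_gt0.
have r1 : r <= 1 by rewrite ge_min lexx.
have rd : r * C * s <= d by rewrite -mulrA -ler_pdivlMr ?mulr_gt0// ge_min lexx orbT.
exists r => // B AB.
have BA i j : normc ((val B - val A) i j) <= r.
  by rewrite !mxE normc_sub_sym; exact/ltW/AB.
have Bb i j : normc (val B i j) <= a + r.
  have -> : val B i j = val A i j + (val B - val A) i j by rewrite !mxE; ring.
  by apply: le_trans (le_normcD _ _) _; rewrite lerD.
pose w := lor (val B) (emb x).
pose E := (val B - val A) *m herm (emb x) *m adjm (val B) + val A *m herm (emb x) *m adjm (val B - val A).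
have HE : herm w - herm v = E.
  rewrite !herm_lor /E; have -> : adjm (val B - val A) = adjm (val B) - adjm (val A).
    by apply/matrixP => i j; rewrite !mxE rmorphB.
  by rewrite !mulmxBl mulmxBr addrA subrK.
have Er i j : normc (E i j) <= r * C.
  rewrite mxE; apply: le_trans (le_normcD _ _) _.
  have := normc_mul3 BA hP Bb i j; have := normc_mul3 aP hP BA i j.
  have : 0 <= h * r by rewrite mulr_ge0// ltW.
  rewrite /C; set p := normc _; set q := normc _ => hr hp hq.
  have : r * (h * r) <= 1 * (h * r) by rewrite ler_wpM2r.
  by nra.
have w1 : `|w.1.1.1 - v.1.1.1| <= r * C.
  apply: le_trans (Er ord0 ord_max); apply: le_trans (Re_le_normc _).
  by rewrite -HE !mxE.
have w2 : `|w.1.1.2 - v.1.1.2| <= r * C.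
  apply: le_trans (Er ord0 ord_max); apply: le_trans (Im_le_normc _).
  by rewrite -HE !mxE.
have w3 : `|w.1.2 - v.1.2| <= r * C.
  apply: le_trans (Er ord_max ord_max); apply: le_trans (Re_le_normc _).
  by rewrite -HE !mxE.
have w4 : `|w.2 - v.2| <= r * C.
  apply: le_trans (Er ord0 ord0); apply: le_trans (Re_le_normc _).
  by rewrite -HE !mxE.
have vv : lb v v = -1 by rewrite lb_lorS lb_emb.
have -> : ch (mobius A x) (mobius B x) = 1 - lb v (w - v).
  by rewrite lbBr vv /ch !emb_mobius -/v -/w; ring.
rewrite ltrD2l; apply: le_lt_trans (ler_norm _) _; rewrite normrN.
have rC0 : 0 < r * C by rewrite mulr_gt0.
apply: (@lt_le_trans _ _ (r * C * s)) => //.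
apply: le_lt_trans (lb_diff_le (ltW rC0) w1 w2 w3 w4) _.
by rewrite [ltLHS]mulrC (ltr_pM2l rC0) /s ltrDl.
Qed.

Section EvenGroup.
Variables (I : finType) (e : I -> lorentz R).
Hypothesis e1 : forall i, lb (e i) (e i) = 1.
Hypothesis e_cox : forall i j, i != j -> coxeter_pair (e i) (e j).
Variable p0 : H3 R.
Hypothesis p0C : forall i, lb (emb p0) (e i) < 0.

Lemma egroup_kleinian : kleinian (egroup e).
Proof.
split; first exact: egroup_group.
  by move=> _ [w we <-]; have [A ->] := hact_even_mobius e1 we; exists A.
move=> A [w we wA]; have [d d0 sep] := orbit_sep e1 e_cox p0C.
have [r r0 hr] := mobius_continuous A p0 d0.
(* A nonzero entry excludes [B = - A], which induces the same isometry but differs from A by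
   [2 |A i j|] there. *)
have [i [j Aij]] : exists i j, val A i j != 0.
  apply: contrapT => A0; have : val A = 0.
    apply/matrixP => i j; rewrite mxE; apply/eqP/negP => /negP Aij; apply: A0.
    by exists i, j.
  move=> E; have := valP A; rewrite /= E det0 eq_sym.
  by rewrite oner_eq0.
exists (Num.min r (normc (val A i j))); first by rewrite lt_min r0 normc_gt0.
move=> B [u ue uB] BA.
have : hact e w = hact e u.
  have : ch (mobius A p0) (mobius B p0) < 1 + d.
    by apply: hr => k l; apply: lt_le_trans (BA k l) _; rewrite ge_min lexx.
  rewrite -wA -uB -(ch_hact e1 (rev w)) hact_revK// -[hact e (rev w) _]/((hact e (rev w) \o hact e u) p0).
  rewrite -hact_cat => /sep h; apply/funext => z.
  have := congr1 (fun f => hact e w (f z)) h.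
  by rewrite hact_cat /= hact_Krev// => ->.
rewrite wA uB => /mobius_eq[->//|AB]; exfalso.
have := BA i j; rewrite AB mxE; have -> : - val B i j - val B i j = - (2 * val B i j) by ring.
rewrite !normcN ComplexField.Normc.normcM lt_min => /andP[_].
have -> : normc (2 : R[i]) = 2.
  by rewrite (normcMn 1 2) ComplexField.Normc.normc1.
by have := normc_ge0 (val B i j); lra.
Qed.

End EvenGroup.
End Discrete.

(** * Finite volume *)

Section Volume.
Variable R : realType.
Implicit Types (x y z : H3 R) (n v : lorentz R).

Let mu3 := ((@lebesgue_measure R \x @lebesgue_measure R) \x @lebesgue_measure R)%E.

(* The integrand is compared with measurable functions only, so that the
   measurability of the domain is not needed. *)
Lemma le_integral_restrict (A : set (R * R * R)) (f g : R * R * R -> R) :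
  (forall p, 0 <= g p) -> (forall p, A p -> 0 <= f p) ->
  (forall p, A p -> g p <= f p) -> (forall p, ~ A p -> g p = 0) ->
  (\int[mu3]_p (g p)%:E <= \int[mu3]_(p in A) (f p)%:E)%E.
Proof.
move=> g0 f0 gf gA; rewrite [leRHS]integral_mkcond.
have fA p : (0 <= ((fun p => (f p)%:E) \_ A) p)%E.
  by rewrite patchE; case: ifPn => // /set_mem/f0; rewrite lee_fin.
rewrite !ge0_integralTE//.
apply: ereal_sup_le => _ [h hg <-]; exists h => //= p.
apply: le_trans (hg p) _; rewrite patchE; case: ifPn => pA.
- by rewrite lee_fin; exact/gf/set_mem.
- by rewrite gA//; move/negP: pA; rewrite inE.
Qed.

Definition box (a b t s : R) : set (R * R * R) :=
  (`[a, a + s] `*` `[b, b + s]) `*` `[t, t + s].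

Lemma box_measurable a b t s : measurable (box a b t s).
Proof. by apply: measurableX; [apply: measurableX|]. Qed.

Lemma box_volume a b t s : 0 < s -> mu3 (box a b t s) = (s ^+ 3)%:E.
Proof.
move=> s0; have I (c : R) : lebesgue_measure (`[c, c + s]%classic : set R) = s%:E.
  by rewrite lebesgue_measure_itv /= lte_fin ltrDl s0 -EFinD addrC addKr.
rewrite /mu3 /box product_measure1E//; last exact: measurableX.
rewrite /= product_measure1E//= !I -!EFinM.
by rewrite !exprS expr0 mulr1 mulrA.
Qed.

Lemma lb_triangle x y z : (lb (emb y) (emb z) + ch x y * ch x z) ^+ 2 <=
  (ch x y ^+ 2 - 1) * (ch x z ^+ 2 - 1).
Proof.
have := lb_CS x (emb y) (emb z); rewrite !lb_emb !(lbC _ (emb x)) /ch mulrNN !sqrrN.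
by rewrite !(addrC (-1)).
Qed.

(* A box of Euclidean side d * ht x based at x has hyperbolic volume at least
   (d / (1 + d)) ^ 3, whatever the height of x. *)
Lemma hvolume_boxes (A : set (H3 R)) (d : R) (n : nat) (xs : 'I_n -> H3 R) : 0 < d ->
  (forall j (y : H3 R), box (complex.Re (hz (xs j))) (complex.Im (hz (xs j)))
     (ht (xs j)) (d * ht (xs j)) (complex.Re (hz y), complex.Im (hz y), ht y) -> A y) ->
  (forall j k p, box (complex.Re (hz (xs j))) (complex.Im (hz (xs j)))
     (ht (xs j)) (d * ht (xs j)) p -> box (complex.Re (hz (xs k))) (complex.Im (hz (xs k)))
     (ht (xs k)) (d * ht (xs k)) p -> j = k) ->
  ((n%:R * (d / (1 + d)) ^+ 3)%:E <= hvolume A)%E.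
Proof.
move=> d0 xA disj; have t0 j := ht_gt0 (xs j).
pose bx j := box (complex.Re (hz (xs j))) (complex.Im (hz (xs j))) (ht (xs j)) (d * ht (xs j)).
pose c j := (((1 + d) * ht (xs j)) ^+ 3)^-1.
have d1 : 0 < 1 + d by rewrite addr_gt0.
have c0 j : 0 <= c j by rewrite invr_ge0 exprn_ge0// mulr_ge0 ?(ltW d1)// ltW.
have hb j p : bx j p -> exists y, p = (complex.Re (hz y), complex.Im (hz y), ht y).
  case: p => [[a b] t] [_ /=]; rewrite in_itv /= => /andP[t1 _].
  by exists (MkH3 (Complex a b) (lt_le_trans (t0 j) t1)).
pose g p := \sum_(j < n) c j * \1_(bx j) p.
have g0 p : 0 <= g p by apply: sumr_ge0 => j _; rewrite mulr_ge0.
have gb j p : bx j p -> g p = c j.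
  move=> jp; rewrite /g (bigD1 j)//= indicE mem_set// mulr1 big1 ?addr0// => k kj.
  rewrite indicE memNset ?mulr0// => kp; move/eqP: kj; apply.
  exact: disj kp jp.
have gn p : (forall j, ~ bx j p) -> g p = 0.
  by move=> np; rewrite /g big1// => j _; rewrite indicE memNset ?mulr0//; exact: np.
rewrite /hvolume; apply: le_trans (@le_integral_restrict _ (fun p => (p.2 ^+ 3)^-1) g g0 _ _ _).
- rewrite /g; under eq_integral do rewrite -sumEFin.
  rewrite ge0_integral_sum//; last 2 first.
  + move=> j; apply/measurable_EFinP; apply: measurable_funM => //.
    apply: measurable_indic; exact: box_measurable.
  + by move=> j p _; rewrite lee_fin mulr_ge0.
  have E j : (\int[mu3]_p (c j * \1_(bx j) p)%:E = ((d / (1 + d)) ^+ 3)%:E)%E.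
    under eq_integral do rewrite EFinM.
    have mI : measurable_fun setT (fun p : R * R * R => (\1_(bx j) p : R)%:E).
      by apply/measurable_EFinP; apply: measurable_indic; exact: box_measurable.
    rewrite ge0_integralZl_EFin//.
    rewrite integral_indic//; last exact: box_measurable.
    transitivity ((c j)%:E * ((d * ht (xs j)) ^+ 3)%:E)%E.
      by rewrite setIT; congr (_ * _)%E; apply: box_volume; rewrite mulr_gt0.
    rewrite -EFinM; congr (_%:E).
    rewrite /c; field; rewrite gt_eqF//=; exact: ht_neq0.
  under eq_bigr do rewrite E.
  by rewrite sumEFin sumr_const card_ord mulr_natl.
- by move=> p [y _ <-] /=; rewrite invr_ge0 exprn_ge0// ltW// ht_gt0.
- move=> p pA; have [[j jp]|np] := pselect (exists j, bx j p); last first.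
    rewrite gn; last by move=> j jp; apply: np; exists j.
    by case: pA => y _ <- /=; rewrite invr_ge0 exprn_ge0// ltW// ht_gt0.
  rewrite (gb j)//; case: pA => y _ yp; move: jp; rewrite -yp => -[_ /=].
  rewrite in_itv /= => /andP[t1 t2]; have ty := ht_gt0 y.
  rewrite /c lef_pV2 ?posrE ?exprn_gt0// ?mulr_gt0//.
  have ty' : ht y <= (1 + d) * ht (xs j) by lra.
  by apply: lerXn2r => //; rewrite nnegrE; [exact: ltW|exact: le_trans (ltW ty) ty'].
- move=> p pA; apply: gn => j jp; apply: pA; have [y py] := hb j p jp.
  by exists y; rewrite -?py//; apply: (xA j); rewrite -py.
Qed.

Lemma box_ch x y (d : R) : 0 < d -> box (complex.Re (hz x)) (complex.Im (hz x))
     (ht x) (d * ht x) (complex.Re (hz y), complex.Im (hz y), ht y) -> ch x y <= 1 + 2 * d ^+ 2.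
Proof.
move=> d0 [[/=]]; rewrite !in_itv /= => /andP[a1 a2] /andP[b1 b2] /andP[t1 t2].
have tx := ht_gt0 x; have ty := ht_gt0 y.
rewrite chE lerD2l normc_sqr ReB ImB ler_pdivrMr ?mulr_gt0//.
have sq (p q : R) : p <= q -> q <= p + d * ht x -> (p - q) ^+ 2 <= (d * ht x) ^+ 2.
  by move=> pq qp; have := mulr_ge0 (ltW d0) (ltW tx); nra.
have h1 := sq _ _ a1 a2; have h2 := sq _ _ b1 b2; have h3 := sq _ _ t1 t2.
have h4 : ht x * ht x <= ht x * ht y by rewrite ler_pM2l.
have h5 : d ^+ 2 * (ht x * ht x) <= d ^+ 2 * (ht x * ht y) by rewrite ler_wpM2l ?sqr_ge0.
have h6 : 0 <= d ^+ 2 * (ht x * ht y) by rewrite !mulr_ge0 ?sqr_ge0 ?ltW.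
have E : (d * ht x) ^+ 2 = d ^+ 2 * (ht x * ht x) by ring.
have -> : 2 * d ^+ 2 * (2 * ht x * ht y) = 4 * (d ^+ 2 * (ht x * ht y)) by ring.
by lra.
Qed.

Lemma packing (I : finType) (e : I -> lorentz R) (A : set (H3 R)) (r : R) :
  (forall i, lb (e i) (e i) = 1) -> (forall x, (forall i, lb (emb x) (e i) <= 0) -> A x) ->
  (hvolume A < +oo)%E -> 0 < r ->
  exists N : nat, forall (n : nat) (xs : 'I_n -> H3 R),
    (forall j i, lb (emb (xs j)) (e i) <= - r) ->
    (forall j k, j != k -> 1 + r <= ch (xs j) (xs k)) -> (n <= N)%N.
Proof.
move=> e1 eA Afin r0.
(* Points within cosine [1 + s] of a center stay in the polyhedron since [s <= r ^+ 2 / 8], and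
   those of distinct centers stay apart since [s <= r / 8]. *)
pose s := Num.min 1 (Num.min (r / 8) (r ^+ 2 / 8)).
have s0 : 0 < s by rewrite !lt_min ltr01 !divr_gt0// exprn_gt0.
have s1 : s <= 1 by rewrite ge_min lexx.
have s2 : s <= r / 8 by rewrite /s minCA ge_min lexx.
have s3 : s <= r ^+ 2 / 8 by rewrite /s !ge_min lexx !orbT.
pose d := s / 2; have d0 : 0 < d by rewrite divr_gt0.
have ds : 2 * d ^+ 2 <= s by rewrite /d; nra.
pose k := (d / (1 + d)) ^+ 3.
have k0 : 0 < k by rewrite exprn_gt0// divr_gt0// addr_gt0.
exists (Num.truncn (fine (hvolume A) / k)) => n xs xe xx.
have near j y : box (complex.Re (hz (xs j))) (complex.Im (hz (xs j)))
     (ht (xs j)) (d * ht (xs j)) (complex.Re (hz y), complex.Im (hz y), ht y) ->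
    1 <= ch (xs j) y <= 1 + s.
  by move=> /(box_ch d0) h; rewrite ch_ge1 /=; lra.
have vol : ((n%:R * k)%:E <= hvolume A)%E.
  apply: hvolume_boxes => // [j y /near /andP[c1 c2]|j l p jp lp].
    apply: eA => i; apply/ltW/(lb_stay_lt0 (x := xs j)) => //.
      by apply: le_lt_trans (xe j i) _; rewrite oppr_lt0.
    have h : r ^+ 2 <= lb (emb (xs j)) (e i) ^+ 2 by have := xe j i; nra.
    have : ch (xs j) y ^+ 2 <= (1 + s) ^+ 2 by nra.
    by have := exprn_gt0 2 r0; nra.
  apply/eqP/negP => /negP/xx jl.
  case: p jp lp => [[a b] t] jp lp.
  have t0 : 0 < t.
    case: jp => _ /=; rewrite in_itv /= => /andP[+ _]; apply: lt_le_trans; exact: ht_gt0.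
  have := near j (MkH3 (Complex a b) t0) jp; have := near l (MkH3 (Complex a b) t0) lp.
  set y := MkH3 _ _; rewrite !(chC _ y) => /andP[p1 p2] /andP[q1 q2].
  have := lb_triangle y (xs j) (xs l); move: jl; rewrite /ch -/(ch y _) -/(ch y _).
  set c := lb (emb (xs j)) _; set p := ch y _ in p1 p2 *; set q := ch y _ in q1 q2 *.
  move=> cr h.
  have h1 : q * p <= (1 + s) ^+ 2 by nra.
  have h2 : (q ^+ 2 - 1) * (p ^+ 2 - 1) <= (3 * s) ^+ 2.
    have q3 : 0 <= q ^+ 2 - 1 <= 3 * s by apply/andP; split; nra.
    have p3 : 0 <= p ^+ 2 - 1 <= 3 * s by apply/andP; split; nra.
    case/andP: q3 => ? ?; case/andP: p3 => ? ?.
    by rewrite expr2 ler_pM.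
  have : (c + q * p) ^+ 2 <= (3 * s) ^+ 2 by exact: le_trans h2.
  have : c + q * p < - (3 * s).
    have : (1 + s) ^+ 2 <= 1 + 3 * s by nra.
    lra.
  by nra.
have nk : n%:R * k <= fine (hvolume A).
  rewrite -lee_fin fineK// fin_numElt Afin andbT.
  by apply: lt_le_trans vol; exact: ltNyr.
by rewrite -(@natrK R n) le_truncn// ler_pdivlMr.
Qed.

End Volume.

(** * The sides of Q and its reflection group *)

Section Family.
Variable R : realType.
Implicit Types (x y z : H3 R) (n v : lorentz R).

Lemma half_lt (r : R) : 0 < r -> `|r / 2| < r.
Proof. by move=> r0; rewrite gtr0_norm ?divr_gt0// ltr_pdivrMr// ltr_pMr// ltr1n. Qed.

Lemma nat_dist_ge1 (j k : nat) : j != k -> 1 <= `|j%:R - k%:R : R|.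
Proof.
have h a b : (a < b)%N -> 1 <= `|b%:R - a%:R : R|.
  by move=> ab; rewrite ler_normr lerBrDr nat1r ler_nat ab.
by case: ltngtP => // jk _; [rewrite distrC|]; exact: h.
Qed.

Lemma interior_strict (A : set (H3 R)) x n : lb n n = 1 ->
  (forall y, A y -> lb (emb y) n <= 0) -> hinterior A x -> lb (emb x) n < 0.
Proof.
move=> n1 An /hinteriorP[d d0 xA]; rewrite lt_neqAle An ?andbT; last first.
  by apply: xA; rewrite chxx ltrDl.
apply/eqP => xn; have nx : lb n (emb x) = 0 by rewrite lbC.
have [r r0 hr] := perturb nx d0.
have [y [k [k0 yE xy kd]]] := hr _ (half_lt r0).
have := An y; rewrite leNgt => /(_ _)/negP; apply; first by apply: xA; rewrite xy.
by rewrite yE lbZl lbDl lbZl xn n1 add0r mulr1 mulr_gt0// divr_gt0.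
Qed.

(** Redundant and repeated half-spaces are discarded by [ex_irredundant]. Joining [p0] to a point
    that violates i alone then produces an interior point of side i. *)
Lemma ex_family (Q : set (H3 R)) : finite_sided_polyhedron Q ->
  exists (I : finType) (e : I -> lorentz R) (p0 : H3 R),
  [/\ forall i, lb (e i) (e i) = 1,
      forall x, Q x <-> forall i, lb (emb x) (e i) <= 0,
      forall i, lb (emb p0) (e i) < 0 &
      forall i, exists w : H3 R, lb (emb w) (e i) = 0 /\
        forall j, j != i -> lb (emb w) (e j) < 0].
Proof.
move=> [[p0 p0Q] [F Ffin QF]].
have /finite_seqP[s sE] : finite_set [set nrm h | h in F] by exact: finite_image.
pose e0 (i : 'I_(size s)) := nth 0 s i.
have QE0 x : Q x <-> forall i, lb (emb x) (e0 i) <= 0.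
  rewrite QF; split=> [h i|h k Fk].
    have : [set` s] (e0 i) by apply: mem_nth.
    by rewrite -sE => -[k Fk <-]; apply/halfspaceP; exact: h.
  have : [set` s] (nrm k) by rewrite -sE; exists k.
  move=> /= ks; apply/halfspaceP.
  have ki : (index (nrm k) s < size s)%N by rewrite index_mem.
  by have := h (Ordinal ki); rewrite /e0 /= nth_index.
have e01 i : lb (e0 i) (e0 i) = 1.
  have : [set` s] (e0 i) by apply: mem_nth.
  by rewrite -sE => -[k _ <-]; exact: nrm1.
have [A _ [Agen Airr]] := @ex_irredundant R _ e0 set0 [set: 'I_(size s)].
pose I := {i : 'I_(size s) | i \in A}; pose e (i : I) := e0 (val i).
have e1 i : lb (e i) (e i) = 1 by exact: e01.
have QE x : Q x <-> forall i, lb (emb x) (e i) <= 0.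
  rewrite QE0; split=> [h i|h i]; first exact: h.
  by apply: Agen => // l lA; exact: (h (exist _ l lA)).
have p0e i : lb (emb p0) (e i) < 0.
  by apply: (interior_strict (e1 i) _ p0Q) => y /QE.
exists I, e, p0; split=> // i.
have ex0 n : set0 n -> lb (emb p0) n = 0 by [].
have exy : exists y, [/\ forall n, set0 n -> lb (emb y) n = 0,
    forall l, l \in [set: I]%SET -> l != i -> lb (emb y) (e l) <= 0 & 0 < lb (emb y) (e i)].
  have [y [_ yA yi]] := Airr (val i) (valP i).
  by exists y; split=> // l _ li; apply: yA; [exact: valP|].
have [|w [_ wi wj]] := @facet_point R I e set0 [set: I]%SET p0 i ex0 _ (finset.in_setT i) exy => //.
by exists w; split=> // j ji; apply: wj; rewrite ?inE.
Qed.

Section Sides.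
Variables (Q : set (H3 R)) (I : finType) (e : I -> lorentz R).
Hypothesis e1 : forall i, lb (e i) (e i) = 1.
Hypothesis QE : forall x, Q x <-> forall i, lb (emb x) (e i) <= 0.
Variable p0 : H3 R.
Hypothesis p0Q : forall i, lb (emb p0) (e i) < 0.
Hypothesis irr : forall i, exists w : H3 R, lb (emb w) (e i) = 0 /\
  forall j, j != i -> lb (emb w) (e j) < 0.

(** Some [e i] vanishes at the given point of the side, which would otherwise be interior to Q. The
    component of [e i] along the plane of h must be zero, or moving along it would leave Q inside
    the side; [p0] fixes the sign. *)
Lemma side_normal (h : oplane R) : is_side Q h -> exists i, nrm h = e i.
Proof.
move=> [Qh [x [xh [r r0 xr]]]].
have [d d0 hd] := hball_ch r0.
have xhn : lb (emb x) (nrm h) = 0 by apply/hplane_setP.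
have [[i xi]|nox] := pselect (exists i, lb (emb x) (e i) = 0); last first.
  have Qx : Q x by apply: xr; split=> //; apply: hd; rewrite chxx ltrDl.
  have [|d' d'0 hd'] := @stay_all R I e e1 x [set: I].
    move=> k _; rewrite lt_neqAle; apply/andP; split; last by move/QE: Qx.
    by apply/eqP => xk; apply: nox; exists k.
  have : hinterior Q x.
    by apply/hinteriorP; exists d' => // y xy; apply/QE => k; exact/ltW/hd'.
  move=> /interior_strict-/(_ _ (nrm1 h)); rewrite xhn ltxx => F.
  by exfalso; apply: notF; apply: F => y /Qh/halfspaceP.
exists i; pose c := lb (e i) (nrm h); pose u := e i - c *: nrm h.
have ux : lb u (emb x) = 0 by rewrite /u lbBl lbZl !(lbC _ (emb x)) xi xhn mulr0 subr0.
have uh : lb u (nrm h) = 0 by rewrite /u lbBl lbZl nrm1 mulr1 subrr.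
have ui : lb u (e i) = lb u u by rewrite /u [in RHS]lbBr lbZr -/u uh mulr0 subr0.
have u0 : u = 0.
  apply: (lb_tangent_eq0 ux); apply/eqP; rewrite eq_le (lb_tangent_ge0 ux) andbT leNgt.
  apply/negP => uu; have [s s0 hs] := perturb ux d0.
  have [y [k [k0 yE xy kd]]] := hs _ (half_lt s0).
  have /QE/(_ i) : Q y.
    apply: xr; split; last by apply: hd; rewrite xy.
    by apply/hplane_setP; rewrite yE lbZl lbDl lbZl xhn uh mulr0 addr0 mulr0.
  rewrite yE lbZl lbDl lbZl xi add0r ui leNgt => /negP; apply.
  by rewrite !mulr_gt0// divr_gt0.
have ei : e i = c *: nrm h by apply/eqP; rewrite -subr_eq0; apply/eqP.
have : c ^+ 2 = 1 by rewrite -(e1 i) ei lbZl lbZr nrm1 mulr1 expr2.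
move=> /eqP; rewrite sqrf_eq1 => /orP[]/eqP cE; first by rewrite ei cE scale1r.
have : lb (emb p0) (nrm h) <= 0.
  by apply/halfspaceP; apply: Qh; apply/QE => j; exact: ltW.
by have := p0Q i; rewrite ei cE scaleN1r lbNr oppr_lt0 => p1; rewrite leNgt p1.
Qed.

Lemma reflection_groupE : reflection_group Q = wgroup e.
Proof.
apply: wgroup_gen => // [i|_ [h hs <-]].
  have [h hi] := nrm_surj (e1 i); exists h; last by rewrite -hi hrefl_nrm.
  exact: (side_of e1 QE irr hi).
by have [i hi] := side_normal hs; exists i; rewrite -hi hrefl_nrm.
Qed.

Lemma second_center (t : I) w0 : lb (emb w0) (e t) = 0 ->
  (forall j, j != t -> lb (emb w0) (e j) < 0) -> exists w1, [/\ w0 <> w1,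
    lb (emb w1) (e t) = 0 & forall j, j != t -> lb (emb w1) (e j) < 0].
Proof.
move=> w0t w0C; have [v v0 [vw vt _]] := orth3 (emb w0) (e t) 0.
have [|d d0 hd] := @stay_all R I e e1 w0 (~: [set t]).
  by move=> k; rewrite !inE => ki; exact: w0C.
have [r r0 hr] := perturb vw d0.
have [y [c [c0 yE wy cd]]] := hr _ (half_lt r0).
exists y; split.
- move=> E; move: yE; rewrite -E => yE.
  have cE : c = 1 by rewrite -wy -E chxx.
  move: yE; rewrite cE scale1r => /eqP; rewrite -[X in X == _]addr0 => /eqP/addrI/eqP.
  by rewrite eq_sym scaler_eq0 (negbTE v0) orbF gt_eqF// divr_gt0.
- by rewrite yE lbZl lbDl lbZl w0t vt mulr0 addr0 mulr0.
- by move=> j jt; apply: (hd y); [rewrite wy|rewrite !inE].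
Qed.

(** Without sides Q would be the whole space, and points at height 1 spaced by 2 would violate
    [packing]. *)
Lemma nonempty_family : (hvolume Q < +oo)%E -> exists t : I, True.
Proof.
move=> Qfin; apply: contrapT => noI.
have [|N NP] := @packing R I e Q 1 e1 _ Qfin ltr01; first by move=> x /QE.
pose xs (j : 'I_N.+1) := MkH3 (Complex (2 * j%:R) 0) (ltr01 : 0 < 1 :> R).
have := NP N.+1 xs; rewrite ltnn => /(_ _ _)/negP; apply => //.
  by move=> j i; exfalso; apply: noI; exists i.
move=> j k jk; rewrite chE normc_sqr ReB ImB /= !subrr expr0n/= !addr0 !mulr1.
rewrite lerD2l ler_pdivlMr// mul1r -mulrBr exprMn.
have : 1 <= (j%:R - k%:R : R) ^+ 2.
  rewrite -[leRHS]real_normK ?num_real// -[leLHS](expr1n _ 2) lerXn2r ?nnegrE//.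
  exact: nat_dist_ge1.
lra.
Qed.

End Sides.
End Family.

(** * The cusp *)

Section Cusp.
Variable R : realType.
Implicit Types (x y z : H3 R) (n v : lorentz R).

Lemma lb_poleI n : lb (poleI R) n = - n.1.2 / 2.
Proof. by rewrite lb_unfold /=; field. Qed.

Lemma lb_emb_poleI x : lb (poleI R) (emb x) = - (ht x)^-1 / 2.
Proof. by rewrite lb_poleI embE. Qed.

Lemma lb_emb_coord x n : lb (emb x) n =
  (n.1.1.1 * complex.Re (hz x) + n.1.1.2 * complex.Im (hz x) - (n.2 + n.1.2 *
    (complex.Re (hz x) ^+ 2 + complex.Im (hz x) ^+ 2 + ht x ^+ 2)) / 2) / ht x.
Proof. by rewrite lb_unfold embE /=; field; exact: ht_neq0. Qed.

Lemma finite_max (I : finType) (f : I -> R) : exists2 T : R, 1 <= T & forall i, f i <= T.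
Proof.
exists (1 + \sum_i `|f i|); first by rewrite lerDl sumr_ge0.
move=> i; rewrite (bigD1 i)//= addrCA (le_trans (ler_norm _))// lerDl addr_ge0// sumr_ge0//.
Qed.

Lemma finite_pos_min (I : finType) (P : pred I) (f : I -> R) : (forall i, P i -> 0 < f i) ->
  exists2 r : R, 0 < r & forall i, P i -> r <= f i.
Proof.
move=> f0; have [T T1 TP] := finite_max (fun i => (f i)^-1).
have T0 : 0 < T by apply: lt_le_trans T1.
exists T^-1; first by rewrite invr_gt0.
by move=> i Pi; rewrite -[f i]invrK lef_pV2 ?posrE ?invr_gt0// f0.
Qed.

Section Ideal.
Variables (I : finType) (e : I -> lorentz R).
Hypothesis e1 : forall i, lb (e i) (e i) = 1.
Variable p0 : H3 R.
Hypothesis p0C : forall i, lb (emb p0) (e i) < 0.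
Hypothesis linf : forall i, lb (poleI R) (e i) <= 0.
Hypothesis pack : forall r : R, 0 < r -> exists N : nat, forall (n : nat) (xs : 'I_n -> H3 R),
    (forall j i, lb (emb (xs j)) (e i) <= - r) ->
    (forall j k, j != k -> 1 + r <= ch (xs j) (xs k)) -> (n <= N)%N.

(* Far points of the horospherical cross-section would leave room for
   arbitrarily many disjoint balls at a fixed height. *)
Lemma cusp_bounded : exists M : R, forall x,
  (forall i, lb (poleI R) (e i) = 0 -> lb (emb x) (e i) <= 0) -> normc (hz x - hz p0) ^+ 2 <= M.
Proof.
pose g i (z : R[i]) := (e i).1.1.1 * complex.Re z + (e i).1.1.2 * complex.Im z - (e i).2 / 2.
have vE i x : lb (poleI R) (e i) = 0 -> lb (emb x) (e i) = g i (hz x) / ht x.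
  rewrite lb_poleI lb_emb_coord => /eqP; rewrite mulf_eq0 oppr_eq0 invr_eq0 pnatr_eq0 orbF.
  by move=> /eqP ->; rewrite mul0r addr0.
have [r r0 rP] : exists2 r : R, 0 < r & forall i, lb (poleI R) (e i) == 0 -> r <= - g i (hz p0).
  apply: finite_pos_min => i /eqP iv; have := p0C i.
  by rewrite vE// pmulr_llt0 ?invr_gt0 ?ht_gt0// oppr_gt0.
(* A non-vertical side is a hemisphere of radius [1 / (e i).1.2]; height T is at least twice each of
   these radii. *)
have [T T1 TP] := finite_max (fun i => 2 / (e i).1.2).
have T0 : 0 < T by apply: lt_le_trans T1.
pose s := Num.min (1 / 2) (r / (2 * T)).
have s0 : 0 < s by rewrite lt_min !divr_gt0// mulr_gt0.
have s1 : s <= 1 / 2 by rewrite ge_min lexx.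
have s2 : s <= r / (2 * T) by rewrite ge_min lexx orbT.
have [N NP] := pack s0.
(* The parameters [j / m] stay at most 1/2, so the chosen points of the segment keep half of the
   margin that [p0] has from the vertical sides. *)
pose m : R := 2 * N.+1%:R.
have m0 : 0 < m by rewrite mulr_gt0// ltr0n.
exists (2 * T ^+ 2 * s * m ^+ 2) => x xC; rewrite leNgt; apply/negP => far.
pose lam (j : 'I_N.+1) : R := j%:R / m.
have lam0 j : 0 <= lam j by rewrite divr_ge0// ltW.
have lam1 j : lam j <= 1 / 2.
  rewrite ler_pdivrMr// /m mulrA divfK// mul1r ler_nat; exact/ltnW/ltn_ord.
pose a := complex.Re (hz p0); pose b := complex.Im (hz p0).
pose c := complex.Re (hz x); pose d := complex.Im (hz x).
pose xs j := MkH3 (Complex (a + lam j * (c - a)) (b + lam j * (d - b))) T0.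
have := NP N.+1 xs; rewrite ltnn => /(_ _ _)/negP; apply => //.
- move=> j i; have [iv|iv] := eqVneq (lb (poleI R) (e i)) 0.
    rewrite vE// /xs /g /=.
    have h1 := rP i; rewrite iv eqxx in h1; have {}h1 := h1 isT.
    have := xC i iv; rewrite vE// pmulr_lle0 ?invr_gt0 ?ht_gt0//.
    move: h1; rewrite /g -/a -/b -/c -/d => h1 h2.
    rewrite ler_pdivrMr//; have : s * T <= r / 2.
      by have := s2; rewrite invfM mulrA ler_pdivlMr.
    move: (lam0 j) (lam1 j) => l0 l1; move: (lam j) l0 l1 => l l0 l1 sT.
    pose A := (e i).1.1.1 * a + (e i).1.1.2 * b - (e i).2 / 2.
    pose B := (e i).1.1.1 * c + (e i).1.1.2 * d - (e i).2 / 2.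
    have -> : (e i).1.1.1 * (a + l * (c - a)) + (e i).1.1.2 * (b + l * (d - b)) - (e i).2 / 2
      = (1 - l) * A + l * B by rewrite /A /B; ring.
    have hA : A <= - r by rewrite /A; lra.
    have hB : l * B <= 0 by rewrite mulr_ge0_le0.
    have : (1 - l) * A <= (1 - l) * (- r) by rewrite ler_wpM2l//; lra.
    by nra.
  rewrite lb_emb_coord /=.
  have n3 : 0 < (e i).1.2.
    by move: iv (linf i); rewrite lb_poleI neq_lt => /orP[]; lra.
  have := TP i; rewrite ler_pdivrMr// => T2.
  have := e1 i; rewrite lb_unfold.
  move: (e i).1.1.1 (e i).1.1.2 (e i).1.2 (e i).2 n3 T2 => n1 n2 n3 n4 n30 T2 n11.
  rewrite ler_pdivrMr//; set p := _ + lam j * _; set q := _ + lam j * _.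
  have E : n3 * (n1 * p + n2 * q - (n4 + n3 * (p ^+ 2 + q ^+ 2 + T ^+ 2)) / 2) =
    - ((n1 - n3 * p) ^+ 2 + (n2 - n3 * q) ^+ 2) / 2 + (1 - (n3 * T) ^+ 2) / 2.
    have -> : 1 - (n3 * T) ^+ 2 = n1 * n1 + n2 * n2 - (n3 * n4 + n4 * n3) / 2 - (n3 * T) ^+ 2.
      by rewrite n11.
    by field.
  rewrite -(ler_pM2l n30) E.
  have := sqr_ge0 (n1 - n3 * p); have := sqr_ge0 (n2 - n3 * q).
  have : n3 * (- s * T) >= - (n3 * T) / 2 by nra.
  have : 1 - (n3 * T) ^+ 2 <= - (n3 * T) by nra.
  lra.
- move=> j k jk; rewrite chE normc_sqr ReB ImB /= subrr expr0n/= addr0 lerD2l ler_pdivlMr ?mulr_gt0//.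
  have E : (a + lam j * (c - a) - (a + lam k * (c - a))) ^+ 2 +
    (b + lam j * (d - b) - (b + lam k * (d - b))) ^+ 2 =
    (lam j - lam k) ^+ 2 * normc (hz x - hz p0) ^+ 2.
    by rewrite normc_sqr ReB ImB -/a -/b -/c -/d; ring.
  rewrite E.
  have l1 : 1 <= ((lam j - lam k) * m) ^+ 2.
    rewrite /lam -mulrBl divfK ?gt_eqF// -[leRHS]real_normK ?num_real//.
    by rewrite -[leLHS](expr1n _ 2) lerXn2r ?nnegrE// nat_dist_ge1.
  rewrite exprMn in l1; have l0 : 0 <= (lam j - lam k) ^+ 2 by exact: sqr_ge0.
  have := ler_wpM2l l0 (ltW far).
  move: (normc _ ^+ 2) ((lam j - lam k) ^+ 2) (m ^+ 2) l0 l1 => F L M L0 LM h.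
  have : 2 * T ^+ 2 * s * 1 <= 2 * T ^+ 2 * s * (L * M).
    by rewrite ler_wpM2l// !mulr_ge0 ?sqr_ge0// ltW.
  by lra.
Qed.

Hypothesis e_cox : forall i j, i != j -> coxeter_pair (e i) (e j).

Lemma cone_poleI : cone e (poleI R).
Proof. exact: linf. Qed.

Lemma lor_poleI_mc (A : SL2 R) (k : R) : lor (val A) (poleI R) = k *: poleI R -> mc A = 0.
Proof.
move=> /(congr1 (fun v : lorentz R => v.1.2)); rewrite lor_poleI.
rewrite -/(mc A) -normc_sqr; have -> : (k *: poleI R).1.2 = 0 by exact: mulr0.
move=> /eqP; rewrite sqrf_eq0 => /eqP.
exact: ComplexField.Normc.eq0_normc.
Qed.

Lemma act_hact_mobius w (A : SL2 R) : hact e w = mobius A ->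
  forall v, act e w v = lor (val A) v.
Proof.
move=> wA; apply: lor_span => [v v'|v v'|x|x]; [exact: lb_act|exact: lb_lorS| |].
- by exists (hact e (rev w) x); rewrite emb_hact// act_Krev.
- by rewrite -emb_hact// wA emb_mobius.
Qed.

(** Neither w nor its inverse can raise [p0], so both k and its inverse are at least 1: horospheres
    at the cusp are preserved. *)
Lemma act_poleI_scale w (k : R) : act e w (poleI R) = k *: poleI R -> act e w (poleI R) = poleI R.
Proof.
move=> wk; have lp : lb (emb p0) (poleI R) < 0.
  by rewrite lbC lb_emb_poleI mulNr oppr_lt0 divr_gt0// invr_gt0 ht_gt0.
have Cp : cone e (emb p0) by move=> i; exact: ltW.
have [h1 _] := lb_act_cone e1 e_cox w Cp cone_poleI.
have [h2 _] := lb_act_cone e1 e_cox (rev w) Cp cone_poleI.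
have k1 : 1 <= k by move: h1; rewrite wk lbZr; nra.
have k0 : k != 0 by rewrite gt_eqF// (lt_le_trans ltr01).
have E : act e (rev w) (poleI R) = k^-1 *: poleI R.
  have El : poleI R = act e (rev w) (k *: poleI R) by rewrite -wk act_revK.
  have actZ u (a : R) v : act e u (a *: v) = a *: act e u v.
    by elim: u => //= i u ->; rewrite /refl lbZl mulrCA scalerBr scalerA.
  by rewrite [in RHS]El actZ scalerA mulVf// scale1r.
have k2 : 1 <= k^-1 by move: h2; rewrite E lbZr; nra.
have kE : k = 1.
  apply/eqP; rewrite eq_le k1 andbT -[leLHS]invrK invf_le1// (lt_le_trans ltr01)//.
by rewrite wk kE scale1r.
Qed.

(* The sides through the ideal point. *)
Definition Iv := {i : I | lb (poleI R) (e i) == 0}.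
Definition ev (i : Iv) := e (val i).

Lemma hact_ev (w : seq Iv) : hact ev w = hact e (map val w).
Proof. by elim: w => //= i w ->. Qed.

Lemma poleI_ev (w : seq Iv) : act e (map val w) (poleI R) = poleI R.
Proof.
by elim: w => //= i w ->; apply: refl_id; exact/eqP/(valP i).
Qed.

Lemma ev1 i : lb (ev i) (ev i) = 1.
Proof. exact: e1. Qed.

Lemma egroup_ev_sub : egroup ev `<=` egroup e.
Proof.
by move=> _ [w we <-]; exists (map val w); rewrite ?hact_ev//= size_map.
Qed.

(** Fixing infinity means scaling [poleI], hence fixing it, and the stabilizer of a vector of the
    closed chamber is generated by the walls through it. *)
Lemma stab_infty_ev : stab_infty (egroup e) = egroup ev.
Proof.
apply/seteqP; split => [_ [A [[w we wA] Ainf] <-]|f fv].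
  have c0 : mc A = 0.
    by move: Ainf; rewrite /mobius_bd; case: eqVneq.
  have wl := act_hact_mobius wA.
  have wp : act e w (poleI R) = poleI R.
    by apply: (@act_poleI_scale w (normc (ma A) ^+ 2)); rewrite wl lor_poleI_eq.
  have [u wu uv] := stab_cone e1 e_cox cone_poleI wp.
  have hwu : hact e w = hact e u by exact/(hactE e1).
  have [u' uE] : exists u', u = map val (u' : seq Iv).
    elim: u uv {wu hwu} => [|i u IH] /=; first by exists [::].
    by case/andP => iv /IH[u' ->]; exists (exist _ i iv :: u').
  exists u'; last by rewrite hact_ev -uE -hwu.
  by rewrite /= -(size_map val) -uE -(hact_parity e1 hwu).
have := egroup_ev_sub fv; case: fv => w we <- ww.
have [A wA] := hact_even_mobius ev1 we.
exists A => //; split; first by rewrite /SL2_lift /= -wA.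
have c0 : mc A = 0.
  apply: (@lor_poleI_mc A 1); rewrite scale1r -(@act_hact_mobius (map val w)).
    exact: poleI_ev.
  by rewrite -hact_ev.
by rewrite /mobius_bd c0 eqxx.
Qed.

End Ideal.
End Cusp.

(** * Translations in a group of rigid motions of C whose orbits all meet a fixed disc *)

Section Lattice.
Variable R : realType.
Implicit Types (x y : H3 R) (a b c d u v z : R[i]).

Definition aff a b x : H3 R := MkH3 (a * hz x + b) (ht_gt0 x).

Lemma aff_comp a b c d : aff a b \o aff c d = aff (a * c) (a * d + b).
Proof. by apply/funext => x; apply: H3_eq => //=; ring. Qed.

Lemma aff_inj a b c d : aff a b = aff c d -> a = c /\ b = d.
Proof.
move=> E; have h z : a * z + b = c * z + d.
  by have := congr1 (fun f : H3 R -> H3 R => hz (f (MkH3 z ltr01))) E.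
have bd : b = d by have := h 0; rewrite !mulr0 !add0r.
by split=> //; have := h 1; rewrite !mulr1 bd => /addIr.
Qed.

Variable V : set (H3 R -> H3 R).
Hypothesis VG : is_group V.
Hypothesis V_aff : forall f, V f -> exists a b, normc a = 1 /\ f = aff a b.
Hypothesis V_bounded : exists B : R, forall x, exists2 f, V f & normc (hz (f x)) <= B.

Let VM f g : V f -> V g -> V (f \o g).
Proof. by case: VG => _ h _; exact: h. Qed.

Let VV a b : a != 0 -> V (aff a b) -> V (aff a^-1 (- (a^-1 * b))).
Proof.
move=> a0; case: VG => _ _ h /h[g [Vg _ gf]].
suff <- : g = aff a^-1 (- (a^-1 * b)) by [].
apply/funext => x; rewrite -[RHS]/(id (aff a^-1 (- (a^-1 * b)) x)) -gf /=.
by congr g; apply: H3_eq => //=; rewrite mulrBr !mulVKf// subrK.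
Qed.

Let norm_neq0 a : normc a = 1 -> a != 0.
Proof. by move=> a1; apply: contraTneq (ltr01 : 0 < 1 :> R) => a0; rewrite -a1 a0 ComplexField.Normc.normc0 ltxx. Qed.

Let T v := V (aff 1 v).

Let TD u v : T u -> T v -> T (u + v).
Proof. by move=> Tu /(VM Tu); rewrite aff_comp mulr1 mul1r addrC. Qed.

Let TN u : T u -> T (- u).
Proof. by move=> /(VV (oner_neq0 _)); rewrite invr1 mul1r. Qed.

Let T0 : T 0.
Proof.
case: VG => h _ _; rewrite /T (_ : aff 1 0 = id)//.
by apply/funext => x; apply: H3_eq => //=; rewrite mul1r addr0.
Qed.

Let TZ u (m : int) : T u -> T (u *~ m).
Proof.
have TMn (n : nat) : T u -> T (u *+ n).
  by move=> Tu; elim: n => [|n IH]; rewrite ?mulr0n// mulrS; exact: TD.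
by move=> Tu; case: m => n; [exact: TMn|apply: TN; exact: TMn].
Qed.

Let T_conj a b v : a != 0 -> V (aff a b) -> T v -> T (a * v).
Proof.
move=> a0 Vf Tv; have := VM Vf (VM Tv (VV a0 Vf)).
rewrite !aff_comp !mul1r mulfV// /T; congr (V (aff _ _)).
by rewrite mulrDr mulrN mulVKf//; ring.
Qed.

Let T_comm a b c d : a != 0 -> c != 0 -> V (aff a b) -> V (aff c d) ->
  T ((a - 1) * d - (c - 1) * b).
Proof.
move=> a0 c0 Vf Vh; have ca0 : c * a != 0 by rewrite mulf_neq0.
have Vhf : V (aff (c * a) (c * b + d)) by rewrite -aff_comp; exact: VM.
have := VM (VM Vf Vh) (VV ca0 Vhf); rewrite !aff_comp (mulrC a c) mulfV//.
by rewrite /T mulrN mulVKf//; congr (V (aff _ _)); ring.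
Qed.

Let cross u v : R := complex.Im (conjc u * v).

Let crossD u v w : cross u (v + w) = cross u v + cross u w.
Proof. by rewrite /cross mulrDr ImD. Qed.

Let crossN u v : cross u (- v) = - cross u v.
Proof. by rewrite /cross mulrN ImN. Qed.

Let crossMz u v (m : int) : cross u (v *~ m) = cross u v *~ m.
Proof.
have hn (n : nat) : cross u (v *+ n) = cross u v *+ n.
  by elim: n => [|n IH]; rewrite ?mulr0n ?mulrS ?crossD ?IH// /cross mulr0.
by case: m => n; rewrite ?NegzE ?mulrNz ?crossN -!pmulrn hn.
Qed.

Let cross_le u v : `|cross u v| <= normc u * normc v.
Proof. by rewrite -(normc_conj u) -ComplexField.Normc.normcM; exact: Im_le_normc. Qed.

(* Otherwise rotating a translation gives an independent one, so there are no
   translations; then all commutators are trivial and V fixes the center of a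
   rotation. *)
Let rotation_trivial u a b : u != 0 -> (forall v, T v -> cross u v = 0) ->
  V (aff a b) -> normc a = 1 -> complex.Im a = 0.
Proof.
move=> u0 Tu Vf a1; apply/eqP/negP => /negP ia.
have a0 := norm_neq0 a1.
have an1 : a - 1 != 0.
  by apply: contra ia; rewrite subr_eq0 => /eqP ->.
have Tv0 v : T v -> v = 0.
  move=> Tv; have h1 := Tu _ Tv; have h2 := Tu _ (T_conj a0 Vf Tv).
  have h3 : complex.Re (conjc u * v) * complex.Im a = 0.
    by move: h2; rewrite /cross mulrCA ImM -/(cross u v) h1 mulr0 add0r mulrC.
  move: h3 => /eqP; rewrite mulf_eq0 (negbTE ia) orbF => /eqP h3.
  have : conjc u * v = 0 by apply: complex_eq; [exact: h3|exact: h1].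
  by move/eqP; rewrite mulf_eq0 conjc_eq0 (negbTE u0) => /eqP.
have [B VB] := V_bounded.
(* The fixed point of [a z + b]. Trivial commutators make all of V fix p, so the orbit of [p + s]
   stays on a circle that misses the disc of radius B. *)
pose p := - (b / (a - 1)); pose s : R := `|B| + normc p + 1.
have [h Vh hB] := VB (MkH3 (p + Complex s 0) ltr01).
have [c [d [c1 hE]]] := V_aff Vh; have c0 := norm_neq0 c1.
rewrite hE /= in hB Vh.
have /eqP := Tv0 _ (T_comm a0 c0 Vf Vh); rewrite subr_eq0 => /eqP E.
have dE : d = (c - 1) * b / (a - 1) by rewrite -E mulrAC divff// mul1r.
have {}hB : normc (c * Complex s 0 + p) <= B.
  by rewrite (_ : _ + p = c * (p + Complex s 0) + d)// dE /p; ring.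
have s0 : 0 <= s by rewrite /s !addr_ge0// normc_ge0.
have : normc (c * Complex s 0) <= B + normc p.
  have -> : c * Complex s 0 = (c * Complex s 0 + p) + - p by rewrite addrK.
  by apply: le_trans (le_normcD _ _) _; rewrite normcN lerD2r.
rewrite ComplexField.Normc.normcM c1 mul1r /= expr0n /= addr0 sqrtr_sqr ger0_norm// /s.
by have := ler_norm B; lra.
Qed.

(* If all translations are multiples of u, every orbit takes at most two values
   under cross u. *)
Lemma independent_translations : exists u v,
  [/\ V (aff 1 u), V (aff 1 v) & complex.Im (conjc u * v) != 0].
Proof.
apply: contrapT => none.
have [u u0 Tu] : exists2 u, u != 0 & forall v, T v -> cross u v = 0.
  have [[u [u0 Tu]]|noT] := pselect (exists u, u != 0 /\ T u).
    exists u => // v Tv; apply/eqP/negP => /negP uv; apply: none.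
    by exists u, v.
  exists 1; rewrite ?oner_neq0// => v Tv; have [->|v0] := eqVneq v 0.
    by rewrite /cross mulr0.
  by exfalso; apply: noT; exists v.
(* Linear parts are now 1 or -1. Half-turns differ by translations, which [cross u] ignores, so one
   constant k serves for all of them. *)
have [k kP] : exists k : R, forall a b, V (aff a b) -> normc a = 1 ->
    forall z, cross u (a * z + b) = cross u z \/ cross u (a * z + b) = k - cross u z.
  have sgn a b : V (aff a b) -> normc a = 1 -> a = 1 \/ a = -1.
    move=> Vf a1; have ia := rotation_trivial u0 Tu Vf a1.
    have := normc_sqr a; rewrite a1 ia expr1n expr0n addr0 => /esym/eqP.
    rewrite sqrf_eq1 => /orP[] /eqP ra; [left|right]; apply: complex_eq; rewrite ?ReN ?ImN ?ra ?ia//.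
    by rewrite /= oppr0.
  have [[b0 Vb0]|no] := pselect (exists b0, V (aff (-1) b0)).
    exists (cross u b0) => a b Vf a1 z; have [aE|aE] := sgn _ _ Vf a1; rewrite aE in Vf *.
      by left; rewrite mul1r crossD (Tu b)// addr0.
    right; have := Tu (b - b0) _; rewrite crossD crossN => /(_ _)/eqP; rewrite subr_eq0 => h.
    rewrite mulN1r crossD crossN addrC; congr (_ - _); apply/eqP/h.
    by have := VM Vf Vb0; rewrite aff_comp mulrNN mul1r mulN1r addrC.
  exists 0 => a b Vf a1 z; have [aE|aE] := sgn _ _ Vf a1; rewrite aE in Vf *.
    by left; rewrite mul1r crossD (Tu b)// addr0.
  by exfalso; apply: no; exists b.
have [B VB] := V_bounded.
pose C : R := normc u * `|B| + `|k|.
have Cz z : `|cross u z| <= C.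
  have [f Vf] := VB (MkH3 z ltr01).
  have [a [b [a1 fE]]] := V_aff Vf; rewrite fE in Vf * => /= fB.
  have h : `|cross u (a * z + b)| <= normc u * `|B|.
    apply: le_trans (cross_le _ _) _; rewrite ler_wpM2l ?normc_ge0//.
    exact: le_trans fB (ler_norm _).
  have := kP _ _ Vf a1 z; rewrite /C => -[E|E].
    by rewrite -E (le_trans h)// lerDl.
  have -> : cross u z = - (cross u (a * z + b)) + k by rewrite E; ring.
  by apply: le_trans (ler_normD _ _) _; rewrite normrN lerD2r.
pose q : R := normc u ^+ 2; have q0 : 0 < q by exact: normc_sqr_gt0.
have C0 : 0 <= C by rewrite /C addr_ge0// mulr_ge0// normc_ge0.
(* This point is [i u (C + 1) / |u|^2], where [cross u] takes the value [C + 1]. *)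
have := Cz (Complex (- complex.Im u) (complex.Re u) * Complex ((C + 1) / q) 0).
have -> : cross u (Complex (- complex.Im u) (complex.Re u) * Complex ((C + 1) / q) 0) = C + 1.
  rewrite /cross !ReImE /=; have := divfK (lt0r_neq0 q0) (C + 1).
  by move: (_ / q) => r; rewrite /q normc_sqr => <-; ring.
by move/(le_trans (ler_norm _)); rewrite leNgt ltrDl ltr01.
Qed.

Lemma lattice_Z2 : contains_Z2 V.
Proof.
have [u [v [Vu Vv uv]]] := independent_translations.
exists (fun m => aff 1 (u *~ m.1 + v *~ m.2)); split.
- have h (k l : int) : u *~ k + v *~ l = 0 -> k = 0 /\ l = 0.
    move=> kl; have uu : cross u u = 0 by rewrite /cross !ReImE; ring.
    have vv : cross v v = 0 by rewrite /cross !ReImE; ring.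
    have vu : cross v u != 0.
      by apply: contra uv => /eqP vu; apply/eqP; rewrite -[RHS]oppr0 -vu /cross !ReImE; ring.
    have := congr1 (cross u) kl; have := congr1 (cross v) kl.
    rewrite !crossD !crossMz uu vv !mul0rz addr0 add0r {2 4}/cross !mulr0.
    move=> /eqP + /eqP; rewrite !mulrz_eq0 (negbTE vu) (negbTE uv) !orbF.
    by move=> /eqP -> /eqP ->.
  case=> [m n] [m' n'] /aff_inj[_ /=] /eqP; rewrite -subr_eq0 => /eqP E.
  have [|/eqP + /eqP] := h (m - m') (n - n'); first by rewrite !mulrzBr -E; ring.
  by rewrite !subr_eq0 => /eqP -> /eqP ->.
- by move=> a b; rewrite aff_comp !mul1r; congr aff; rewrite /= !mulrzDr; ring.
- by move=> a; apply: TD; exact: TZ.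
Qed.

End Lattice.

(** * Isometric spheres, the chimney and the Ford domain *)

Section Ford.
Variable R : realType.
Implicit Types (x y : H3 R) (n v : lorentz R) (A : SL2 R).

Lemma lb_vertical n x : lb (poleI R) n = 0 ->
  lb (emb x) n = (cdot (Complex n.1.1.1 n.1.1.2) (hz x) - n.2 / 2) / ht x.
Proof.
rewrite lb_poleI lb_emb_coord /cdot => /eqP; rewrite mulf_eq0 oppr_eq0 invr_eq0 pnatr_eq0 orbF.
by move=> /eqP ->; rewrite mul0r addr0.
Qed.

Lemma vertical_le n x : lb (poleI R) n = 0 ->
  (lb (emb x) n <= 0) = (cdot (Complex n.1.1.1 n.1.1.2) (hz x) <= n.2 / 2).
Proof. by move=> /lb_vertical ->; rewrite pmulr_lle0 ?invr_gt0 ?ht_gt0// subr_le0. Qed.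

Lemma vertical_neq0 n : lb (poleI R) n = 0 -> lb n n = 1 -> Complex n.1.1.1 n.1.1.2 != 0.
Proof.
rewrite lb_poleI lb_unfold => n3 n1; apply/eqP => -[a0 b0]; move: n3 n1; rewrite a0 b0; nra.
Qed.

Lemma ht_le x y : (ht x <= ht y) = (lb (poleI R) (emb x) <= lb (poleI R) (emb y)).
Proof.
by rewrite !lb_emb_poleI ler_pM2r ?invr_gt0// lerN2 lef_pV2 ?posrE ?ht_gt0.
Qed.

(** [mobius A] divides the height by [mobius_denom A x], which is at least 1 exactly on or outside
    the isometric sphere. *)
Lemma outside_denom A x : mc A != 0 ->
  ((1 / normc (mc A)) ^+ 2 <= normc (hz x - (- md A / mc A)) ^+ 2 + ht x ^+ 2) =
  (ht (mobius A x) <= ht x).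
Proof.
move=> c0; have n0 : 0 < normc (mc A) ^+ 2 by exact: normc_sqr_gt0.
rewrite /= ler_pdivrMr ?mobius_denom_gt0// ler_pMr ?ht_gt0// /mobius_denom.
rewrite expr_div_n expr1n ler_pdivrMr//; congr (_ <= _).
rewrite mulrDl -exprMn -ComplexField.Normc.normcM [ht x ^+ 2 * _]mulrC; congr (normc _ ^+ 2 + _).
by field.
Qed.

Lemma md_neq0 A : mc A = 0 -> md A != 0.
Proof.
move=> c0; apply/eqP => d0; have := eqP (valP A); rewrite det2 -/(mc A) -/(md A) c0 d0 !mulr0 subr0.
by move/eqP; rewrite eq_sym oner_eq0.
Qed.

Lemma mobius_bd_hz A x : mc A = 0 -> mobius_bd A (Some (hz x)) = Some (hz (mobius A x)).
Proof.
move=> c0; have d0 := md_neq0 c0; rewrite /mobius_bd /= /mobius_denom c0 !mul0r !add0r (negbTE d0).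
rewrite rmorph0 mulr0 mul0r addr0 ComplexField.Normc.normc0 expr0n/= mul0r addr0 -mulrA.
congr (Some (_ * _)); apply: (mulfI d0); rewrite mulfV// mulrA.
have n0 : normc (md A) ^+ 2 != 0 by rewrite gt_eqF// normc_sqr_gt0.
apply: complex_eq; rewrite !ReImE /=; last by ring.
by rewrite normc_sqr in n0 *; rewrite -[LHS](mulfV n0); ring.
Qed.

Lemma hinterior_chimney (P : set R[i]) x : hinterior (chimney P) x <-> cinterior P (hz x).
Proof.
have t0 := ht_gt0 x; split=> [/hinteriorP[d d0 xP]|[r r0 xP]]; last first.
  (* The bound 1/2 forces [ht y < 3 ht x]; the other then bounds the horizontal displacement by
     r. *)
  apply/hinteriorP; pose d := Num.min (1 / 2) (r ^+ 2 / (6 * ht x ^+ 2)).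
  have d0 : 0 < d by rewrite lt_min !divr_gt0// ?mulr_gt0 ?exprn_gt0.
  exists d => // y; rewrite chE ltrD2l ltr_pdivrMr ?mulr_gt0 ?ht_gt0// => xy.
  have d1 : d <= 1 / 2 by rewrite ge_min lexx.
  have : d <= r ^+ 2 / (6 * ht x ^+ 2) by rewrite ge_min lexx orbT.
  rewrite ler_pdivlMr ?mulr_gt0 ?exprn_gt0// => d2.
  apply: xP; rewrite -ltr_sqr ?nnegrE ?normc_ge0 ?(ltW r0)//.
  move: (ht_gt0 y) (sqr_ge0 (normc (hz x - hz y))) xy d2 t0.
  move: (normc _ ^+ 2) (ht x) (ht y) => N s s' s'0 N0 h d2 s0.
  have tt : s' < 3 * s.
    rewrite ltNge; apply/negP => s3.
    have ss : 0 < s * s' by rewrite mulr_gt0.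
    have : 0 <= s' * (s' - 3 * s) by rewrite mulr_ge0 ?subr_ge0// ltW.
    nra.
  have : d * (2 * s * s') <= d * (6 * s ^+ 2) by rewrite ler_pM2l//; nra.
  by have := sqr_ge0 (s - s'); lra.
pose r := Num.min 1 (2 * ht x ^+ 2 * d).
have r0 : 0 < r by rewrite lt_min ltr01 !mulr_gt0// exprn_gt0.
exists r => // z xz; have := xP (MkH3 z t0); apply.
rewrite chE /= subrr expr0n/= addr0 ltrD2l ltr_pdivrMr ?mulr_gt0//.
have r1 : r <= 1 by rewrite ge_min lexx.
have : r <= 2 * ht x ^+ 2 * d by rewrite ge_min lexx orbT.
by have := normc_ge0 (hz x - z); nra.
Qed.

Section Cusp.
Variables (I : finType) (e : I -> lorentz R).
Hypothesis e1 : forall i, lb (e i) (e i) = 1.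
Hypothesis e_cox : forall i j, i != j -> coxeter_pair (e i) (e j).
Variable p0 : H3 R.
Hypothesis p0C : forall i, lb (emb p0) (e i) < 0.
Hypothesis linf : forall i, lb (poleI R) (e i) <= 0.
Hypothesis pack : forall r : R, 0 < r -> exists N : nat, forall (n : nat) (xs : 'I_n -> H3 R),
    (forall j i, lb (emb (xs j)) (e i) <= - r) ->
    (forall j k, j != k -> 1 + r <= ch (xs j) (xs k)) -> (n <= N)%N.

Notation Iv := (Iv e).
Notation ev := (ev (e := e)).

Lemma ex_vertical : exists t : Iv, True.
Proof.
apply: contrapT => noV; have [M MP] := cusp_bounded e1 p0C linf pack.
have := MP (MkH3 (hz p0 + Complex (`|M| + 1) 0) (ltr01 : 0 < 1 :> R)) _.
rewrite leNgt => /(_ _)/negP; apply.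
  by move=> i /eqP iv; exfalso; apply: noV; exists (exist _ i iv).
rewrite /= addrC addKr normc_sqr /= expr0n addr0.
by have := ler_norm M; have := normr_ge0 M; nra.
Qed.

Lemma ev_cox (i j : Iv) : i != j -> coxeter_pair (ev i) (ev j).
Proof. exact: e_cox. Qed.

Lemma ht_hact_ev (w : seq Iv) x : ht (hact ev w x) = ht x.
Proof.
have : lb (poleI R) (emb (hact ev w x)) = lb (poleI R) (emb x).
  by rewrite hact_ev emb_hact// -{1}(poleI_ev w) lb_act.
by move=> E; apply: le_anti; rewrite !ht_le E lexx.
Qed.

Lemma egroup_ev_mc A : egroup ev (mobius A) -> mc A = 0.
Proof.
rewrite -(stab_infty_ev e1 p0C linf e_cox) => -[B [_ Binf] BA].
have c0 : mc B = 0 by move: Binf; rewrite /mobius_bd; case: eqVneq.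
case: (mobius_eq BA) => [<-//|E]; have -> : mc A = - mc B.
  by rewrite /mc E mxE opprK.
by rewrite c0 oppr0.
Qed.

Lemma egroup_ev_aff f : egroup ev f -> exists a b, normc a = 1 /\ f = aff a b.
Proof.
move=> fv; have htf x : ht (f x) = ht x by case: fv => w _ <-; exact: ht_hact_ev.
have [A fA] : exists A, f = mobius A by case: fv => w we <-; exact: hact_even_mobius (ev1 e1) _ we.
rewrite fA in fv htf *; have c0 := egroup_ev_mc fv; have d0 := md_neq0 c0.
exists (ma A / md A), (mb A / md A); split; last first.
  apply/funext => x; apply: H3_eq; last exact: htf.
  have := congr1 (odflt 0) (mobius_bd_hz x c0).
  by rewrite /mobius_bd c0 mul0r add0r (negbTE d0) /= mulrDl mulrAC => <-.
have := htf p0; rewrite /= /mobius_denom c0 mul0r add0r ComplexField.Normc.normc0 expr0n/= mul0r addr0 => E.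
have d1 : normc (md A) ^+ 2 = 1.
  by apply: (mulfI (ht_neq0 p0)); rewrite mulr1 -{1}E divfK// gt_eqF// normc_sqr_gt0.
have /eqP : normc (ma A / md A) * normc (md A) ^+ 2 = 1.
  rewrite expr2 mulrA -!ComplexField.Normc.normcM divfK//.
  have := eqP (valP A); rewrite det2 -/(ma A) -/(md A) -/(mc A) c0 mulr0 subr0 => ->.
  by rewrite ComplexField.Normc.normc1.
by rewrite d1 mulr1 => /eqP.
Qed.

Section Side.
Variables (t : Iv) (w0 : H3 R).
Hypothesis w0t : lb (emb w0) (e (val t)) = 0.
Hypothesis w0C : forall j, j != val t -> lb (emb w0) (e j) < 0.

Lemma vertical_doubled (j : Iv) : lb (poleI R) (refl (ev t) (ev j)) = 0.
Proof.
have tv : lb (poleI R) (ev t) = 0 by apply/eqP/(valP t).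
by rewrite -lb_refl_adj refl_id//; exact/eqP/(valP j).
Qed.

Definition cusp_polygon : set R[i] := [set hz x | x in doubled ev t].

Lemma chimney_doubled : chimney cusp_polygon = doubled ev t.
Proof.
apply/seteqP; split=> [x [y Dy yx] j jt|x Dx]; last by exists x.
rewrite !vertical_le -?yx; [|exact: vertical_doubled|exact/eqP/(valP j)].
by rewrite -!vertical_le; [exact: Dy|exact: vertical_doubled|exact/eqP/(valP j)].
Qed.

Lemma cusp_cover x : exists2 f, egroup ev f & doubled ev t (f x).
Proof.
have : setT x by [].
rewrite -(doubled_cover (ev1 e1) ev_cox (fun i => p0C (val i)) t).
case=> _ [w we <-] [y Dy <-]; exists (hact ev (rev w)); first by exists (rev w); rewrite //= size_rev.
by rewrite hact_revK//; exact: ev1.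
Qed.

Lemma cusp_fundamental_domain : fundamental_domain (egroup ev) (chimney cusp_polygon).
Proof.
rewrite chimney_doubled; apply: (@doubled_fundamental _ _ _ (ev1 e1) ev_cox p0 _ t w0) => //.
  by move=> i; exact: p0C.
by move=> j jt; apply: w0C.
Qed.

Lemma cusp_fundamental_polygon : fundamental_polygon (egroup ev) cusp_polygon.
Proof.
have p0D : cinterior cusp_polygon (hz p0).
  apply/hinterior_chimney; rewrite chimney_doubled.
  by apply: (doubled_interior (ev1 e1) ev_cox) => i; exact: p0C.
split.
- split; first by exists (hz p0).
  pose nn (j : Iv * bool) := if j.2 then ev j.1 else refl (ev t) (ev j.1).
  pose l j := (Complex (nn j).1.1.1 (nn j).1.1.2, (nn j).2 / 2).
  have nv j : lb (poleI R) (nn j) = 0.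
    by case: j => j [] /=; [exact/eqP/(valP j)|exact: vertical_doubled].
  have n1 j : lb (nn j) (nn j) = 1 by case: j => j [] /=; rewrite ?lb_refl ev1.
  exists [set l j | j in [set j | j.1 != t]].
    split; first exact/finite_image/finite_finset.
    by move=> _ [j _ <-]; exact: vertical_neq0.
  have E x : doubled ev t x <-> forall j : Iv * bool, j.1 != t -> lb (emb x) (nn j) <= 0.
    split=> [Dx [j []] jt|Dx j jt]; [exact: (Dx j jt).1|exact: (Dx j jt).2|].
    by split; [exact: (Dx (j, true))|exact: (Dx (j, false))].
  apply/seteqP; split=> [_ [x /E Dx <-] _ [j jt <-]|z zP].
    by rewrite /= -(vertical_le x (nv j)); exact: Dx.
  exists (MkH3 z (ltr01 : 0 < 1 :> R)) => //; apply/E => j jt.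
  by rewrite (vertical_le _ (nv j)); apply: (zP (l j)); exists j.
- apply/seteqP; split=> // z _; pose x := MkH3 z (ltr01 : 0 < 1 :> R).
  have : setT x by [].
  rewrite -(doubled_cover (ev1 e1) ev_cox (fun i => p0C (val i)) t).
  case=> _ [w we <-] [y Dy wy]; have [A wA] := hact_even_mobius (ev1 e1) we.
  have VA : egroup ev (mobius A) by rewrite -wA; exists w.
  exists A => //; exists (hz y); first by exists y.
  by rewrite mobius_bd_hz ?egroup_ev_mc// -wA wy.
- move=> A VA Aid; apply/seteqP; split=> // z [zP [z' zP' Az]].
  have [_ _ /(_ _ VA Aid)] := cusp_fundamental_domain.
  pose x := MkH3 z' (ltr01 : 0 < 1 :> R).
  have {}Az : hz (mobius A x) = z.
    by move: Az; rewrite (mobius_bd_hz x) ?egroup_ev_mc// => /(congr1 (odflt 0)).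
  move/seteqP => [/(_ (mobius A x)) h _]; apply: h; split.
    by apply/hinterior_chimney; rewrite Az.
  by exists x => //; apply/hinterior_chimney.
Qed.

Lemma cusp_Z2 : contains_Z2 (egroup ev).
Proof.
apply: lattice_Z2; [exact/egroup_group/ev1|exact: egroup_ev_aff|].
have [M MP] := cusp_bounded e1 p0C linf pack.
have bd (c z : R[i]) : normc (z - c) ^+ 2 <= M -> normc z <= M + 1 + normc c.
  move=> h; rewrite -[X in normc X](subrK c); apply: le_trans (le_normcD _ _) _.
  by rewrite lerD2r; have := normc_ge0 (z - c); nra.
have cb y : cell ev y -> normc (hz y - hz p0) ^+ 2 <= M.
  by move=> Cy; apply: MP => i /eqP iv; exact: (Cy (exist _ i iv)).
pose p1 := hact ev [:: t] p0.
exists (M + 1 + normc (hz p0) + normc (hz p1)) => x.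
have [f fv fD] := cusp_cover x; exists f => //.
(* The chimney ignores heights, so the point is put at the height of [p0]: there [ch] determines
   horizontal distance, and the bound around [p0] transfers to tau Q around [p1]. *)
have {fD} : doubled ev t (MkH3 (hz (f x)) (ht_gt0 p0)).
  by rewrite -chimney_doubled; exists (f x).
move=> /(doubledP (ev1 e1) ev_cox)[/cb/bd/le_trans|Ct].
  by apply; rewrite lerDl normc_ge0.
suff /bd/le_trans : normc (hz (f x) - hz p1) ^+ 2 <= M.
  by apply; rewrite lerD2r lerDl normc_ge0.
have := cb _ Ct; set y := MkH3 _ _ in Ct *.
have := ch_hact (ev1 e1) [:: t] y p1; rewrite {1}/p1 -[X in ch _ X](_ : p0 = _); last first.
  by have := hact_revK (ev1 e1) [:: t] p0.
rewrite !chE !ht_hact_ev subrr expr0n/= !addr0.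
by move=> /addrI/(mulIf _) -> //; rewrite invr_neq0// !mulf_neq0// ht_neq0.
Qed.

(* A point is outside the isometric spheres iff no element of the group raises
   it, and a reflection in a non-vertical side raises the points beyond it. *)
Lemma ford_doubled : doubled e (val t) = outside_isometric_spheres (egroup e) `&` chimney cusp_polygon.
Proof.
have tau_ht x : ht (hact e [:: val t] x) = ht x by rewrite -(hact_ev [:: t]) ht_hact_ev.
rewrite chimney_doubled; apply/seteqP; split=> [x Dx|y [yO yV]].
  split; last by move=> j jt; apply: Dx.
  move=> A [GA nA]; rewrite outside_denom; last first.
    apply/eqP => c0; apply: nA; exists A => //; split=> //.
    by rewrite /mobius_bd c0 eqxx.
  case: GA => w we <-.
  have low u z : cell e z -> ht (hact e u z) <= ht z.
    move=> Cz; rewrite ht_le emb_hact//; apply: (lb_act_cone e1 e_cox u _ Cz).1.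
    exact: cone_poleI.
  move/(doubledP e1 e_cox): Dx => [/low//|/(low (w ++ [:: val t]))].
  by rewrite tau_ht hact_cat /= -[hrefl _ (hrefl _ x)]/(hact e (rev [:: val t]) (hact e [:: val t] x)) hact_revK.
have even u : ~~ odd (size u) -> ht (hact e u y) <= ht y.
  move=> ue; have [A uA] := hact_even_mobius e1 ue.
  have GA : egroup e (mobius A) by rewrite -uA; exists u.
  have [sA|nA] := pselect (stab_infty (egroup e) (mobius A)).
    move: sA; rewrite (stab_infty_ev e1 p0C linf e_cox) uA => -[w _ <-].
    by rewrite ht_hact_ev.
  rewrite uA -outside_denom; first exact: yO.
  apply/eqP => c0; apply: nA; exists A => //; split=> //.
  by rewrite /mobius_bd c0 eqxx.
(* Composing with tau, which keeps heights, makes an odd word even. *)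
have all_le u : ht (hact e u y) <= ht y.
  have [uo|ue] := boolP (odd (size u)); last exact: even.
  by rewrite -tau_ht -[hact e _ _]/(hact e (val t :: u) y); apply: even; rewrite /= uo.
(* A point of maximal height in its orbit satisfies the non-vertical inequalities, since the
   reflection in a violated side would raise it. *)
have top u : ht (hact e u y) = ht y -> cell ev (hact e u y) -> cell e (hact e u y).
  move=> uh Cv i; have [iv|iv] := eqVneq (lb (poleI R) (e i)) 0.
    by apply: (Cv (exist _ i _)); exact/eqP.
  have := all_le (i :: u); rewrite -uh ht_le /= emb_hrefl// /refl lbBr lbZr.
  have : lb (poleI R) (e i) < 0 by rewrite lt_neqAle iv linf.
  move: (lb (poleI R) (e i)) (lb (poleI R) _) => a b a0.
  by rewrite gerBl -mulrA pmulr_rge0// nmulr_lge0.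
apply/(doubledP e1 e_cox); move/(doubledP (ev1 e1) ev_cox): yV => [Cy|Cy].
  by left; exact: (top [::]).
by right; apply: top; rewrite ?tau_ht//; move: Cy; rewrite hact_ev.
Qed.

Lemma DF_doubled : DF_domain (egroup e) (doubled e (val t)).
Proof.
split; first exact: (doubled_fundamental e1 e_cox p0C w0t w0C).
- split; first by rewrite (stab_infty_ev e1 p0C linf e_cox); exact: cusp_Z2.
  exists cusp_polygon; rewrite (stab_infty_ev e1 p0C linf e_cox).
  split; [exact: cusp_fundamental_polygon|exact: cusp_fundamental_domain|exact: ford_doubled].
- by exists w0; exact: (doubled_dirichlet e1 e_cox p0C w0t w0C).
Qed.

End Side.
End Cusp.
End Ford.

(** * Ideal vertices as isotropic vectors *)

Section IdealVertex.
Variable R : realType.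
Implicit Types (x y : H3 R) (n v : lorentz R) (A : SL2 R).

(* The isotropic vector representing a point of the sphere at infinity. *)
Definition bdvec (v : option R[i]) : lorentz R :=
  if v is Some z then (complex.Re z, complex.Im z, 1, normc z ^+ 2) else poleI R.

(** Passage to the limit at the boundary: if the product were positive, points of Q close enough to
    the ideal vertex would violate n. For a finite vertex, K bounds the variation of the numerator
    in [lb_emb_coord]. *)
Lemma lb_bdvec_le (Q : set (H3 R)) (v : option R[i]) n :
  (forall x, Q x -> lb (emb x) n <= 0) -> ideal_vertex Q v -> lb (bdvec v) n <= 0.
Proof.
move=> Qn; case: v => [z|] h.
  rewrite leNgt; apply/negP => c0.
  pose K := `|n.1.1.1| + `|n.1.1.2| + `|n.1.2| * `|complex.Re z| + `|n.1.2| * `|complex.Im z| + `|n.1.2| + 1.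
  have K0 : 0 < K by rewrite ltr_wpDl// !addr_ge0// mulr_ge0.
  set c := lb _ _ in c0.
  pose s := Num.min 1 (c / K); have s0 : 0 < s by rewrite lt_min ltr01 divr_gt0.
  have s1 : s <= 1 by rewrite ge_min lexx.
  have sK : s * K <= c by rewrite -ler_pdivlMr// ge_min lexx orbT.
  have [x Qx xz] := h _ (exprn_gt0 2 s0).
  have := Qn x Qx; rewrite leNgt => /negP; apply.
  rewrite lb_emb_coord divr_gt0 ?ht_gt0//; move: xz; rewrite normc_sqr ReB ImB.
  pose p := complex.Re (hz x) - complex.Re z; pose q := complex.Im (hz x) - complex.Im z.
  rewrite -/p -/q => pq.
  have -> : complex.Re (hz x) = complex.Re z + p by rewrite /p addrC subrK.
  have -> : complex.Im (hz x) = complex.Im z + q by rewrite /q addrC subrK.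
  have cE : c = n.1.1.1 * complex.Re z + n.1.1.2 * complex.Im z -
      (n.2 + n.1.2 * (complex.Re z ^+ 2 + complex.Im z ^+ 2)) / 2.
    by rewrite /c lb_unfold /= normc_sqr; field.
  have t2 := exprn_gt0 2 (ht_gt0 x).
  have ps : `|p| <= s.
    by rewrite -ler_sqr ?nnegrE ?(ltW s0)// real_normK ?num_real//; have := sqr_ge0 q; lra.
  have qs : `|q| <= s.
    by rewrite -ler_sqr ?nnegrE ?(ltW s0)// real_normK ?num_real//; have := sqr_ge0 p; lra.
  have bd (a b : R) : `|b| <= s -> - (`|a| * s) <= a * b.
    by move=> bs; rewrite lerNl -mulrN (le_trans (ler_norm _))// normrM normrN ler_wpM2l.
  have rs : `|(p ^+ 2 + q ^+ 2 + ht x ^+ 2) / 2| <= s.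
    rewrite ger0_norm; last by rewrite divr_ge0// !addr_ge0// sqr_ge0.
    by rewrite ler_pdivrMr//; nra.
  have h1 := bd n.1.1.1 _ ps; have h2 := bd n.1.1.2 _ qs.
  have h3 := bd (- (n.1.2 * complex.Re z)) _ ps.
  have h4 := bd (- (n.1.2 * complex.Im z)) _ qs.
  have h5 := bd (- n.1.2) _ rs.
  rewrite !normrN !normrM in h3 h4 h5.
  apply: (@lt_le_trans _ _ (c - s * K + s)); first by rewrite ltr_wpDl// subr_ge0.
  by rewrite {1}cE /K; lra.
rewrite /= lb_poleI leNgt; apply/negP => k0.
pose k := - n.1.2 / 2; rewrite -/k in k0.
(* Outside this radius the quadratic term, with coefficient k, dominates the linear and constant
   ones; the linear terms are absorbed by completing squares. *)
have [x Qx xM] := h (2 / k * ((n.1.1.1 ^+ 2 + n.1.1.2 ^+ 2) / (2 * k) + `|n.2| / 2)).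
have := Qn x Qx; rewrite leNgt => /negP; apply.
rewrite lb_emb_coord divr_gt0 ?ht_gt0//; move: xM; rewrite normc_sqr.
have -> : n.1.2 = - (2 * k) by rewrite /k; field.
have t2 := exprn_gt0 2 (ht_gt0 x).
move: (complex.Re _) (complex.Im _) (ht x ^+ 2) t2 n.1.1.1 n.1.1.2 (ler_norm n.2) => p q s s0 a b.
move: n.2 `|n.2| => m m' mm.
rewrite mulrAC ltr_pdivrMr// => h1.
have h2 (u w : R) : - (k * w ^+ 2 / 2 + u ^+ 2 / (2 * k)) <= u * w.
  have -> : u ^+ 2 / (2 * k) = k / 2 * (u / k) ^+ 2 by field; rewrite gt_eqF.
  have {2}-> : u = k * (u / k) by field; rewrite gt_eqF.
  by have := sqr_ge0 (w + u / k); move: (u / k) => g; nra.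
have := h2 a p; have := h2 b q; rewrite [(_ + b ^+ 2) / _]mulrDl in h1.
move: (a ^+ 2 / (2 * k)) (b ^+ 2 / (2 * k)) h1 => f g h1 h3 h4.
have : 0 < k * s by rewrite mulr_gt0.
lra.
Qed.

(** For finite z the matrix is [y y^*] with [y = (z, 1)], and A sends y to [(a z + b, 0)]. *)
Lemma lor_bdvec A (v : option R[i]) : mobius_bd A v = None ->
  exists2 k : R, 0 < k & lor (val A) (bdvec v) = k *: poleI R.
Proof.
case: v => [z|] /=; last first.
  case: eqVneq => // c0 _; exists (normc (ma A) ^+ 2); last exact: lor_poleI_eq.
  apply: normc_sqr_gt0; apply: contraTneq (oner_neq0 R[i]) => a0.
  by have := eqP (valP A); rewrite det2 -/(ma A) -/(mc A) a0 c0 mulr0 mul0r subr0 => <-; rewrite eqxx.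
case: eqVneq => // cd _; pose u := ma A * z + mb A.
have dE : md A = - (mc A * z) by apply/eqP; rewrite -addr_eq0 addrC cd.
exists (normc u ^+ 2).
  apply: normc_sqr_gt0; apply: contraTneq (oner_neq0 R[i]) => u0.
  have := eqP (valP A); rewrite det2 -/(ma A) -/(mb A) -/(mc A) -/(md A) dE.
  have -> : mb A = - (ma A * z) by apply/eqP; rewrite -addr_eq0 addrC -/u u0.
  by move=> <-; rewrite negbK; apply/eqP; ring.
apply: herm_inj; rewrite herm_lor hermZ.
have sqrE (y : R[i]) : Complex (normc y ^+ 2) 0 = y * conjc y.
  by apply: complex_eq; rewrite !ReImE /= ?normc_sqr; ring.
have zE : Complex (complex.Re z) (complex.Im z) = z by case: (z).
have zcE : Complex (complex.Re z) (- complex.Im z) = conjc z by case: (z).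
have cu : conjc u = conjc (ma A) * conjc z + conjc (mb A) by rewrite rmorphD rmorphM.
have cdE : conjc (md A) = - (conjc (mc A) * conjc z) by rewrite dE rmorphN rmorphM.
have c00 : Complex 0 0 = 0 :> R[i] by [].
have c10 : Complex 1 0 = 1 :> R[i] by [].
apply: mx2P; rewrite !mulmx2 !mxE /= -/(ma A) -/(mb A) -/(mc A) -/(md A) zE zcE;
  rewrite ?cdE ?dE !sqrE ?cu /u ?oppr0 ?c00 ?c10; ring.
Qed.

End IdealVertex.

(** * Transport of the normals by a Moebius transformation *)

Section Conjugation.
Variables (R : realType) (A : SL2 R) (I : finType) (e : I -> lorentz R).
Hypothesis e1 : forall i, lb (e i) (e i) = 1.

Definition ecj (i : I) : lorentz R := lor (val A) (e i).

Lemma ecj1 i : lb (ecj i) (ecj i) = 1.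
Proof. by rewrite lb_lorS. Qed.

Lemma lb_ecj x i : lb (emb x) (ecj i) = lb (emb (mobius (invS A) x)) (e i).
Proof. by rewrite emb_mobius -[RHS](lb_lorS A) lorK_invS. Qed.

Lemma lb_mobius_ecj x i : lb (emb (mobius A x)) (ecj i) = lb (emb x) (e i).
Proof. by rewrite emb_mobius lb_lorS. Qed.

Lemma hact_ecj w x : hact ecj w (mobius A x) = mobius A (hact e w x).
Proof.
apply: emb_inj; rewrite emb_hact ?emb_mobius ?emb_hact//; last exact: ecj1.
by elim: w => //= i w ->; rewrite /refl lb_lorS lorB lorZ.
Qed.

Lemma conj_egroup : conj_group A (egroup e) = egroup ecj.
Proof.
have hE w : hact ecj w \o mobius A = mobius A \o hact e w.
  by apply/funext => x; exact: hact_ecj.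
apply/seteqP; split=> [h [_ [w we <-] hA]|_ [w we <-]].
  exists w => //; apply/funext => x; rewrite -(mobiusK_inv A x).
  by rewrite -[LHS]/((hact ecj w \o mobius A) _) hE -hA.
by exists (hact e w); [exists w|exact: hE].
Qed.

End Conjugation.

Theorem theorem7p1 (R : realType) (Q : set (H3 R)) :
  finite_sided_polyhedron Q ->
  (hvolume Q < +oo)%E ->
  dihedral_angles_submultiples Q ->
  exists K : set (H3 R -> H3 R),
    [/\ index2_subgroup (reflection_group Q) K,
        kleinian K,
        exists D, double_dirichlet_domain K D &
        forall (v : option (complex.complex R)) (A : SL2 R),
          ideal_vertex Q v -> mobius_bd A v = None ->
          exists D, DF_domain (conj_group A K) D].
Proof.
move=> Qpoly Qvol Qang; have [I [e [p0 [e1 QE p0C irr]]]] := ex_family Qpoly.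
have e_cox := gram_cox e1 QE p0C irr Qang.
have [t _] := nonempty_family e1 QE Qvol; exists (egroup e); split.
- by rewrite (reflection_groupE e1 QE p0C irr); exact: (egroup_index2 e1 t).
- exact: (egroup_kleinian e1 e_cox p0C).
- have [w0 [w0t w0C]] := irr t; have [w1 [w01 w1t w1C]] := second_center e1 w0t w0C.
  exists (doubled e t); split; first exact: (doubled_fundamental e1 e_cox p0C w0t w0C).
  exists w0, w1; split=> //; first exact: (doubled_dirichlet e1 e_cox p0C w0t w0C).
  exact: (doubled_dirichlet e1 e_cox p0C w1t w1C).
- move=> v A Qv Av; rewrite (conj_egroup A e1).
  have e1' := ecj1 A e1.
  have e_cox' i j : i != j -> coxeter_pair (ecj A e i) (ecj A e j).
    by rewrite /coxeter_pair !lb_lorS; exact: e_cox.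
  have p0C' i : lb (emb (mobius A p0)) (ecj A e i) < 0 by rewrite lb_mobius_ecj.
  have linf i : lb (poleI R) (ecj A e i) <= 0.
    have [k k0 kE] := lor_bdvec Av.
    have : lb (bdvec v) (e i) <= 0 by apply: (lb_bdvec_le _ Qv) => x /QE.
    by rewrite -(lb_lorS A) kE lbZl pmulr_rle0.
  (* The bound is pulled back to Q by the isometry, since it is expressed by [lb] and [ch] only. *)
  have pack r : 0 < r -> exists N : nat, forall (n : nat) (xs : 'I_n -> H3 R),
      (forall j i, lb (emb (xs j)) (ecj A e i) <= - r) ->
      (forall j k, j != k -> 1 + r <= ch (xs j) (xs k)) -> (n <= N)%N.
    move=> r0; have [|N NP] := @packing R I e Q r e1 _ Qvol r0; first by move=> x /QE.
    exists N => n xs xe xx; apply: (NP n (fun j => mobius (invS A) (xs j))).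
      by move=> j i; rewrite -lb_ecj.
    by move=> j k jk; rewrite /ch !emb_mobius lb_lorS; exact: xx.
  have [s _] := ex_vertical e1' p0C' linf pack.
  have [w [ws wC]] := irr (val s); exists (doubled (ecj A e) (val s)).
  apply: (@DF_doubled _ _ _ e1' e_cox' _ p0C' linf pack s (mobius A w)).
    by rewrite lb_mobius_ecj.
  by move=> j js; rewrite lb_mobius_ecj; exact: wC.
Qed.
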